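(* For every tree $T$ with $m$ edges there exists a natural number $k_h(T)$ such that the following holds: if $G$ is a $k_h(T)$-edge-connected graph whose number of edges is divisible by $m$, then $G$ has a $T^*$-decomposition. In particular, if $d$ is the diameter of $T$, then every $k_h(T)$-edge-connected graph $G$ whose number of edges is divisible by $m$ and whose girth is greater than $d$ has a $T$-decomposition.
   Context: All graphs are finite and loopless but may have multiple edges. A graph $H$ is a homomorphic copy of a graph $G$ if $H$ can be obtained from $G$ by identifying some of its vertices and keeping all edges; equivalently, there is a homomorphism from $G$ to $H$ that is bijective on edge sets. A $T^*$-decomposition of $G$ is a partition of $E(G)$ into subgraphs that are homomorphic copies of $T$. A $T$-decomposition of $G$ is a partition of $E(G)$ into subgraphs isomorphic to $T$. *)

(* Defs.v *)
From mathcomp Require Import all_boot.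
Set Implicit Arguments. Unset Strict Implicit. Unset Printing Implicit Defensive.

(* A finite loopless multigraph: vertex type, edge type, and for each edge
   its two (distinct) end-vertices; the order src/tgt carries no meaning. *)
Record mgraph := MGraph {
  vert : finType;
  edge : finType;
  src : edge -> vert;
  tgt : edge -> vert;
  loopless : forall e, src e != tgt e }.

Definition joins (G : mgraph) (e : edge G) (x y : vert G) : bool :=
  ((src e == x) && (tgt e == y)) || ((src e == y) && (tgt e == x)).

Definition adj_minus (G : mgraph) (F : {set edge G}) : rel (vert G) :=
  fun x y => [exists e, (e \notin F) && joins e x y].

Definition adj (G : mgraph) : rel (vert G) := adj_minus (set0 : {set edge G}).

Definition connected (G : mgraph) : Prop :=
  forall x y : vert G, connect (@adj G) x y.

Definition edge_connected (k : nat) (G : mgraph) : Prop :=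
  forall F : {set edge G}, #|F| < k ->
    forall x y : vert G, connect (adj_minus F) x y.

Definition is_cycle (G : mgraph) (k : nat) (vs : 'I_k -> vert G)
    (es : 'I_k -> edge G) : Prop :=
  [/\ 0 < k, injective vs, injective es &
      forall i : 'I_k, joins (es i) (vs i) (vs (ordS i))].

Definition acyclic (G : mgraph) : Prop :=
  forall k vs es, ~ @is_cycle G k vs es.

Definition is_tree (T : mgraph) : Prop :=
  [/\ 0 < #|vert T|, connected T & acyclic T].

(* girth(G) > d : every cycle has length > d (girth of an acyclic graph = oo) *)
Definition girth_gt (G : mgraph) (d : nat) : Prop :=
  forall k vs es, @is_cycle G k vs es -> d < k.

Fixpoint reach_in (G : mgraph) (n : nat) (x y : vert G) : bool :=
  if n is n'.+1 then reach_in n' x y || [exists z, reach_in n' x z && adj z y]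
  else x == y.

(* graph distance (for connected graphs; #|V| if unreachable) *)
Definition dist (G : mgraph) (x y : vert G) : nat :=
  find (fun n => reach_in n x y) (iota 0 #|vert G|).

Definition diameter (G : mgraph) : nat :=
  \max_(x : vert G) \max_(y : vert G) dist x y.

Definition hom_copy_on (T G : mgraph) (S : {set edge G}) : Prop :=
  exists (fV : vert T -> vert G) (fE : edge T -> edge G),
    [/\ injective fE, forall e, fE e \in S, forall e', e' \in S -> exists e, fE e = e'
      & forall e, joins (fE e) (fV (src e)) (fV (tgt e))].

Definition iso_copy_on (T G : mgraph) (S : {set edge G}) : Prop :=
  exists (fV : vert T -> vert G) (fE : edge T -> edge G),
    [/\ injective fV, injective fE, forall e, fE e \in S,
        forall e', e' \in S -> exists e, fE e = e'
      & forall e, joins (fE e) (fV (src e)) (fV (tgt e))].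

Definition T_star_decomposition (T G : mgraph) : Prop :=
  exists P : {set {set edge G}},
    partition P [set: edge G] /\ forall S, S \in P -> hom_copy_on T S.

Definition T_decomposition (T G : mgraph) : Prop :=
  exists P : {set {set edge G}},
    partition P [set: edge G] /\ forall S, S \in P -> iso_copy_on T S.

(* Main.v *)
(* Split the vertices by a maximum cut (A, B).  The crossing edges, which form a
   highly edge-connected bipartite graph, are packed into highly connected
   groups.  By matroid intersection the first group contains a subgraph using
   few edges at each vertex of B but such that splitting off its edges at B
   leaves a highly connected graph on A; the second group serves B likewise.
   Root T at a leaf.  All edges of the tree but the leaf edge are found by
   letting tokens walk along an Euler orientation of the rest of the two groups,
   one token for every split pair, and one for each of fewer than m edges inside
   A (and possibly one crossing edge) that balance the two sides.  Which edge of a split pair becomes the leaf edge of its copy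
   is a choice of orientation of the split graph, so by the theorem of Lovasz,
   Thomassen, Wu and Zhang (modulo-k orientations of highly connected graphs)
   the copies can be chosen such that all remaining degrees vanish modulo 2m.
   At each vertex of an Euler orientation of the rest, indegree and outdegree
   are then equal and divisible by m, so that the rest splits into m classes
   with equal degrees, one for each edge of T, and the tokens finish the job.
   For the second part, a homomorphic copy of T that is not injective on
   vertices contains a cycle of length at most the diameter of T. *)
Require Import Defs.
From mathcomp Require Import all_boot all_order all_algebra.
From mathcomp Require Import zify.
Set Implicit Arguments. Unset Strict Implicit. Unset Printing Implicit Defensive.
Local Open Scope int_scope.
Local Open Scope nat_scope.

(** * Matroid intersection *)

(** The two edges of a split pair have an end in common, and the token of the pair starts there. Its
    walk is therefore fixed before the leaf edge is chosen, and the choice only moves the far end of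
    one edge within A (or within B). This separates the two orientation problems from the walks and
    from each other. Each problem is solvable only if the prescribed residues add up to the number
    of split edges modulo 2m. For both sides this comes down to the difference between the numbers
    of edges inside A and inside B modulo m, which the edges inside A absorb, and to a parity, which
    the crossing edge repairs.

    The obstacle in the first phase is that tokens must leave a vertex along fresh edges although
    arrivals are only bounded, not prescribed. The edge classes therefore grow by a factor 4 from
    one tree edge to the next, so that a vertex needs an outdegree exponential in m for every token
    starting there. This is why the split pairs may take only a small share of the edges at each
    starting vertex. In the second phase equal indegrees and outdegrees replace the growth. *)

Definition is_rank (E : finType) (r : {set E} -> nat) :=
  [/\ r set0 = 0, forall e, r [set e] <= 1,
      forall A B : {set E}, A \subset B -> r A <= r B
    & forall A B : {set E}, r (A :|: B) + r (A :&: B) <= r A + r B].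

Section MatroidIntersection.
Variable E : finType.
Implicit Types (r : {set E} -> nat) (S U I : {set E}).

Lemma rankU1 r U e : is_rank r -> r (e |: U) <= r U + r [set e].
Proof. by case=> r0 r1 rm rs; move: (rs U [set e]); rewrite setUC; lia. Qed.

Lemma contract_rank r e : is_rank r -> is_rank (fun U => r (e |: U) - r [set e]).
Proof.
move=> hr; case: (hr) => r0 r1 rm rs; split.
- by rewrite setU0 subnn.
- by move=> f; have := rankU1 [set f] e hr; have := r1 f; lia.
- by move=> A B sAB; apply: leq_sub2r; apply: rm; apply: setUS.
- move=> A B; have := rs (e |: A) (e |: B).
  rewrite -setUUr -setUIr.
  have h X : r [set e] <= r (e |: X) by apply: rm; apply: subsetUl.
  have := h (A :&: B); have := h A; have := h B; have := h (A :|: B); lia.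
Qed.

(** Edmonds's theorem by deletion and contraction of an element [e]: if [U1] violates the bound
    after deletion and [U2] after contraction, then submodularity of both ranks makes [U1 :&: U2] or
    [U1 :|: (e |: U2)] violate it for [S]. A set of [n] elements whose ranks are at least [n] is a
    common independent set. *)
Theorem matroid_intersection r1 r2 S n :
  is_rank r1 -> is_rank r2 ->
  (forall U, U \subset S -> n <= r1 U + r2 (S :\: U)) ->
  exists I, [/\ I \subset S, #|I| = n, n <= r1 I & n <= r2 I].
Proof.
move: {2}#|S| (leqnn #|S|) => s.
elim: s S n r1 r2 => [|s IH] S n r1 r2 hs h1 h2 hU.
  have := hU set0 (sub0set _); move: hs.
  rewrite leqn0 cards_eq0 => /eqP->; rewrite setD0.
  case: h1 => -> _ _ _; case: h2 => -> _ _ _ => n0.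
  by exists set0; rewrite cards0 sub0set; split=> //; lia.
case: n hU => [|n] hU; first by exists set0; rewrite cards0 sub0set; split.
case: (set_0Vmem S) => [S0|[e eS]].
  have := hU set0 (sub0set _); rewrite S0 setD0.
  by case: h1 => -> _ _ _; case: h2 => -> _ _ _.
have hs' : #|S :\ e| <= s by move: hs; rewrite (cardsD1 e S) eS; lia.
case: (boolP [forall U : {set E}, (U \subset S :\ e) ==> (n.+1 <= r1 U + r2 ((S :\ e) :\: U))]).
  move=> /forallP hd; have [U us|I [IS cI I1 I2]] := IH (S :\ e) n.+1 r1 r2 hs' h1 h2.
    by have /implyP := hd U; apply.
  by exists I; split=> //; apply: subset_trans IS (subD1set _ _).
rewrite negb_forall => /existsP[U1]; rewrite negb_imply -ltnNge => /andP[U1S hU1].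
have eU1 : e \notin U1 by apply/negP=> /(subsetP U1S); rewrite !inE eqxx.
have U1S' : U1 \subset S by apply: subset_trans U1S (subD1set _ _).
have sD : S :\: (e |: U1) = (S :\ e) :\: U1 by rewrite setDDl.
case: (h1) => r10 r11 r1m r1s; case: (h2) => r20 r21 r2m r2s.
(* If [e] had rank 0 in one of the matroids, it could be added to that side of the partition given
   by [U1] at no cost, against [hU]. *)
have re1 : r1 [set e] = 1.
  apply/eqP; rewrite eqn_leq r11 lt0n; apply/negP=> /eqP r0.
  have := hU (e |: U1); rewrite subUset sub1set eS U1S' sD => /(_ isT).
  have := rankU1 U1 e h1; lia.
have re2 : r2 [set e] = 1.
  apply/eqP; rewrite eqn_leq r21 lt0n; apply/negP=> /eqP r0.
  have := hU U1 U1S'.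
  have -> : S :\: U1 = e |: ((S :\ e) :\: U1).
    apply/setP=> x; rewrite !inE; case: eqP => [->|] //=.
    by rewrite eS eU1.
  have := rankU1 ((S :\ e) :\: U1) e h2; lia.
case: (boolP [forall U : {set E}, (U \subset S :\ e) ==>
   (n <= (r1 (e |: U) - r1 [set e]) + (r2 (e |: ((S :\ e) :\: U)) - r2 [set e]))]).
  move=> /forallP hd.
  have [U us|I [IS cI I1 I2]] :=
    IH (S :\ e) n _ _ hs' (contract_rank e h1) (contract_rank e h2).
    by have /implyP := hd U; apply.
  have eI : e \notin I by apply/negP=> /(subsetP IS); rewrite !inE eqxx.
  exists (e |: I); split.
  - by rewrite subUset sub1set eS; apply: subset_trans IS (subD1set _ _).
  - by rewrite cardsU1 eI cI.
  - by move: I1; rewrite re1; have := r1m [set e] (e |: I) (subsetUl _ _); lia.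
  - by move: I2; rewrite re2; have := r2m [set e] (e |: I) (subsetUl _ _); lia.
rewrite negb_forall => /existsP[U2]; rewrite negb_imply -ltnNge => /andP[U2S hU2].
have eU2 : e \notin U2 by apply/negP=> /(subsetP U2S); rewrite !inE eqxx.
have U2S' : U2 \subset S by apply: subset_trans U2S (subD1set _ _).
have sD2 : e |: ((S :\ e) :\: U2) = S :\: U2.
  apply/setP=> x; rewrite !inE; case: eqP => [->|] //=.
  by rewrite eS eU2.
have := hU (U1 :|: (e |: U2)); rewrite !subUset sub1set eS U1S' U2S' => /(_ isT).
have := hU (U1 :&: U2) (subset_trans (subsetIl _ _) U1S').
have := r1s U1 (e |: U2).
have -> : U1 :&: (e |: U2) = U1 :&: U2.
  apply/setP=> x; rewrite !inE; case: eqP => [->|] //=.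
  by rewrite (negPf eU1).
have := r2s ((S :\ e) :\: U1) (S :\: U2).
have -> : ((S :\ e) :\: U1) :|: (S :\: U2) = S :\: (U1 :&: U2).
  apply/setP=> x; rewrite !inE; case: eqP => [->|] //=.
    by rewrite eS (negPf eU1) (negPf eU2).
  by rewrite -andb_orl -negb_and.
have -> : ((S :\ e) :\: U1) :&: (S :\: U2) = S :\: (U1 :|: (e |: U2)).
  apply/setP=> x; rewrite !inE; case: eqP => [->|_] /=; first by rewrite ?orbT ?andbF.
  by case: (x \in U1); case: (x \in U2); case: (x \in S).
move: hU2; rewrite re1 re2 sD2.
have := r1m [set e] (e |: U2) (subsetUl _ _).
have : r2 [set e] <= r2 (S :\: U2) by apply: r2m; rewrite sub1set inE eU2.
rewrite re1 re2; lia.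
Qed.

End MatroidIntersection.

Section CappedRank.
Variables (E C : finType).
(** The rank function of the partition matroid whose classes are the fibres of [f], with capacity
    [cap c] for class [c]. *)
Definition capped (f : E -> C) (cap : C -> nat) (U : {set E}) :=
  \sum_c minn (cap c) #|U :&: [set e | f e == c]|.

Lemma capped_rank f cap : is_rank (capped f cap).
Proof.
split; rewrite /capped.
- by rewrite big1 // => c _; rewrite set0I cards0 minn0.
- move=> e; rewrite (bigD1 (f e)) //= big1 ?addn0.
    by apply: leq_trans (geq_minr _ _) _; apply: leq_trans (subset_leq_card (subsetIl _ _)) _; rewrite cards1.
  move=> c cne; rewrite [_ :&: _](_ : _ = set0) ?cards0 ?minn0 //.
  by apply/setP=> x; rewrite !inE; case: eqP => // ->; rewrite eq_sym (negPf cne).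
- move=> A B sAB; apply: leq_sum => c _.
  have := subset_leq_card (setSI [set e | f e == c] sAB); lia.
- move=> A B; rewrite -!big_split /=; apply: leq_sum => c _.
  rewrite setIUl setIIl; set X := A :&: _; set Y := B :&: _.
  have := cardsUI X Y.
  have := subset_leq_card (subsetUl X Y); have := subset_leq_card (subsetUr X Y).
  lia.
Qed.

Lemma cards_fibre (f : E -> C) (U : {set E}) :
  #|U| = \sum_c #|U :&: [set e | f e == c]|.
Proof.
rewrite -sum1_card (partition_big f xpredT) //=; apply: eq_bigr => c _.
by rewrite -sum1_card; apply: eq_bigl => e; rewrite !inE.
Qed.

Lemma capped_full f cap (I : {set E}) : #|I| <= capped f cap I ->
  forall c, #|I :&: [set e | f e == c]| <= cap c.
Proof.
rewrite /capped (cards_fibre f) => h c; rewrite leqNgt; apply/negP=> hc.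
have : \sum_c minn (cap c) #|I :&: [set e | f e == c]| < \sum_c #|I :&: [set e | f e == c]|.
  rewrite (bigD1 c) //= [X in _ < X](bigD1 c) //= -addSn; apply: leq_add; first lia.
  by apply: leq_sum => i _; apply: geq_minr.
by move: h; lia.
Qed.

End CappedRank.

(** Giving every edge the weight 1/q is a fractional solution; an integral one comes from
    intersecting the partition matroids of tails and of heads. *)
Lemma degree_select (V E : finType) (tl hd : E -> V) (S : {set E}) (q : nat)
    (al be : V -> nat) : 0 < q ->
  (forall v, q * al v <= #|S :&: [set e | tl e == v]|) ->
  (forall v, #|S :&: [set e | hd e == v]| <= q * be v) ->
  exists I : {set E}, [/\ I \subset S,
    forall v, #|I :&: [set e | tl e == v]| = al v &
    forall v, #|I :&: [set e | hd e == v]| <= be v].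
Proof.
move=> q0 hal hbe.
have [U US|I [IS cI I1 I2]] := @matroid_intersection E _ _ S (\sum_v al v)
   (capped_rank tl al) (capped_rank hd be).
  have h2 : #|S :\: U| <= q * capped hd be (S :\: U).
    rewrite (cards_fibre hd) /capped big_distrr /=; apply: leq_sum => v _.
    have := subset_leq_card (setSI [set e | hd e == v] (subsetDl S U)).
    have := hbe v; case: leqP; nia.
  have h1 : q * (\sum_v al v) <= q * capped tl al U + #|S :\: U|.
    rewrite (cards_fibre tl (S :\: U)) /capped !big_distrr -big_split /=; apply: leq_sum => v _.
    have : #|S :&: [set e | tl e == v]| <= #|U :&: [set e | tl e == v]| + #|(S :\: U) :&: [set e | tl e == v]|.
      apply: leq_trans (leq_card_setU _ _); apply: subset_leq_card.
      by apply/subsetP=> e; rewrite !inE; case: (e \in U); case: (e \in S); case: (tl e == v).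
    have := hal v; case: leqP; nia.
  by rewrite -(leq_pmul2l q0) mulnDr; apply: leq_trans h1 _; rewrite leq_add2l.
exists I; split=> //; last by apply: capped_full; rewrite cI.
have h1 : #|I| <= capped tl al I by rewrite cI.
have hle := capped_full h1.
move: cI; rewrite (cards_fibre tl) => cI v.
apply/eqP; rewrite eqn_leq hle /= leqNgt; apply/negP=> hv.
have : \sum_c #|I :&: [set e | tl e == c]| < \sum_c al c.
  rewrite (bigD1 v) //= [X in _ < X](bigD1 v) //= -addSn; apply: leq_add; first lia.
  by apply: leq_sum => i _; apply: hle.
by rewrite cI ltnn.
Qed.

(** * Packing connected subgraphs *)

Definition cut (V E : finType) (a b : E -> V) (S : {set E}) (X : {set V}) : nat :=
  \sum_(e in S) ((a e \in X) (+) (b e \in X)).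

Section GraphicRank.
Variables (V E : finType) (a b : E -> V).
Import GRing.Theory.
Local Open Scope ring_scope.

Let n := #|V|.
Definition vvec (v : V) : 'rV[rat]_n := delta_mx 0 (enum_rank v).
Definition evec (e : E) := vvec (a e) - vvec (b e).
(** The graphic matroid is represented over the rationals, so that the rank axioms are those of
    dimensions of subspaces. *)
Definition espace (U : {set E}) : 'M[rat]_n := (\sum_(e in U) <<evec e>>)%MS.
Definition grk (U : {set E}) : nat := \rank (espace U).

Lemma espaceS (A B : {set E}) : A \subset B -> (espace A <= espace B)%MS.
Proof.
move=> sAB; apply/sumsmx_subP => e eA; apply: (sumsmx_sup e) => //.
exact: (subsetP sAB).
Qed.

Lemma grk_rank : is_rank grk.
Proof.
rewrite /grk; split.
- by rewrite /espace big_set0 mxrank0.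
- by move=> e; rewrite /espace big_set1 mxrank_gen rank_leq_row.
- by move=> A B sAB; apply: mxrankS; apply: espaceS.
- move=> A B; rewrite -(mxrank_sum_cap (espace A) (espace B)); apply: leq_add.
    apply: mxrankS; apply/sumsmx_subP => e; rewrite inE => /orP[] h.
      by apply: submx_trans (addsmxSl _ _); apply: (sumsmx_sup e).
    by apply: submx_trans (addsmxSr _ _); apply: (sumsmx_sup e).
  by apply: mxrankS; rewrite sub_capmx !espaceS ?subsetIl ?subsetIr.
Qed.

Lemma vvecE m v (M : 'M[rat]_(n, m)) : vvec v *m M = row (enum_rank v) M.
Proof. by rewrite /vvec -rowE. Qed.

(** The indicators of [X] and of its complement are two independent functionals that vanish on all
    edge vectors of [U]. *)
Lemma grk_cut0 (U : {set E}) (X : {set V}) x y :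
  cut a b U X = 0%N -> x \in X -> y \notin X -> (grk U + 2 <= n)%N.
Proof.
move=> c0 xX yX.
pose K : 'M[rat]_(n, 2) := \matrix_(i, j)
  (if j == 0 then enum_val i \in X else enum_val i \notin X)%:R.
have kerK : (espace U <= kermx K)%MS.
  apply/sumsmx_subP => e eU; rewrite genmxE; apply/sub_kermxP.
  rewrite /evec mulmxBl !vvecE; apply/rowP => j; rewrite !mxE !enum_rankK.
  have : ((a e \in X) (+) (b e \in X)) = false.
    move: c0; rewrite /cut (bigD1 e) //=; by case: addb.
  by case: (a e \in X); case: (b e \in X) => //; rewrite subrr.
have rK : (2 <= \rank K)%N.
  pose P : 'M[rat]_(2, n) := \matrix_(i, j) (if i == 0 then vvec x 0 j else vvec y 0 j).
  apply: (@mulmx1_min_rank _ _ _ _ K P 1%:M); rewrite mulmx1.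
  have rP i : row i P = if i == 0 then vvec x else vvec y.
    by apply/rowP => j; rewrite !mxE; case: ifP => _; rewrite !mxE.
  apply/row_matrixP => i; rewrite row_mul rP.
  case: ifP => hi; rewrite vvecE; apply/rowP => j; rewrite !mxE !enum_rankK.
    by rewrite xX eq_sym (eqP hi) eq_sym; case: eqP.
  rewrite yX (negPf yX); move: i j hi => [[|[|i]] hi] [[|[|j]] hj] //.
have := mxrankS kerK; rewrite mxrank_ker /grk.
have := rank_leq_row K; lia.
Qed.

Lemma grk_le (U : {set E}) : (0 < n)%N -> (grk U + 1 <= n)%N.
Proof.
case/card_gt0P => x _.
pose K : 'M[rat]_(n, 1) := const_mx 1.
have kerK : (espace U <= kermx K)%MS.
  apply/sumsmx_subP => e eU; rewrite genmxE; apply/sub_kermxP.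
  by rewrite /evec mulmxBl !vvecE; apply/rowP => j; rewrite !mxE subrr.
have rK : (1 <= \rank K)%N.
  apply: (@mulmx1_min_rank _ _ _ _ K (vvec x) 1%:M); rewrite mulmx1 vvecE.
  by apply/rowP => j; rewrite !mxE !ord1 eqxx.
have := mxrankS kerK; rewrite mxrank_ker /grk.
have := rank_leq_row K; lia.
Qed.

Section Components.
Variable U : {set E}.
Definition uadj : rel V :=
  [rel u v | [exists e in U, (a e == u) && (b e == v) || (a e == v) && (b e == u)]].

Lemma uadj_sym : connect_sym uadj.
Proof.
apply: sym_connect_sym => u v; apply: eq_existsb => e.
by congr (_ && _); rewrite orbC.
Qed.

Lemma uadj_edge e : e \in U -> fingraph.root uadj (a e) = fingraph.root uadj (b e).
Proof.
move=> eU; apply/eqP; rewrite root_connect; last exact: uadj_sym.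
by apply: connect1; apply/existsP; exists e; rewrite eU !eqxx.
Qed.

Definition comps := [set fingraph.root uadj v | v in V].

(** A functional that vanishes on the edge vectors is constant on components, hence a combination of
    their indicators. *)
Lemma grk_comps : (n <= grk U + #|comps|)%N.
Proof.
pose ind x : 'rV[rat]_n := \row_j (fingraph.root uadj (enum_val j) == x)%:R.
pose D := (\sum_(x in comps) <<ind x>>)%MS.
have rD : (\rank D <= #|comps|)%N.
  rewrite -sum1_card /D.
  apply: (big_ind2 (fun (M : 'M[rat]_n) k => \rank M <= k)%N).
  - by rewrite mxrank0.
  - move=> M k M' k' h h'; apply: leq_trans (mxrank_adds_leqif M M').1 _.
    exact: leq_add.
  - by move=> x _; rewrite mxrank_gen rank_leq_row.
suff : (kermx (espace U)^T <= D)%MS.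
  move/mxrankS; rewrite mxrank_ker mxrank_tr; have := rank_leq_row (espace U).
  by rewrite /grk; lia.
apply/row_subP => i; set f := row i _.
have fe e : e \in U -> f 0 (enum_rank (a e)) = f 0 (enum_rank (b e)).
  move=> eU; have : f *m (evec e)^T = 0.
    have : (evec e <= espace U)%MS.
      by apply: (sumsmx_sup e) => //; rewrite genmxE.
    case/submxP => M ->; rewrite trmx_mul mulmxA.
    by rewrite -row_mul mulmx_ker row0 mul0mx.
  rewrite -[f *m _]trmxK trmx_mul trmxK /evec mulmxBl !vvecE.
  by move/matrixP/(_ 0 0); rewrite !mxE => /eqP; rewrite subr_eq0 => /eqP.
have fc x y : connect uadj x y -> f 0 (enum_rank x) = f 0 (enum_rank y).
  case/connectP => p; elim: p x => [|z p IH] x /=; first by move=> _ ->.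
  case/andP => /existsP[e /andP[eU he]] hp hl; rewrite -(IH z) //.
  by case/orP: he => /andP[/eqP <- /eqP <-]; rewrite fe.
have -> : f = \sum_(x in comps) f 0 (enum_rank x) *: ind x.
  apply/rowP => j; rewrite summxE (bigD1 (fingraph.root uadj (enum_val j))) /=; last first.
    by apply/imsetP; exists (enum_val j).
  rewrite big1 ?addr0; last first.
    by move=> x /andP[_ hx]; rewrite !mxE eq_sym (negPf hx) mulr0.
  rewrite !mxE eqxx mulr1 -[in LHS](enum_valK j).
  have := fc _ _ (connect_root uadj (enum_val j)); rewrite !mxE; exact.
apply: summx_sub => x xc; apply: scalemx_sub.
by apply: (sumsmx_sup x) => //; rewrite genmxE.
Qed.

(** At least [2 * K] edges of [S] leave each component of [U]; none of them is in [U], and each is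
    counted for at most two components. *)
Lemma cross_comps (S : {set E}) K : 
  (forall X : {set V}, X != set0 -> X != setT -> 2 * K <= cut a b S X)%N ->
  (1 < #|comps|)%N -> (K * #|comps| <= #|S :\: U|)%N.
Proof.
move=> hS hc; rewrite -(leq_pmul2l (isT : (0 < 2)%N)) mulnA.
pose cl x := [set v | fingraph.root uadj v == x].
have h1 : (2 * K * #|comps| <= \sum_(x in comps) cut a b S (cl x))%N.
  rewrite -sum1_card big_distrr /=; apply: leq_sum => x xc; rewrite muln1; apply: hS.
    by case/imsetP: xc => v _ ->; apply/set0Pn; exists v; rewrite inE.
  apply/negP => /eqP hT; move: hc; rewrite ltnNge => /negP; apply.
  rewrite -(cards1 x); apply/subset_leq_card/subsetP => y /imsetP[v _ ->].
  by have := in_setT v; rewrite -hT !inE.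
apply: leq_trans h1 _; rewrite /cut exchange_big /=.
rewrite -sum1_card big_distrr /= (big_setID U) /= [X in (X + _)%N]big1; last first.
  move=> e /setIP[_ eU]; apply: big1 => x _; rewrite !inE (uadj_edge eU).
  by rewrite addbb.
rewrite add0n; apply: leq_sum => e _; rewrite muln1.
have h2 v : (\sum_(x in comps) (fingraph.root uadj v == x) <= 1)%N.
  apply: leq_trans (_ : (\sum_x (fingraph.root uadj v == x) <= 1)%N).
    by rewrite [X in (_ <= X)%N](bigID (mem comps)) /= leq_addr.
  rewrite (bigD1 (fingraph.root uadj v)) //= eqxx big1 // => x hx.
  by rewrite eq_sym (negPf hx).
apply: leq_trans (leq_add (h2 (a e)) (h2 (b e))).
rewrite -big_split /=; apply: leq_sum => x _; rewrite !inE.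
by do 2 case: eqP => _.
Qed.

End Components.
End GraphicRank.

(** The direct sum of copies of one matroid: the pair [(e, i)] is the element [e] in copy [i]. *)
Lemma rank_sum (E Idx : finType) (r : {set E} -> nat) : is_rank r ->
  is_rank (fun U : {set E * Idx} => \sum_i r [set e | (e, i) \in U]).
Proof.
case=> r0 r1 rm rs; split.
- by rewrite big1 // => i _; rewrite (_ : [set _ | _] = set0) //; apply/setP=> e; rewrite !inE.
- case=> e j; rewrite (bigD1 j) //= big1 ?addn0.
    by rewrite (_ : [set _ | _] = [set e]) //; apply/setP=> x; rewrite !inE xpair_eqE eqxx andbT.
  move=> i hi; rewrite (_ : [set _ | _] = set0) //; apply/setP=> x.
  by rewrite !inE xpair_eqE (negPf hi) andbF.
- move=> A B sAB; apply: leq_sum => i _; apply: rm; apply/subsetP=> e.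
  by rewrite !inE; apply: (subsetP sAB).
- move=> A B; rewrite -!big_split /=; apply: leq_sum => i _.
  have := rs [set e | (e, i) \in A] [set e | (e, i) \in B].
  rewrite (_ : _ :|: _ = [set e | (e, i) \in A :|: B]); last by apply/setP=> x; rewrite !inE.
  by rewrite (_ : _ :&: _ = [set e | (e, i) \in A :&: B]) //; apply/setP=> x; rewrite !inE.
Qed.

(* Intersecting the sum of #|Idx| graphic matroids with the partition matroid of f. *)
Theorem pack_connected (V E C Idx : finType) (a b : E -> V) (S : {set E}) (K : nat)
    (f : E * Idx -> C) (cap : C -> nat) : 0 < K ->
  (forall X : {set V}, X != set0 -> X != setT -> 2 * K <= cut a b S X) ->
  (forall c, #|[set p | (p.1 \in S) && (f p == c)]| <= K * cap c) ->
  exists I : {set E * Idx}, [/\ forall p, p \in I -> p.1 \in S,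
    forall i (X : {set V}), X != set0 -> X != setT -> 0 < cut a b [set e | (e, i) \in I] X
    & forall c, #|I :&: [set p | f p == c]| <= cap c].
Proof.
move=> K0 hS hcap.
have NS : #|Idx| * (#|V| - 1) = \sum_(i : Idx) (#|V| - 1) by rewrite sum_nat_const.
pose SN := [set p : E * Idx | p.1 \in S].
have [U US|I [IS cI I1 I2]] := @matroid_intersection _ _ _ SN (#|Idx| * (#|V| - 1))
   (rank_sum Idx (grk_rank a b)) (capped_rank f cap).
  have h2 : #|SN :\: U| <= K * capped f cap (SN :\: U).
    rewrite (cards_fibre f) /capped big_distrr /=; apply: leq_sum => c _.
    have : #|(SN :\: U) :&: [set e | f e == c]| <= #|[set p | (p.1 \in S) && (f p == c)]|.
      by apply/subset_leq_card/subsetP => p; rewrite !inE => /andP[/andP[_ ->] ->].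
    by move=> h; rewrite minnMr leq_min (leq_trans h (hcap c)) leq_pmull.
  have h1 : K * (#|Idx| * (#|V| - 1)) <= K * (\sum_i grk a b [set e | (e, i) \in U]) + #|SN :\: U|.
    rewrite (cards_fibre snd (SN :\: U)) big_distrr -big_split /=.
    rewrite NS.
    rewrite big_distrr /=; apply: leq_sum => i _; set Ui := [set e | _].
    have -> : #|(SN :\: U) :&: [set e | e.2 == i]| = #|S :\: Ui|.
      have pinj : injective (fun e : E => (e, i)) by move=> x y [].
      rewrite -(card_imset _ pinj); apply: eq_card => [[e j]].
      apply/idP/imsetP => [|[x]].
        by rewrite !inE /= => /andP[/andP[hU eS] /eqP hj]; exists e; rewrite -?hj // !inE -hj hU.
      by rewrite !inE => /andP[hU xS] [-> ->]; rewrite hU xS /=.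
    (* A copy in which [Ui] has c > 1 components lacks at most c - 1 of the full rank, and
       [cross_comps] finds [K] times c edges outside [Ui] to pay for it. *)
    have hg := grk_comps a b Ui; case: (leqP #|comps a b Ui| 1) => hc.
      apply: leq_trans (leq_addr _ _); rewrite leq_pmul2l // leq_subLR addnC.
      by apply: leq_trans hg _; rewrite leq_add2l.
    apply: leq_trans (leq_add (leqnn _) (cross_comps hS hc)).
    by rewrite -mulnDr leq_pmul2l //; apply: leq_trans (leq_subr _ _) hg.
  by rewrite -(leq_pmul2l K0) mulnDr; apply: leq_trans h1 _; rewrite leq_add2l.
exists I; split.
- by move=> p /(subsetP IS); rewrite inE.
- move=> i X X0 XT; rewrite lt0n; apply/negP => /eqP hX.
  case/set0Pn: X0 => x xX; move: XT; rewrite -subTset => /subsetPn[y _ yX].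
  have := grk_cut0 hX xX yX => hi.
  have hb j : grk a b [set e | (e, j) \in I] <= #|V| - 1.
    have V0 : 0 < #|V| by apply/card_gt0P; exists x.
    by have := grk_le a b [set e | (e, j) \in I] V0; lia.
  (* The total rank is the largest possible, so no single copy may fall short. *)
  have : \sum_j grk a b [set e | (e, j) \in I] < #|Idx| * (#|V| - 1).
    rewrite NS.
    rewrite (bigD1 i) //= [X in _ < X](bigD1 i) //= -addSn.
    apply: leq_add; first by rewrite ltn_subRL add1n; move: hi; rewrite addn2.
    by apply: leq_sum => j _.
  by rewrite ltnNge I1.
- by apply: capped_full; rewrite cI.
Qed.

(** * Degrees and splitting off *)

Section Degrees.
Variables (V E : finType) (a b : E -> V).

Definition dg (S : {set E}) (v : V) := \sum_(e in S) ((a e == v) + (b e == v)).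

Definition mu (S : {set E}) (x y : V) :=
  \sum_(e in S) ((a e == x) && (b e == y) || (a e == y) && (b e == x)).

(** Outdegree minus indegree, where [o e] means that [e] runs from [a e] to [b e]. *)
Definition net (o : E -> bool) (S : {set E}) (v : V) : int :=
  (\sum_(e in S) (if o e then (a e == v)%:Z - (b e == v)%:Z
                  else (b e == v)%:Z - (a e == v)%:Z))%R.

End Degrees.

Section Counting.
Variables V E : finType.
Implicit Types (a b : E -> V) (o : E -> bool) (S : {set E}) (X W : {set V}) (x y z v : V).

Lemma cutC a b S X : cut a b S (~: X) = cut a b S X.
Proof. by apply: eq_bigr => e _; rewrite !inE; do 2 case: (_ \in X). Qed.

Lemma cut_ends a b S X (U : {set V}) : X \subset U ->
  (forall e, e \in S -> a e \in U /\ b e \in U) -> cut a b S (U :\: X) = cut a b S X.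
Proof.
move=> XU hU; apply: eq_bigr => e /hU[ha hb]; rewrite !inE ha hb.
by do 2 case: (_ \in X).
Qed.

Lemma cut_map (V' : finType) (f : V -> V') a b S (X : {set V'}) :
  cut (fun e => f (a e)) (fun e => f (b e)) S X = cut a b S (f @^-1: X).
Proof. by apply: eq_bigr => e _; rewrite !inE. Qed.

Lemma cut_subset a b (S1 S2 : {set E}) X : S1 \subset S2 -> cut a b S1 X <= cut a b S2 X.
Proof.
move=> h; rewrite /cut [X in _ <= X](big_setID S1) /= (setIidPr h); exact: leq_addr.
Qed.

Lemma sum_eq_in (A : {set V}) v : \sum_(u in A) (v == u) = (v \in A).
Proof.
case: (boolP (v \in A)) => h.
  by rewrite (bigD1 v) //= eqxx big1 // => u /andP[_ hu]; rewrite eq_sym (negPf hu).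
by rewrite big1 // => u hu; case: eqP => // hv; rewrite hv hu in h.
Qed.

Lemma odd_cut a b S X : odd (cut a b S X) = odd (\sum_(v in X) dg a b S v).
Proof.
rewrite /dg exchange_big /= /cut; elim/big_rec2: _ => // e m n _.
rewrite !oddD => ->; congr (_ (+) _).
by rewrite big_split /= !sum_eq_in; do 2 case: (_ \in X).
Qed.

Lemma odd_cut1 a b S v : odd (cut a b S [set v]) = odd (dg a b S v).
Proof. by rewrite odd_cut big_set1. Qed.

Lemma dg_map (V' : finType) (f : V -> V') a b S (v : V') :
  dg (fun e => f (a e)) (fun e => f (b e)) S v = \sum_(u | f u == v) dg a b S u.
Proof.
rewrite /dg exchange_big /=; apply: eq_bigr => e _.
have h w : (\sum_(u | f u == v) (w == u)) = (f w == v) :> nat.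
  have -> : (f w == v) = (w \in [set u | f u == v]) by rewrite inE.
  by rewrite -sum_eq_in; apply: eq_bigl => u; rewrite inE.
by rewrite big_split /= !h.
Qed.

Lemma net_map (V' : finType) (f : V -> V') a b o S (v : V') :
  net (fun e => f (a e)) (fun e => f (b e)) o S v = (\sum_(u | f u == v) net a b o S u)%R.
Proof.
rewrite /net exchange_big /=; apply: eq_bigr => e _.
have h w : (\sum_(u | f u == v) ((w == u)%:Z))%R = Posz (f w == v).
  rewrite -(_ : \sum_(u | f u == v) (w == u) = (f w == v)).
    by rewrite (big_morph Posz PoszD (erefl _)).
  have -> : (f w == v) = (w \in [set u | f u == v]) by rewrite inE.
  by rewrite -sum_eq_in; apply: eq_bigl => u; rewrite inE.
by case: (o e); rewrite GRing.sumrB !h.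
Qed.

Lemma net_total a b o S (U : {set V}) :
  (forall e, e \in S -> a e \in U /\ b e \in U) -> (\sum_(v in U) net a b o S v = 0)%R.
Proof.
move=> hU; rewrite /net exchange_big /=; apply: big1 => e /hU[ha hb].
have h w : w \in U -> (\sum_(u in U) ((w == u)%:Z))%R = Posz 1.
  by move=> wU; rewrite -(big_morph Posz PoszD (erefl _)) sum_eq_in wU.
by case: (o e); rewrite GRing.sumrB !h // GRing.subrr.
Qed.

Lemma net_parity a b o S v : exists q : int, (net a b o S v = (dg a b S v)%:Z - 2 * q)%R.
Proof.
rewrite /net /dg; elim/big_rec2: _ => [|e n i _ [q ->]]; first by exists 0%R; lia.
case: (o e).
  by exists (q + (b e == v)%:Z)%R; lia.
by exists (q + (a e == v)%:Z)%R; lia.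
Qed.

Lemma eq_net a b o o' S v :
  (forall e, e \in S -> (a e == v) || (b e == v) -> o e = o' e) ->
  net a b o S v = net a b o' S v.
Proof.
move=> h; apply: eq_bigr => e eS; case: (boolP ((a e == v) || (b e == v))) => [/(h _ eS)->//|].
by rewrite negb_or => /andP[/negPf-> /negPf->]; case: (o e); case: (o' e).
Qed.

Lemma mu_sym a b S x y : mu a b S x y = mu a b S y x.
Proof. by apply: eq_bigr => e _; rewrite orbC. Qed.

Lemma cut_mu a b S x : cut a b S [set x] = \sum_(y | y != x) mu a b S x y.
Proof.
rewrite /mu exchange_big /=; apply: eq_bigr => e _; rewrite !inE.
have h v w : \sum_(y | y != x) ((v == x) && (w == y)) = (v == x) && (w != x) :> nat.
  case: (v == x) => /=; last by rewrite big1.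
  have -> : (w != x) = (w \in [set~ x]) by rewrite !inE.
  by rewrite -sum_eq_in; apply: eq_bigl => y; rewrite !inE.
transitivity (\sum_(y | y != x) (((a e == x) && (b e == y)) + ((b e == x) && (a e == y)))).
  by rewrite big_split /= !h; case: (a e == x); case: (b e == x).
apply: eq_bigr => y yx; rewrite [(a e == y) && _]andbC.
case: (a e =P x) => [->|]; last by [].
by rewrite [x == y]eq_sym (negPf yx) andbF orbF addn0.
Qed.

Lemma cut2 a b S x y : x != y ->
  cut a b S [set x; y] + 2 * mu a b S x y = cut a b S [set x] + cut a b S [set y].
Proof.
move=> xy; rewrite /cut /mu big_distrr /= -!big_split /=; apply: eq_bigr => e _.
rewrite !inE; case: (a e =P x) => [->|].
  by rewrite (negPf xy); case: (b e =P x) => [->|]; rewrite ?(negPf xy) //; case: (b e == y).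
by case: (a e =P y); case: (b e =P x) => [->|]; rewrite ?(negPf xy) //; case: (b e == y).
Qed.

Lemma mu_gt0 a b S x y : 0 < mu a b S x y ->
  exists2 e, e \in S & (a e == x) && (b e == y) || (a e == y) && (b e == x).
Proof.
rewrite lt0n => h; apply/exists_inP; apply: contraNT h => /exists_inPn h.
by rewrite /mu big1 // => e /h /negPf ->.
Qed.

(* Splitting off: the path y1 - x - y2 formed by e1, e2 is replaced by a single
   edge, which keeps the name e1. *)
Section Lift.
Variables (a b : E -> V) (S : {set E}) (x : V) (e1 e2 : E).
Hypotheses (e1S : e1 \in S) (e2S : e2 \in S) (e12 : e1 != e2).
Hypotheses (e1x : (a e1 == x) || (b e1 == x)) (e2x : (a e2 == x) || (b e2 == x)).

Definition other e := if a e == x then b e else a e.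
Definition la e := if e == e1 then other e1 else a e.
Definition lb e := if e == e1 then other e2 else b e.
(** An orientation of the lifted graph is carried back by directing the path y1 - x - y2 like the
    edge that replaced it; all net outdegrees, also the one at [x], stay the same. *)
Definition pull o e :=
  if e == e1 then (a e1 == x) (+) o e1
  else if e == e2 then (a e2 != x) (+) o e1 else o e.

Lemma lift_sum (R : nmodType) (F : E -> R) :
  (\sum_(e in S) F e = F e1 + (F e2 + \sum_(e in S :\ e1 :\ e2) F e))%R.
Proof. by rewrite (big_setD1 e1) // (big_setD1 e2) // !inE eq_sym e12. Qed.

Lemma lift_sumn (F : E -> nat) :
  (\sum_(e in S) F e = F e1 + (F e2 + \sum_(e in S :\ e1 :\ e2) F e)).
Proof. by rewrite (big_setD1 e1) // (big_setD1 e2) // !inE eq_sym e12. Qed.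

Lemma lift_sum' (R : nmodType) (F : E -> R) :
  (\sum_(e in S :\ e2) F e = F e1 + \sum_(e in S :\ e1 :\ e2) F e)%R.
Proof. by rewrite (big_setD1 e1) ?inE ?e12 //= setDDl setUC -setDDl. Qed.

Lemma lift_sumn' (F : E -> nat) :
  (\sum_(e in S :\ e2) F e = F e1 + \sum_(e in S :\ e1 :\ e2) F e).
Proof. by rewrite (big_setD1 e1) ?inE ?e12 //= setDDl setUC -setDDl. Qed.

Lemma net_lift o v : net a b (pull o) S v = net la lb o (S :\ e2) v.
Proof.
rewrite /net lift_sum lift_sum' GRing.addrA; congr (_ + _)%R; last first.
  apply: eq_bigr => e; rewrite !inE => /andP[n2 /andP[n1 _]].
  by rewrite /pull /la /lb (negPf n1) (negPf n2).
rewrite /pull /la /lb !eqxx [e2 == e1]eq_sym (negPf e12) /other.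
move: e1x e2x; case: (a e1 =P x) => [->|_] /=; case: (a e2 =P x) => [->|_] /=;
  move=> h1 h2; rewrite ?(eqP h1) ?(eqP h2); case: (o e1) => /=; lia.
Qed.

Lemma cut_lift X : cut a b S X = cut la lb (S :\ e2) X +
  2 * (((x \in X) (+) (other e1 \in X)) && ((x \in X) (+) (other e2 \in X))).
Proof.
rewrite /cut lift_sumn lift_sumn'.
rewrite (eq_bigr (fun e => (la e \in X) (+) (lb e \in X) : nat)); last first.
  by move=> e; rewrite !inE => /andP[n2 /andP[n1 _]]; rewrite /la /lb (negPf n1).
rewrite addnA [RHS]addnAC; congr (_ + _); rewrite /la /lb !eqxx /other.
move: e1x e2x; case: (a e1 =P x) => [->|_] /=; case: (a e2 =P x) => [->|_] /=;
  move=> h1 h2; rewrite ?(eqP h1) ?(eqP h2); do 3 case: (_ \in X) => //.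
Qed.

Lemma dg_lift v : dg a b S v = dg la lb (S :\ e2) v + 2 * (x == v).
Proof.
rewrite /dg lift_sumn lift_sumn'.
rewrite (eq_bigr (fun e => (la e == v) + (lb e == v))); last first.
  by move=> e; rewrite !inE => /andP[n2 /andP[n1 _]]; rewrite /la /lb (negPf n1).
rewrite addnA [RHS]addnAC; congr (_ + _); rewrite /la /lb !eqxx /other.
move: e1x e2x; case: (a e1 =P x) => [->|_] /=; case: (a e2 =P x) => [->|_] /=;
  move=> h1 h2; rewrite ?(eqP h1) ?(eqP h2); lia.
Qed.

Lemma lift_ends (U : {set V}) : (forall e, e \in S -> a e \in U /\ b e \in U) ->
  forall e, e \in S :\ e2 -> la e \in U /\ lb e \in U.
Proof.
move=> h e; rewrite !inE /la /lb /other => /andP[_ /h[ha hb]].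
have [h1 h1'] := h _ e1S; have [h2 h2'] := h _ e2S.
by case: (e == e1) => //; case: (a e1 == x); case: (a e2 == x).
Qed.

Lemma mu_lift y : y != x -> other e1 != x -> other e2 != x ->
  mu a b S x y = mu la lb (S :\ e2) x y + (other e1 == y) + (other e2 == y).
Proof.
move=> yx o1 o2; rewrite /mu lift_sumn lift_sumn'.
rewrite (eq_bigr (fun e => (la e == x) && (lb e == y) || (la e == y) && (lb e == x) : nat)); last first.
  by move=> e; rewrite !inE => /andP[n2 /andP[n1 _]]; rewrite /la /lb (negPf n1).
rewrite /la /lb !eqxx (negPf o1) (negPf o2) !andbF /= add0n.
suff h e : (a e == x) || (b e == x) -> other e != x ->
   ((a e == x) && (b e == y) || (a e == y) && (b e == x)) = (other e == y).
  by rewrite !h //; lia.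
rewrite /other; case: (a e =P x) => [->|_] /=.
  by rewrite [x == y]eq_sym (negPf yx) orbF.
by move=> -> _; rewrite andbT.
Qed.

End Lift.

(** Splitting off two edges with a common end preserves net outdegrees under [pull]; once the edges
    are pairwise disjoint, every orientation will do. *)
Lemma euler_orientation a b S : exists o, forall v, (`|net a b o S v| <= 1)%R.
Proof.
move: {2}#|S| (leqnn #|S|) => n; elim: n a b S => [|n IH] a b S hS.
  exists xpredT => v; move: hS; rewrite leqn0 cards_eq0 => /eqP->.
  by rewrite /net big_set0.
case: (boolP [exists x, [exists e1 in S, [exists e2 in S, [&& e1 != e2,
   (a e1 == x) || (b e1 == x) & (a e2 == x) || (b e2 == x)]]]]).
  case/existsP => x /exists_inP[e1 e1S /exists_inP[e2 e2S /and3P[e12 h1 h2]]].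
  have [|o ho] := IH (la a b x e1) (lb a b x e1 e2) (S :\ e2).
    by move: hS; rewrite (cardsD1 e2) e2S.
  by exists (pull a x e1 e2 o) => v; rewrite net_lift.
move=> hN; exists xpredT => v; rewrite /net.
case: (boolP [exists e in S, (a e == v) || (b e == v)]) => [/exists_inP[e eS he]|/exists_inPn h].
  rewrite (big_setD1 e) //= big1 ?GRing.addr0; first by case: (a e == v); case: (b e == v).
  move=> f; rewrite !inE => /andP[fe fS]; move: hN.
  rewrite negb_exists => /forallP/(_ v)/exists_inPn/(_ e eS)/exists_inPn/(_ f fS).
  by rewrite eq_sym fe he /= negb_or => /andP[/negPf-> /negPf->].
by rewrite big1 // => e /h; rewrite negb_or => /andP[/negPf-> /negPf->].
Qed.

End Counting.

(** * Orientations with prescribed net outdegrees modulo 2k *)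

Section Preorientation.
Variables (V E : finType) (k : nat) (z : V).
Implicit Types (a b : E -> V) (o : E -> bool) (S : {set E}) (X W A : {set V}) (x y v : V).
Implicit Types be : V -> nat.

Definition agree a b S o o' :=
  forall e, e \in S -> (a e == z) || (b e == z) -> o' e = o e.

(* The edges at z are oriented in advance by o; be prescribes outdegree minus
   indegree. *)
Definition extends a b S W be o :=
  exists o', agree a b S o o' /\
    forall v, v \in W -> ((2 * k)%:Z %| (net a b o' S v - (be v)%:Z)%R)%Z.

Lemma agree_net a b S o o' : agree a b S o o' -> net a b o' S z = net a b o S z.
Proof. by move=> h; apply: eq_net => e /h. Qed.

Lemma agree_refl a b S o : agree a b S o o.
Proof. by []. Qed.

Section LiftExtends.
Variables (a b : E -> V) (S : {set E}) (x : V) (e1 e2 : E) (o : E -> bool).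
Hypotheses (e1S : e1 \in S) (e2S : e2 \in S) (e12 : e1 != e2).
Hypotheses (e1x : (a e1 == x) || (b e1 == x)) (e2x : (a e2 == x) || (b e2 == x)).
Hypotheses (xz : x != z) (o12 : other a b x e1 != other a b x e2).

(** If one of the two edges is at [z], its given orientation forces that of the lifted edge. By
    [o12] the other ends differ, so the two edges cannot both be at [z] and make conflicting
    demands. *)
Definition lo e := if e == e1 then
  (if other a b x e1 == z then (a e1 == x) (+) o e1 else (a e2 != x) (+) o e2)
  else o e.

Lemma other_z e : (a e == x) || (b e == x) -> (a e == z) || (b e == z) ->
  other a b x e == z.
Proof.
rewrite /other; case: (a e =P x) => [->|_] /=; first by rewrite (negPf xz).
by move=> /eqP->; rewrite (negPf xz) orbF.
Qed.

Lemma agree_lift o' : agree (la a b x e1) (lb a b x e1 e2) (S :\ e2) lo o' ->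
  agree a b S o (pull a x e1 e2 o').
Proof.
move=> h e eS hz; rewrite /pull; case: (e =P e1) => [e_e1|ne1].
  have h1 := other_z e1x; rewrite -e_e1 in h1; have := h e1.
  rewrite !inE e12 e1S /la /lb eqxx -e_e1 (h1 hz) => ->//.
  by rewrite /lo -e_e1 eqxx (h1 hz); case: (a e == x); case: (o e).
case: (e =P e2) => [e_e2|ne2].
  have h2 := other_z e2x; rewrite -e_e2 in h2; have := h e1.
  rewrite !inE e12 e1S /la /lb eqxx -e_e2 (h2 hz) orbT => ->//.
  have -> : lo e1 = (a e2 != x) (+) o e2.
    rewrite /lo eqxx; case: eqP => // h1.
    by move: o12; rewrite h1 -e_e2 (eqP (h2 hz)) eqxx.
  by rewrite -e_e2; case: (a e == x); case: (o e).
rewrite h ?inE ?eS ?andbT; first by rewrite /lo; case: eqP.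
  by apply/eqP.
by rewrite /la /lb; case: (e =P e1).
Qed.

Lemma net_lift_z : net (la a b x e1) (lb a b x e1 e2) lo (S :\ e2) z = net a b o S z.
Proof.
rewrite -net_lift //; apply: agree_net; apply: agree_lift; exact: agree_refl.
Qed.

Lemma extends_lift W be :
  extends (la a b x e1) (lb a b x e1 e2) (S :\ e2) W be lo -> extends a b S W be o.
Proof.
case=> o' [h1 h2]; exists (pull a x e1 e2 o'); split; first exact: agree_lift.
by move=> v /h2; rewrite net_lift.
Qed.

End LiftExtends.

Lemma mu_le_cut3 a b S x y w u : y != x -> w != x -> u != x -> w != y -> u != y -> u != w ->
  mu a b S x y + mu a b S x w + mu a b S x u <= cut a b S [set x].
Proof.
move=> yx wx ux wy uy uw; rewrite cut_mu (bigD1 y) //= (bigD1 w) /= ?wx //.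
by rewrite (bigD1 u) /= ?ux ?uy // !addnA leq_addr.
Qed.

Lemma edge_at a b x y e : y != x ->
  (a e == x) && (b e == y) || (a e == y) && (b e == x) ->
  ((a e == x) || (b e == x)) /\ other a b x e = y.
Proof.
move=> yx; rewrite /other; case: (a e =P x) => [->|_] /=.
  by rewrite [x == y]eq_sym (negPf yx) orbF => /eqP.
by case/andP => /eqP -> ->.
Qed.

(* Splitting off all edges at x in pairs with different other ends. *)
Lemma lift_all a b S o x : x != z -> ~~ odd (cut a b S [set x]) ->
  (forall y, y != x -> 2 * mu a b S x y <= cut a b S [set x]) ->
  exists a' b' S' o', 
   [/\ [/\ cut a' b' S' [set x] = 0, forall y, y != x -> cut a' b' S' [set y] = cut a b S [set y],
       forall X, x \notin X ->
         cut a b [set e in S | (a e != x) && (b e != x)] X <= cut a' b' S' X &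
       forall v, odd (dg a' b' S' v) = odd (dg a b S v)],
       net a' b' o' S' z = net a b o S z,
       forall U : {set V}, (forall e, e \in S -> a e \in U /\ b e \in U) ->
          forall e, e \in S' -> a' e \in U /\ b' e \in U
     & forall W be, extends a' b' S' W be o' -> extends a b S W be o].
Proof.
move=> xz; move: {2}#|S| (leqnn #|S|) => n; elim: n a b S o => [|n IH] a b S o hS ev hmu.
  exists a, b, S, o; split=> //; split=> // [|X _]; last first.
    by apply: cut_subset; apply/subsetP => e; rewrite inE => /andP[].
  by move: hS; rewrite leqn0 cards_eq0 => /eqP->; rewrite /cut big_set0.
case: (posnP (cut a b S [set x])) => [c0|cpos].
  exists a, b, S, o; split=> //; split=> // X _.
  by apply: cut_subset; apply/subsetP => e; rewrite inE => /andP[].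
have [y0 y0x my0] : exists2 y, y != x & 0 < mu a b S x y.
  apply/exists_inP; apply: contraLR cpos => /exists_inPn h.
  by rewrite cut_mu big1 // => y yx; have := h y yx; case: (mu _ _ _ _ _).
(* Splitting towards the two neighbours of largest multiplicity preserves [hmu]: three times the
   multiplicity of any other neighbour is at most the cut at [x], and multiplicity 1 is settled by
   the evenness of that cut. *)
case: (@arg_maxnP _ y0 (fun y => y != x) (mu a b S x) y0x) => y1 y1x my1.
have m1 : 0 < mu a b S x y1 by apply: leq_trans my0 (my1 _ y0x).
have [y3 y3x my3] : exists2 y, (y != x) && (y != y1) & 0 < mu a b S x y.
  have : \sum_(y | (y != x) && (y != y1)) mu a b S x y != 0.
    by have := hmu _ y1x; have := cpos; rewrite cut_mu (bigD1 y1) //=; clear; lia.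
  rewrite sum_nat_eq0 negb_forall => /existsP[y]; rewrite negb_imply -lt0n => /andP[h1 h2].
  by exists y.
case: (@arg_maxnP _ y3 (fun y => (y != x) && (y != y1)) (mu a b S x) y3x).
move=> y2 /andP[y2x y21] my2.
have m2 : 0 < mu a b S x y2 by apply: leq_trans my3 (my2 _ y3x).
have [e1 e1S he1] := mu_gt0 m1; have [e2 e2S he2] := mu_gt0 m2.
have [e1x o1] := edge_at y1x he1; have [e2x o2] := edge_at y2x he2.
have e12 : e1 != e2 by apply/eqP => h; move: y21; rewrite -o1 -o2 h eqxx.
have o12 : other a b x e1 != other a b x e2 by rewrite o1 o2 eq_sym.
have cl X := cut_lift e1S e2S e12 e1x e2x X.
have ml y : y != x -> mu a b S x y =
   mu (la a b x e1) (lb a b x e1 e2) (S :\ e2) x y + (y1 == y) + (y2 == y).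
  by move=> yx; rewrite (mu_lift e1S e2S e12 e1x e2x yx) ?o1 ?o2.
rewrite o1 o2 in cl.
have cx := cl [set x]; rewrite !inE eqxx (negPf y1x) (negPf y2x) /= in cx.
have [|||a' [b' [S' [o' [[h1 h2 h3 h3'] h4 h5 h6]]]]] :=
  IH (la a b x e1) (lb a b x e1 e2) (S :\ e2) (lo a b x e1 e2 o).
- by move: hS; rewrite (cardsD1 e2) e2S.
- by move: ev; rewrite cx oddD addbF.
- move=> y yx; have := ml y yx; have := hmu y yx.
  case: (y1 =P y) => [<-|/eqP y1y]; first by rewrite (negPf y21) cx; clear; lia.
  case: (y2 =P y) => [<-|/eqP y2y]; first by rewrite cx; clear; lia.
  have hy1 : mu a b S x y <= mu a b S x y1 by apply: my1.
  have hy2 : mu a b S x y <= mu a b S x y2 by apply: my2; rewrite yx eq_sym.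
  have := @mu_le_cut3 a b S x y1 y2 y y1x y2x yx y21.
  rewrite ![y == _]eq_sym y1y y2y => /(_ isT isT).
  move: hy1 hy2 ev; rewrite cx oddD addbF; clear.
  move: (mu a b S x y) (mu a b S x y1) (mu a b S x y2) => p q r.
  move: (cut _ _ _ _) (mu _ _ _ _ _) => n m; lia.
exists a', b', S', o'; split.
- split=> //.
  + move=> y yx; rewrite (h2 y yx) (cl [set y]) !inE [x == y]eq_sym (negPf yx) /=.
    case: (y1 =P y) => [<-|_]; last by rewrite addn0.
    by rewrite (negPf y21) addn0.
  + move=> X xX; apply: leq_trans (h3 X xX); rewrite /cut.
    rewrite [X in _ <= X](big_setID [set e in S | (a e != x) && (b e != x)]) /=.
    apply: leq_trans (leq_addr _ _); rewrite leq_eqVlt; apply/orP; left; apply/eqP.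
    have ne e : a e != x -> b e != x -> (e == e1 = false) * (e == e2 = false).
      move=> ax bx; split; apply/eqP => h.
        by move: e1x; rewrite -h (negPf ax) (negPf bx).
      by move: e2x; rewrite -h (negPf ax) (negPf bx).
    have hN : [set e in S | (a e != x) && (b e != x)] =
       [set e in S :\ e2 | (la a b x e1 e != x) && (lb a b x e1 e2 e != x)]
         :&: [set e in S | (a e != x) && (b e != x)].
      apply/setP => e; rewrite !inE /la /lb; case: (e \in S); rewrite ?andbF //=.
      case ax: (a e == x); rewrite /= ?andbF //; case bx: (b e == x); rewrite /= ?andbF //.
      by rewrite !ne ?ax ?bx.
    apply: eq_big => e; first exact: (congr1 (fun N : {set E} => e \in N) hN).
    by rewrite !inE /la /lb => /and3P[_ ax bx]; rewrite !ne.
  + move=> v; rewrite h3' (dg_lift e1S e2S e12 e1x e2x v) oddD.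
    by case: (x == v); rewrite addbF.
- by rewrite h4 net_lift_z.
- by move=> U hU; apply: h5; apply: lift_ends.
- by move=> W be /h6; apply: extends_lift.
Qed.

End Preorientation.

Lemma dvdz_ex (d x : int) : (exists q : int, x = (q * d)%R) -> (d %| x)%Z.
Proof. by move=> h; apply/dvdzP. Qed.

(** * Contraction of the two sides of a cut, and of parallel edges *)

Section Contraction.
Variables (V E : finType) (k : nat) (z : V).
Hypothesis k0 : 0 < k.
Implicit Types (a b : E -> V) (o : E -> bool) (S D : {set E}) (X W A : {set V}) (x y v r : V).
Implicit Types be : V -> nat.

Let c := 16 * k * k.
Let B0 := 24 * k * k + 3 * k.

(* The induction hypothesis of Lovasz, Thomassen, Wu and Zhang: z is the
   contracted side of a cut of size at most B0 = 3/2 (c + 2k). *)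
Record good a b S W be o : Prop := Good {
  g_z : z \notin W;
  g_ends : forall e, e \in S -> a e \in z |: W /\ b e \in z |: W;
  g_cutz : cut a b S [set z] <= B0;
  g_sum : ((2 * k)%:Z %| (Posz (\sum_(v in W) be v) + net a b o S z)%R)%Z;
  g_par : forall x, x \in W -> odd (dg a b S x) = odd (be x);
  g_lt : forall x, x \in W -> be x < 2 * k;
  g_one : forall x, x \in W -> W != [set x] -> c + be x <= cut a b S [set x];
  g_many : forall A, A \subset W -> A != W -> 1 < #|A| -> c + 2 * k <= cut a b S A }.

Lemma good_zx a b S W be o x : good a b S W be o -> x \in W -> x != z.
Proof. by move=> g xW; apply/eqP => h; move: (g_z g); rewrite -h xW. Qed.

Lemma net_setD a b o S D v : D \subset S ->
  net a b o S v = (net a b o D v + net a b o (S :\: D) v)%R.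
Proof. by move=> h; rewrite /net (big_setID D) /= (setIidPr h). Qed.

Lemma cut_setD a b S D X : D \subset S -> cut a b S X = cut a b D X + cut a b (S :\: D) X.
Proof. by move=> h; rewrite /cut (big_setID D) /= (setIidPr h). Qed.

Lemma dg_setD a b S D v : D \subset S -> dg a b S v = dg a b D v + dg a b (S :\: D) v.
Proof. by move=> h; rewrite /dg (big_setID D) /= (setIidPr h). Qed.

Lemma mu_setD a b S D x y : D \subset S -> mu a b S x y = mu a b D x y + mu a b (S :\: D) x y.
Proof. by move=> h; rewrite /mu (big_setID D) /= (setIidPr h). Qed.

Section Contract.
Variables (a b : E -> V) (S : {set E}) (W : {set V}) (be : V -> nat) (o : E -> bool).
Variables (A : {set V}) (r : V).
Hypotheses (AW : A \subset W) (rA : r \in A).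

(** A cut around [A] takes the graph apart into an outer graph, where [cin] shrinks [A] to [r], and
    an inner one, where [cout] shrinks the rest to [z]. *)
Definition cin v := if v \in A then r else v.
Definition cout v := if v \in A then v else z.
Definition cW := r |: (W :\: A).
Definition cbe v := if v == r then (\sum_(u in A) be u) %% (2 * k) else be v.

Lemma cin_r u : (cin u == r) = (u \in A).
Proof. by rewrite /cin; case: ifP => // h; [rewrite eqxx | apply/eqP => e; rewrite e rA in h]. Qed.

Lemma cin_out v u : v \notin A -> (cin u == v) = (u == v).
Proof.
move=> vA; rewrite /cin; case: ifP => // h.
have -> : (r == v) = false by apply/eqP => e; rewrite -e rA in vA.
by symmetry; apply/eqP => e; rewrite -e h in vA.
Qed.

Lemma cout_in v u : v \in A -> z \notin A -> (cout u == v) = (u == v).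
Proof.
move=> vA zA; rewrite /cout; case: ifP => // h.
have -> : (z == v) = false by apply/eqP => e; rewrite e vA in zA.
by symmetry; apply/eqP => e; rewrite e vA in h.
Qed.

Lemma card_cW : 1 < #|A| -> #|cW| < #|W|.
Proof.
move=> hA; rewrite /cW cardsU1 !inE rA /=; move: hA.
by rewrite -(cardsID A W) (setIidPr AW); clear; lia.
Qed.

Lemma net_cin o' v : v \notin A ->
  net (fun e => cin (a e)) (fun e => cin (b e)) o' S v = net a b o' S v.
Proof.
by move=> vA; rewrite net_map (eq_bigl (pred1 v)) ?big_pred1_eq // => u; exact: cin_out.
Qed.

Lemma net_cin_r o' :
  net (fun e => cin (a e)) (fun e => cin (b e)) o' S r = (\sum_(u in A) net a b o' S u)%R.
Proof. by rewrite net_map; apply: eq_bigl => u; exact: cin_r. Qed.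

(** All cuts of the contracted graph are cuts of the given one. The new vertex [r] inherits the cut
    around [A], whose size exceeds [c] plus any residue modulo 2k; if [A] is all of [W], then [r] is
    the only vertex left and is exempt in [g_one]. *)
Lemma contract_good : good a b S W be o -> (A == W) || (c + 2 * k <= cut a b S A) ->
  good (fun e => cin (a e)) (fun e => cin (b e)) S cW cbe o.
Proof.
move=> g hA; have zA : z \notin A by apply: contra (g_z g); apply: (subsetP AW).
have rW := subsetP AW _ rA.
have pre1 v : v \notin A -> cin @^-1: [set v] = [set v].
  by move=> vA; apply/setP => u; rewrite !inE cin_out.
split.
- rewrite !inE negb_or negb_and (g_z g) orbT andbT.
  by apply/eqP => e; rewrite e rA in zA.
- have h v : v \in z |: W -> cin v \in z |: cW.
    rewrite /cin /cW; case: ifP => h; rewrite !inE ?eqxx ?orbT // h /=.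
    by case/orP => ->; rewrite ?orbT.
  by move=> e /(g_ends g)[/h -> /h ->].
- by rewrite cut_map pre1 // (g_cutz g).
- rewrite net_cin //; case/dvdzP: (g_sum g) => q hq; apply: dvdz_ex.
  have rWA : r \notin W :\: A by rewrite !inE rA.
  rewrite /cW big_setU1 //= /cbe eqxx.
  have -> : \sum_(v in W :\: A) (if v == r then (\sum_(u in A) be u) %% (2 * k) else be v)
     = \sum_(v in W :\: A) be v.
    by apply: eq_bigr => v; rewrite !inE; case: (v =P r) => // ->; rewrite rA.
  exists (q - Posz ((\sum_(u in A) be u) %/ (2 * k))%N)%R.
  move: hq; rewrite (big_setID A) /= (setIidPr AW) => hq.
  have := divn_eq (\sum_(u in A) be u) (2 * k); move: hq; clear; lia.
- move=> x; rewrite !inE dg_map /cbe => /orP[/eqP->|/andP[xA xW]].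
    rewrite eqxx (eq_bigl (mem A)) => [|u]; last exact: cin_r.
    have -> : odd ((\sum_(u in A) be u) %% (2 * k)) = odd (\sum_(u in A) be u).
      by rewrite [in RHS](divn_eq (\sum_(u in A) be u) (2 * k)) oddD mulnCA oddM.
    elim/big_rec2: _ => // u m n uA; rewrite !oddD => ->.
    by rewrite (g_par g) // (subsetP AW).
  rewrite (eq_bigl (pred1 x)) ?big_pred1_eq => [|u]; last exact: cin_out.
  have -> : (x == r) = false by apply/eqP => e; rewrite e rA in xA.
  exact: g_par g _ xW.
- move=> x; rewrite !inE /cbe; case: eqP => [_ _|_ /andP[_ /(g_lt g)]//].
  by rewrite ltn_mod muln_gt0.
- move=> x; rewrite inE cut_map => /orP[/set1P->|/setDP[xW xA]] hW.
    have -> : cin @^-1: [set r] = A by apply/setP => u; rewrite !inE cin_r.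
    case/orP: hA => [/eqP hA|].
      by move: hW; rewrite /cW hA setDv setU0 eqxx.
    apply: leq_trans; rewrite leq_add2l /cbe eqxx ltnW // ltn_mod muln_gt0 //.
  rewrite pre1 // /cbe; have -> : (x == r) = false by apply/eqP => e; rewrite e rA in xA.
  apply: (g_one g) => //; apply/eqP => h; move: rW xA; rewrite h inE => /eqP <-.
  by rewrite rA.
- move=> X XW XnW X1; rewrite cut_map.
  have XcW w : w \in X -> w \in W.
    by move/(subsetP XW); rewrite !inE => /orP[/eqP->|/andP[]].
  case: (boolP (r \in X)) => rX.
    have YE : cin @^-1: X = X :|: A.
      apply/setP => u; rewrite !inE /cin; case: ifP => h; first by rewrite rX orbT.
      by rewrite orbF.
    rewrite YE; apply: (g_many g).
    + by rewrite subUset AW andbT; apply/subsetP.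
    + apply: contra XnW => /eqP h; rewrite eqEsubset XW; apply/subsetP => w.
      rewrite !inE => /orP[/eqP->//|/andP[wA wW]].
      by move: wW; rewrite -h !inE (negPf wA) orbF.
    + by apply: leq_trans X1 (subset_leq_card (subsetUl _ _)).
  have YE : cin @^-1: X = X.
    apply/setP => u; rewrite !inE /cin; case: ifP => // h; rewrite (negPf rX).
    apply/esym/negP => uX; have := subsetP XW _ uX; rewrite !inE h /= orbF => /eqP e.
    by rewrite -e uX in rX.
  rewrite YE; apply: (g_many g) => //; first by apply/subsetP.
  by apply/eqP => h; move: rX; rewrite h rW.
Qed.

(** Once the outer graph is oriented, the edges leaving [A] are the preoriented edges of the inner
    graph. The congruence reached at [r] turns into the sum condition there, because net outdegrees
    add up to 0. *)
Lemma contract_out_good o1 : good a b S W be o -> cut a b S A <= B0 ->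
  ((2 * k)%:Z %| (net (fun e => cin (a e)) (fun e => cin (b e)) o1 S r
      - Posz ((\sum_(u in A) be u) %% (2 * k)))%R)%Z ->
  good (fun e => cout (a e)) (fun e => cout (b e)) S A be o1.
Proof.
move=> g hA hr; have zA : z \notin A by apply: contra (g_z g); apply: (subsetP AW).
have preX X : X \subset A -> cout @^-1: X = X.
  move=> XA; apply/setP => u; rewrite !inE /cout; case: ifP => // h.
  have -> : (z \in X) = false by apply/negP => /(subsetP XA); rewrite (negPf zA).
  by apply/esym/negP => /(subsetP XA); rewrite h.
split=> //.
- have h v : cout v \in z |: A by rewrite /cout !inE; case: ifP => [->|]; rewrite ?eqxx ?orbT.
  by move=> e _; split; apply: h.
- rewrite cut_map; have -> : cout @^-1: [set z] = ~: A.
    apply/setP => u; rewrite !inE /cout; case: ifP => h; last by rewrite eqxx.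
    by apply/eqP => e; rewrite -e h in zA.
  by rewrite cutC.
- move: hr; rewrite net_cin_r => /dvdzP[q hq]; apply: dvdz_ex.
  have hT : (\sum_(v in [set: V]) net a b o1 S v = 0)%R by apply: net_total => e _; rewrite !inE.
  have hout : (\sum_(u | cout u == z) net a b o1 S u = \sum_(u in ~: A) net a b o1 S u)%R.
    apply: eq_bigl => u; rewrite inE /cout; case: ifP => h; last by rewrite eqxx.
    by apply/eqP => e; rewrite -e h in zA.
  move: hT; rewrite net_map hout (big_setID A) /= setTI setTD.
  move: hq; set X := (\sum_(u in A) net _ _ _ _ _)%R; set Y := (\sum_(i in ~: A) _)%R => hq hT.
  exists (Posz ((\sum_(u in A) be u) %/ (2 * k))%N - q)%R.
  have := divn_eq (\sum_(u in A) be u) (2 * k); move: hq hT; clear; lia.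
- move=> x xA; rewrite dg_map (eq_bigl (pred1 x)) ?big_pred1_eq => [|u]; last exact: cout_in.
  by rewrite (g_par g) // (subsetP AW).
- by move=> x xA; rewrite (g_lt g) // (subsetP AW).
- move=> x xA hx; rewrite cut_map preX ?sub1set //; apply: (g_one g); first exact: (subsetP AW).
  apply: contra hx => /eqP h; rewrite eqEsubset sub1set xA andbT.
  by rewrite -h AW.
- move=> X XA XnA X1; rewrite cut_map preX //; apply: (g_many g) => //.
    exact: subset_trans AW.
  by apply: contra XnA => /eqP h; rewrite eqEsubset XA h AW.
Qed.

(** The edges leaving [A] are at [z] in the inner graph, so [o2] agrees with [o1] on them; edges
    with both ends in [A] follow [o2], all others [o1]. *)
Lemma extends_glue o1 : good a b S W be o ->
  agree z (fun e => cin (a e)) (fun e => cin (b e)) S o o1 ->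
  (forall v, v \in cW -> ((2 * k)%:Z %| (net (fun e => cin (a e)) (fun e => cin (b e)) o1 S v - (cbe v)%:Z)%R)%Z) ->
  extends k z (fun e => cout (a e)) (fun e => cout (b e)) S A be o1 ->
  extends k z a b S W be o.
Proof.
move=> g ag h1 [o2 [ag2 h2]].
have zA : z \notin A by apply: contra (g_z g); apply: (subsetP AW).
pose o' e := if (a e \in A) && (b e \in A) then o2 e else o1 e.
exists o'; split.
  move=> e eS hz; rewrite /o'; case: ifP => [/andP[ha hb]|_].
    by case/orP: hz => /eqP hz; move: zA; rewrite -hz ?ha ?hb.
  by apply: ag => //; rewrite !cin_out.
move=> v vW; case: (boolP (v \in A)) => vA.
  rewrite (_ : net a b o' S v = net (fun e => cout (a e)) (fun e => cout (b e)) o2 S v); first exact: h2.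
  rewrite net_map (eq_bigl (pred1 v)) ?big_pred1_eq => [|u]; last exact: cout_in.
  apply: eq_net => e eS hv; rewrite /o'; case: ifP => // hab.
  symmetry; apply: ag2 => //; rewrite /cout.
  by case: (a e \in A) hab; case: (b e \in A); rewrite ?eqxx ?orbT.
have vr : (v == r) = false by apply/eqP => e; rewrite e rA in vA.
have := h1 v; rewrite !inE vA vW orbT => /(_ isT); rewrite net_cin // /cbe vr.
rewrite (@eq_net _ _ _ _ o1 o' S v) // => e eS hv; rewrite /o'.
case: ifP => // /andP[ha hb]; case/orP: hv => /eqP hv; move: vA; rewrite -hv ?ha ?hb //.
Qed.

End Contract.

Lemma subset_of_card (T : finType) (P : {set T}) j : j <= #|P| ->
  exists Q : {set T}, Q \subset P /\ #|Q| = j.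
Proof.
move=> hj; exists [set x in take j (enum P)]; split.
  by apply/subsetP => x; rewrite inE => /mem_take; rewrite mem_enum.
rewrite cardsE (card_uniqP _) ?take_uniq ?enum_uniq // size_take -cardE.
by case: ltngtP hj.
Qed.

(** Identify [x] and [y] and orient the result. The number of parallel edges directed from [x] to
    [y] is still free, and with at least k - 1 such edges it attains all residues modulo k; each
    unit changes the net outdegree at [x] by 2. *)
Lemma extends_parallel a b S W be o x y : good a b S W be o ->
  x \in W -> y \in W -> x != y -> k <= (mu a b S x y).+1 ->
  extends k z (fun e => cin [set x; y] x (a e)) (fun e => cin [set x; y] x (b e)) S
    (cW W [set x; y] x) (cbe be [set x; y] x) o ->
  extends k z a b S W be o.
Proof.
move=> g xW yW xy hmu [o1 [ag h1]]; set A := [set x; y] in ag h1 *.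
have xA : x \in A by rewrite !inE eqxx.
have AW : A \subset W by rewrite subUset !sub1set xW yW.
have xz := good_zx g xW; have yz := good_zx g yW.
have zA : z \notin A by rewrite !inE negb_or ![z == _]eq_sym xz yz.
pose P := [set e in S | (a e == x) && (b e == y) || (a e == y) && (b e == x)].
have PS : P \subset S by apply/subsetP => e; rewrite inE => /andP[].
have cP : #|P| = mu a b S x y.
  rewrite /mu -sum1_card big_mkcond [RHS]big_mkcond; apply: eq_bigr => e _.
  by rewrite inE; case: (e \in S) => //=; case: (_ || _).
have hP e : e \in P -> (a e = x /\ b e = y) \/ (a e = y /\ b e = x).
  by rewrite inE => /andP[_ /orP[] /andP[/eqP-> /eqP->]]; [left | right].
have yxF : (y == x) = false by rewrite eq_sym (negPf xy).
(* [Q] is the set of parallel edges directed from [x] to [y]; the others run from [y] to [x]. *)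
pose oQ (Q : {set E}) e := if e \in P then (e \in Q) == (a e == x) else o1 e.
have netQ (Q : {set E}) : Q \subset P -> net a b (oQ Q) S x =
   (net a b o1 (S :\: P) x + 2 * Posz #|Q| - Posz #|P|)%R.
  move=> QP; rewrite (net_setD _ _ _ _ PS) GRing.addrC -GRing.addrA; congr (_ + _)%R.
    by apply: eq_bigr => e; rewrite !inE /oQ => /andP[]; rewrite inE => /negPf->.
  rewrite (net_setD _ _ _ _ QP) -(cardsID Q P) (setIidPr QP).
  have -> : net a b (oQ Q) Q x = Posz #|Q|.
    rewrite /net -sum1_card (big_morph Posz PoszD (erefl _)); apply: eq_bigr => e eQ.
    have eP := subsetP QP _ eQ; rewrite /oQ eP eQ.
    by case: (hP e eP) => [[-> ->]|[-> ->]]; rewrite eqxx yxF.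
  have -> : net a b (oQ Q) (P :\: Q) x = (- Posz #|P :\: Q|)%R.
    rewrite /net -sum1_card (big_morph Posz PoszD (erefl _)) -GRing.sumrN; apply: eq_bigr => e.
    case/setDP => eP /negPf eQ; rewrite /oQ eP eQ.
    by case: (hP e eP) => [[-> ->]|[-> ->]]; rewrite eqxx yxF.
  clear; move: #|Q| #|P :\: Q| => m n; lia.
have [q0 hq0] := net_parity a b (oQ set0) S x; rewrite netQ ?sub0set // cards0 in hq0.
have hpar := g_par g xW.
(* The exact number of parallel edges that should leave [x]. The division is exact by parity, and
   since the net outdegree counts modulo 2k only the residue of [t] modulo k matters. *)
pose t : int := ((Posz (be x) + Posz #|P| - net a b o1 (S :\: P) x) %/ 2)%Z.
have ht : (2 * t = Posz (be x) + Posz #|P| - net a b o1 (S :\: P) x)%R.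
  rewrite /t; move: hq0 hpar; clear.
  move: (net _ _ _ _ _) (dg _ _ _ _) (be x) #|P| => m n p q; lia.
have k0' : (Posz k != 0)%R by move: k0; clear; lia.
have hj1 := modz_ge0 t k0'; have hj2 := @ltz_pmod t k k0; have hj3 := divz_eq t k.
have [Q [QP cQ]] : exists Q : {set E}, Q \subset P /\ #|Q| = `|(t %% k)%Z|%N.
  apply: subset_of_card; rewrite cP; move: hmu hj1 hj2; clear.
  by move: (t %% k)%Z => u; lia.
exists (oQ Q); split.
  move=> e eS hz; rewrite /oQ; case: ifP => [|_].
    rewrite inE => /andP[_ he]; case/orP: hz => /eqP hz; move: he; rewrite hz ![z == _]eq_sym;
    by rewrite (negPf xz) (negPf yz) ?andbF.
  by apply: ag => //; rewrite !cin_out.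
have hx : ((2 * k)%:Z %| (net a b (oQ Q) S x - (be x)%:Z)%R)%Z.
  rewrite netQ // cQ; apply: dvdz_ex; exists (- (t %/ k)%Z)%R; move: hj1 hj3 ht; clear.
  move: (net _ _ _ _ _) (be x) #|P| (t %/ k)%Z (t %% k)%Z => m n p q r.
  lia.
move=> v vW; case: (v =P x) => [->//|/eqP vx].
case: (v =P y) => [->|/eqP vy].
  (* At [y] the congruence follows from those at [x] and at the identified vertex. *)
  have := h1 x; rewrite !inE eqxx => /(_ isT); rewrite /cbe eqxx.
  have -> : net (fun e => cin A x (a e)) (fun e => cin A x (b e)) o1 S x =
            net (fun e => cin A x (a e)) (fun e => cin A x (b e)) (oQ Q) S x.
    apply: eq_bigr => e eS; rewrite /oQ; case: (boolP (e \in P)) => // eP; rewrite !cin_r //.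
    have -> : (a e \in A) = (b e \in A).
      by case: (hP e eP) => [[-> ->]|[-> ->]]; rewrite !inE !eqxx ?orbT.
    by rewrite !GRing.subrr; do 2 case: ifP.
  rewrite net_cin_r // !big_setU1 ?inE //= !big_set1 => /dvdzP[q hq].
  case/dvdzP: hx => q' hq'; apply: dvdz_ex.
  exists (q - q' - Posz ((be x + be y) %/ (2 * k))%N)%R.
  have := divn_eq (be x + be y) (2 * k); move: hq hq'; clear.
  move: ((be x + be y) %/ (2 * k)) ((be x + be y) %% (2 * k)) => m n; lia.
have vA : v \notin A by rewrite !inE negb_or vx vy.
have := h1 v; rewrite !inE (negPf vx) (negPf vy) vW /= => /(_ isT).
rewrite net_cin // /cbe (negPf vx) (@eq_net _ _ _ _ o1 (oQ Q) S v) // => e eS hv.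
rewrite /oQ; case: (boolP (e \in P)) => // eP; move: hv.
by case: (hP e eP) => [[-> ->]|[-> ->]]; rewrite ![_ == v]eq_sym (negPf vx) (negPf vy).
Qed.

End Contraction.

(** * Elimination of a vertex *)

Section EliminateVertex.
Variables (V E : finType) (k : nat) (z : V).
Hypothesis k0 : 0 < k.
Implicit Types (a b : E -> V) (o : E -> bool) (S D : {set E}) (X W A : {set V}) (x y v r : V).
Implicit Types be : V -> nat.

Let c := 16 * k * k.
Let B0 := 24 * k * k + 3 * k.

(** Every edge at [x] that is not a loop crosses exactly one of [A] and [x |: A]. *)
Lemma cut_not_at a b S x A : x \notin A ->
  cut a b S A + cut a b S (x |: A) =
  2 * cut a b [set e in S | (a e != x) && (b e != x)] A + cut a b S [set x].
Proof.
move=> xA; rewrite {3}/cut big_distrr /= big_mkcond /=.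
rewrite /cut ![\sum_(e in S) _]big_mkcond -!big_split /=; apply: eq_bigr => e _.
rewrite !inE; case: (e \in S) => //=.
case: (a e =P x) => [->|_]; case: (b e =P x) => [->|_] /=; rewrite ?(negPf xA);
  do ?case: (_ \in A) => //.
Qed.

Lemma mu_out a b S W x y : (forall e, e \in S -> a e \in W /\ b e \in W) ->
  y \notin W -> mu a b S x y = 0.
Proof.
move=> h yW; rewrite /mu big1 // => e /h[ha hb].
by case: (a e =P y) => [ea|_]; [rewrite -ea ha in yW | case: (b e =P y) => [eb|_];
  [rewrite -eb hb in yW | rewrite !andbF]].
Qed.

(** The cut around [W :\ x] is the cut around {x, z}. It exceeds [B0], and hence the cut at [z], so
    [cut2] bounds the multiplicity. *)
Lemma mu_z a b S W be o x : good k z a b S W be o -> x \in W -> 2 < #|W| ->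
  (forall A, A \subset W -> A != W -> 1 < #|A| -> B0 < cut a b S A) ->
  2 * mu a b S x z < cut a b S [set x].
Proof.
move=> g xW W3 hA; have xz := good_zx g xW.
have := hA (W :\ x) (subD1set _ _).
have -> : W :\ x != W by apply/eqP => h; have := in_setD1 x W x; rewrite h xW eqxx.
have c1 := cardsD1 x W; rewrite xW in c1.
have -> : 1 < #|W :\ x| by move: c1 W3; clear; lia.
move=> /(_ isT isT).
have -> : W :\ x = (z |: W) :\: [set x; z].
  apply/setP => u; rewrite !inE; case: (u =P z) => [->|_]; rewrite ?orbF ?orbT //=.
  by rewrite (negPf (g_z g)) andbF.
rewrite cut_ends; last exact: g_ends g; last first.
  by rewrite subUset !sub1set !inE xW eqxx orbT.
have := cut2 a b S xz; have := g_cutz g; rewrite -/B0; clear.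
move: (cut _ _ _ _) (cut _ _ _ _) (cut _ _ _ _) (mu _ _ _ _ _) => p q r s; lia.
Qed.

(** The edges of [D] keep their orientation, which runs into [x] except perhaps on edges from [z],
    and they settle the congruence at [x]; all other edges at [x] are split off in pairs and leave
    it balanced. An edge of [D] at [y] lowers the cut at [y] and the residue still due there by one
    each, so that the bound in [g_one] survives. This is why that bound involves [be]. *)
Lemma eliminate a b S W be o x D :
  (forall a' b' S' W' be' o', #|W'| < #|W| -> good k z a' b' S' W' be' o' ->
     extends k z a' b' S' W' be' o') ->
  good k z a b S W be o -> x \in W ->
  (forall A, A \subset W -> A != W -> 1 < #|A| -> B0 < cut a b S A) ->
  cut a b S [set x] <= c + 2 * k ->
  D \subset S ->
  (forall e, e \in D -> (a e == x) (+) (b e == x)) ->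
  (forall e, e \in D -> (a e != z) && (b e != z) -> (a e == x) (+) o e) ->
  (forall y, y \in W -> y != x -> mu a b D x y <= be y) ->
  ((2 * k)%:Z %| ((be x)%:Z - net a b o D x)%R)%Z ->
  (forall y, y != x -> 2 * mu a b (S :\: D) x y <= cut a b (S :\: D) [set x]) ->
  extends k z a b S W be o.
Proof.
move=> IH g xW hA hx DS Dx Do Dbe Dnet hmu.
have xz := good_zx g xW.
have [q0 hq0] := net_parity a b o D x.
have dgD := dg_setD a b x DS.
have ev : ~~ odd (cut a b (S :\: D) [set x]).
  rewrite odd_cut1; have := g_par g xW; case/dvdzP: Dnet => q hq.
  have : exists q', (q * (2 * k)%:Z = 2 * q')%R by exists (q * k)%R; lia.
  case=> q' hq'; rewrite hq' in hq.
  move: hq hq0 dgD; clear; move: (dg _ _ _ _) (dg _ _ _ _) (dg _ _ _ _) (net _ _ _ _ _) => p r s t.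
  lia.
have [a' [b' [S' [o' [[L1 L2 L3 L4] L5 L6 L7]]]]] := lift_all k o xz ev hmu.
pose be' y := be y - mu a b D x y.
(* As the cut at [x] is now empty, only loops can remain there; they are dropped. *)
pose S3 := [set e in S' | a' e != x].
have S3S : S3 \subset S' by apply/subsetP => e; rewrite inE => /andP[].
have loop e : e \in S' -> e \notin S3 -> a' e = x /\ b' e = x.
  move=> eS; rewrite inE eS /= negbK => /eqP ha; split=> //.
  by move: L1; rewrite /cut (bigD1 e) //= ha !inE eqxx; case: eqP.
have S3x e : e \in S3 -> (a' e != x) && (b' e != x).
  rewrite inE => /andP[eS ha]; rewrite ha /=.
  by move: L1; rewrite /cut (bigD1 e) //= !inE (negPf ha); case: eqP.
have cut3 X : cut a' b' S3 X = cut a' b' S' X.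
  rewrite [RHS](cut_setD a' b' X S3S) [X in _ + X]big1 ?addn0 // => e /setDP[eS e3].
  by have [-> ->] := loop e eS e3; rewrite addbb.
have net3 o1 v : net a' b' o1 S3 v = net a' b' o1 S' v.
  rewrite [RHS](net_setD a' b' o1 v S3S) [X in (_ + X)%R]big1 ?GRing.addr0 // => e /setDP[eS e3].
  by have [-> ->] := loop e eS e3; rewrite GRing.subrr; case: ifP.
have dg3 v : v != x -> dg a' b' S3 v = dg a' b' S' v.
  move=> vx; rewrite [RHS](dg_setD a' b' v S3S) [X in _ + X]big1 ?addn0 // => e /setDP[eS e3].
  by have [-> ->] := loop e eS e3; rewrite eq_sym (negPf vx).
have endsD e : e \in D -> a e \in z |: W /\ b e \in z |: W by move/(subsetP DS)/(g_ends g).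
have netD y : y \in W -> y != x -> net a b o D y = mu a b D x y.
  move=> yW yx; have yz := good_zx g yW.
  have xyF : (x == y) = false by rewrite eq_sym (negPf yx).
  rewrite /net /mu (big_morph Posz PoszD (erefl _)); apply: eq_bigr => e eD.
  have := Dx e eD; have := Do e eD.
  case: (a e =P x) => [->|_] /=.
    rewrite xyF orbF xz /=; case: (b e =P y) => [->|_]; last by case: ifP.
    by rewrite yz => /(_ isT); case: (o e).
  move=> h /eqP bx; move: h; rewrite bx xyF eqxx andbT xz andbT.
  case: (a e =P y) => [->|_]; last by case: ifP.
  by rewrite yz => /(_ isT) ->.
have sumD : (net a b o D z + net a b o D x + \sum_(y in W :\ x) Posz (mu a b D x y) = 0)%R.
  have ht := net_total o endsD; rewrite big_setU1 ?(g_z g) //= (big_setD1 x) //= in ht.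
  rewrite -[RHS]ht -GRing.addrA; congr (_ + (_ + _))%R.
  by apply: eq_bigr => y; rewrite !inE => /andP[yx yW]; rewrite netD.
have sumbe : \sum_(v in W :\ x) be v = \sum_(v in W :\ x) be' v + \sum_(v in W :\ x) mu a b D x v.
  rewrite -big_split /=; apply: eq_bigr => y; rewrite !inE => /andP[yx yW].
  by rewrite /be' subnK // Dbe.
have [||o3 [ag3 h3]] := IH a' b' S3 (W :\ x) be' o'.
- by rewrite [X in _ < X](cardsD1 x) xW.
- split.
  + by rewrite !inE (negPf (g_z g)) andbF.
  + move=> e e3; have /andP[ha hb] := S3x _ e3; have := subsetP S3S _ e3.
    have hU : forall e, e \in S :\: D -> a e \in z |: W /\ b e \in z |: W.
      by move=> f /setDP[/(g_ends g)].
    by case/(L6 _ hU); rewrite !inE ha hb.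
  + rewrite cut3 L2 1?eq_sym //; apply: leq_trans (g_cutz g).
    by apply: cut_subset; apply: subsetDl.
  + rewrite net3 L5; have := net_setD a b o z DS; move: (g_sum g) Dnet sumD.
    rewrite (big_setD1 x) //= sumbe => /dvdzP[q1 hq1] /dvdzP[q2 hq2].
    rewrite -(big_morph Posz PoszD (erefl _)) => h1 h2; apply: dvdz_ex; exists (q1 - q2)%R.
    move: hq1 hq2 h1 h2.
    set s1 := \sum_(v in W :\ x) be' v; set s2 := \sum_(v in W :\ x) mu a b D x v.
    move: s1 s2 => s1 s2; clear.
    move: (net _ _ _ _ _) (net _ _ _ _ _) (net _ _ _ _ _) (net _ _ _ _ _) => n1 n2 n3 n4.
    lia.
  + move=> y; rewrite !inE => /andP[yx yW]; rewrite dg3 // L4.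
    have [q1 hq1] := net_parity a b o D y; rewrite netD // in hq1.
    have := dg_setD a b y DS; have := g_par g yW; have := Dbe y yW yx.
    rewrite /be'; move: hq1; clear.
    move: (dg _ _ _ _) (dg _ _ _ _) (dg _ _ _ _) (mu _ _ _ _ _) (be y) => p q r s t; lia.
  + move=> y; rewrite !inE => /andP[yx yW]; apply: leq_ltn_trans (g_lt g yW).
    exact: leq_subr.
  + move=> y; rewrite !inE => /andP[yx yW] _; rewrite cut3 L2 //.
    have hy : W != [set y] by apply/eqP => h; move: xW; rewrite h inE eq_sym (negPf yx).
    have := g_one g yW hy; have := cut_setD a b [set y] DS; rewrite -/c /be'.
    have -> : cut a b D [set y] = mu a b D x y.
      have xyF : (x == y) = false by rewrite eq_sym (negPf yx).
      rewrite /cut /mu; apply: eq_bigr => e /Dx; rewrite !inE.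
      case: (a e =P x) => [->|_] /=; first by rewrite xyF /= orbF.
      by move/eqP ->; rewrite xyF addbF eqxx andbT.
    have := Dbe y yW yx; clear.
    move: (cut _ _ _ _) (cut _ _ _ _) (mu _ _ _ _ _) (be y) => p q r s; lia.
  + move=> A AW AnW A1; rewrite cut3.
    have xA : x \notin A by apply/negP => /(subsetP AW); rewrite !inE eqxx.
    have AW' : A \subset W by apply: subset_trans AW (subD1set _ _).
    apply: leq_trans (L3 A xA).
    have -> : cut a b [set e in S :\: D | (a e != x) && (b e != x)] A =
              cut a b [set e in S | (a e != x) && (b e != x)] A.
      apply: eq_bigl => e; rewrite !inE; case: (boolP (e \in D)) => //= /Dx.
      by case: (a e == x); case: (b e == x); rewrite ?andbF.
    have nA : A != W by apply/eqP => h; rewrite h xW in xA.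
    have nA2 : x |: A != W.
      by apply: contra AnW => /eqP <-; rewrite setU1K.
    have xA1 : 1 < #|x |: A| by rewrite cardsU1 xA add1n ltnW.
    have xAW : x |: A \subset W by rewrite subUset sub1set xW AW'.
    (* Origin of the factor 3/2 in [B0]: both cuts exceed [B0] and at most c + 2k edges leave [x],
       so at least B0 - (c + 2k)/2 = c + 2k edges remain. *)
    have := cut_not_at a b S xA; have := hA A AW' nA A1; have := hA _ xAW nA2 xA1.
    move: hx; rewrite -/c /B0 /c; clear.
    move: (cut _ _ _ _) (cut _ _ _ _) (cut _ _ _ _) (cut _ _ _ _) => p q r s.
    rewrite -!mulnA; move: (k * k) => kk; lia.
have [o4 [ag4 h4]] : extends k z a b (S :\: D) W (fun y => if y == x then 0 else be' y) o.
  apply: L7; exists o3; split.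
    move=> e eS hz; case: (boolP (e \in S3)) => e3; first exact: ag3.
    by have [ha hb] := loop e eS e3; move: hz; rewrite ha hb (negPf xz).
  move=> v vW; rewrite -net3; case: (v =P x) => [->|/eqP vx].
    rewrite /net big1; first by rewrite GRing.subr0 dvdz0.
    by move=> e /S3x /andP[/negPf -> /negPf ->]; case: ifP.
  by apply: h3; rewrite !inE vx.
pose o5 e := if e \in D then o e else o4 e.
exists o5; split.
  move=> e eS hz; rewrite /o5; case: (boolP (e \in D)) => // eD; apply: ag4 => //.
  by rewrite inE eD.
move=> v vW; have := h4 v vW.
have -> : net a b o5 S v = (net a b o D v + net a b o4 (S :\: D) v)%R.
  rewrite (net_setD _ _ _ _ DS); congr (_ + _)%R; apply: eq_net => e; rewrite /o5.
    by move=> ->.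
  by rewrite inE => /andP[/negPf->].
case: (v =P x) => [->|/eqP vx].
  case/dvdzP => q1 hq1; case/dvdzP: Dnet => q2 hq2; apply: dvdz_ex; exists (q1 - q2)%R.
  move: hq1 hq2; clear; move: (net _ _ _ _ _) (net _ _ _ _ _) => n1 n2; lia.
case/dvdzP => q1 hq1; apply: dvdz_ex; exists q1; move: hq1; rewrite netD // /be'.
have := Dbe v vW vx; clear; move: (net _ _ _ _ _) (mu _ _ _ _ _) => n1 n2; lia.
Qed.

End EliminateVertex.

Section Elimination.
Variables (V E : finType) (k : nat) (z : V).
Hypothesis k0 : 0 < k.
Implicit Types (a b : E -> V) (o : E -> bool) (S D : {set E}) (X W A U : {set V}) (x y v r : V).
Implicit Types be : V -> nat.

Let c := 16 * k * k.
Let B0 := 24 * k * k + 3 * k.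

Lemma cut_mu_in a b S U x : (forall e, e \in S -> a e \in U /\ b e \in U) ->
  cut a b S [set x] = \sum_(y in U :\ x) mu a b S x y.
Proof.
move=> hU; rewrite cut_mu (bigID (mem U)) /= [X in _ + X]big1 ?addn0.
  by apply: eq_bigl => y; rewrite !inE.
by move=> y /andP[_ yU]; apply: mu_out yU.
Qed.

Lemma extends_agree a b S W be o o1 : agree z a b S o o1 ->
  extends k z a b S W be o1 -> extends k z a b S W be o.
Proof.
move=> h [o2 [ag h2]]; exists o2; split=> // e eS hz.
by rewrite ag // h.
Qed.

Lemma good_agree a b S W be o o1 : agree z a b S o o1 ->
  good k z a b S W be o -> good k z a b S W be o1.
Proof. by move=> h g; case: (g) => *; split=> //; rewrite (agree_net h). Qed.

(** A vertex with [be x] = 0 is eliminated with [D] empty. If there is none, every neighbour in [W]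
    can spare one unit, and fewer than 2k edges from distinct neighbours, all directed into [x],
    correct what the preoriented edges from [z] leave at [x]. *)
Lemma eliminate_any a b S W be o :
  (forall a' b' S' W' be' o', #|W'| < #|W| -> good k z a' b' S' W' be' o' ->
     extends k z a' b' S' W' be' o') ->
  good k z a b S W be o -> 2 < #|W| ->
  (forall A, A \subset W -> A != W -> 1 < #|A| -> B0 < cut a b S A) ->
  (forall x y, x \in W -> y \in W -> x != y -> mu a b S x y < k) ->
  (forall x, x \in W -> cut a b S [set x] <= c + 2 * k) ->
  extends k z a b S W be o.
Proof.
move=> IH g W3 hA hmu hcut.
have W1 x : W != [set x] by apply/eqP => h; move: W3; rewrite h cards1.
have c_le x : x \in W -> c <= cut a b S [set x].
  by move=> xW; apply: leq_trans (g_one g xW (W1 x)); apply: leq_addr.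
have muW x y : x \in W -> y != x -> y != z -> mu a b S x y <= k.
  move=> xW yx yz; case: (boolP (y \in W)) => yW; first by rewrite ltnW // hmu // eq_sym.
  rewrite (mu_out (W := z |: W)) //; first exact: g_ends g.
  by rewrite !inE negb_or yz yW.
case: (boolP [exists x in W, be x == 0]) => [/exists_inP[x xW /eqP be0]|/exists_inPn bepos].
  have xz := good_zx g xW.
  apply: (@eliminate _ _ _ _ k0 a b S W be o x set0 IH g xW hA (hcut x xW)).
  - exact: sub0set.
  - by move=> e; rewrite inE.
  - by move=> e; rewrite inE.
  - by move=> y _ _; rewrite /mu big_set0.
  - by rewrite be0 /net big_set0.
  - move=> y yx; rewrite setD0; case: (y =P z) => [->|/eqP yz].
      by apply: ltnW; apply: mu_z g xW W3 hA.
    apply: leq_trans (c_le _ xW); have := muW _ _ xW yx yz; rewrite /c; clear -k0.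
    by move: (mu _ _ _ _ _) => m; nia.
have [x xW] : exists x, x \in W by apply/card_gt0P; apply: leq_trans W3.
have xz := good_zx g xW; have zx : z != x by rewrite eq_sym.
(* Away from [z], all edges at [x] are directed into [x]. *)
pose o1 e := if (a e == z) || (b e == z) then o e else a e != x.
have ag1 : agree z a b S o o1 by move=> e _ hz; rewrite /o1 hz.
apply: (extends_agree ag1); have g1 := good_agree ag1 g.
pose jn e u w := (a e == u) && (b e == w) || (a e == w) && (b e == u).
have jn_other e y : y != x -> jn e x y -> other a b x e = y /\ (a e == x) (+) (b e == x).
  move=> yx; rewrite /jn /other; have xyF : (x == y) = false by rewrite eq_sym (negPf yx).
  case: (a e =P x) => [->|ax] /=.
    by rewrite xyF /= orbF => /eqP ->; rewrite (negPf yx).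
  by case/andP => /eqP -> ->.
pose Dz := [set e in S | jn e x z].
pose Y := [set y in W :\ x | 0 < mu a b S x y].
have cutY : cut a b S [set x] <= mu a b S x z + k * #|Y|.
  rewrite (cut_mu_in x (g_ends g)) (big_setD1 z) ?inE ?zx ?eqxx //= leq_add2l.
  rewrite (_ : (z |: W) :\ x :\ z = W :\ x); last first.
    apply/setP => u; rewrite !inE; case: (u =P z) => [->|] //=.
    by rewrite (negPf (g_z g)) andbF.
  rewrite -sum1_card big_distrr /= (big_setID Y) /= [X in _ + X <= _]big1; last first.
    by move=> y; rewrite !inE => /andP[h /andP[yx yW]]; move: h; rewrite yx yW /= -eqn0Ngt => /eqP.
  rewrite addn0 (_ : (W :\ x) :&: Y = Y); last by apply/setIidPr/subsetP => y; rewrite inE => /andP[].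
  apply: leq_sum => y; rewrite !inE muln1 => /andP[/andP[yx yW] _]; apply: muW => //.
  exact: good_zx g yW.
have mz := mu_z g xW W3 hA.
(* Fewer than half of the at least 16 k^2 edges leaving [x] go to [z], and at most k of them go to
   any one vertex of [W]. *)
have hY : 8 * k <= #|Y|.
  have := c_le _ xW; rewrite /c; move: cutY mz; clear -k0.
  by move: (cut _ _ _ _) (mu _ _ _ _ _) #|Y| => p q r; nia.
(* The number of further edges that have to enter [x]. *)
pose uz : int := ((net a b o1 Dz x - (be x)%:Z) %% (2 * k)%:Z)%Z.
have k2 : (Posz (2 * k) != 0)%R by move: k0; clear; lia.
have hu1 : (0 <= uz)%R by apply: modz_ge0.
have hu2 : (uz < (2 * k)%:Z)%R by apply: ltz_pmod; move: k0; clear; lia.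
have hu3 := divz_eq (net a b o1 Dz x - (be x)%:Z)%R (2 * k)%:Z; rewrite -/uz in hu3.
have [Y' [Y'Y cY']] : exists Q : {set V}, Q \subset Y /\ #|Q| = `|uz|%N.
  apply: subset_of_card; apply: leq_trans hY; move: hu1 hu2; clear; lia.
(* One edge, singled out by [pick], from [x] to each neighbour in [Y']. *)
pose P := [set e in S | [&& (a e == x) (+) (b e == x), other a b x e \in Y' &
   [pick f in S | jn f x (other a b x e)] == Some e]].
have Y'W y : y \in Y' -> [/\ y \in W, y != x, y != z & 0 < mu a b S x y].
  move/(subsetP Y'Y); rewrite !inE => /andP[/andP[yx yW] m0]; split=> //.
  exact: good_zx g yW.
have muP y : y != x -> mu a b P x y = (y \in Y').
  move=> yx; case: (boolP (y \in Y')) => yY.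
    have [yW _ yz /mu_gt0[e0 e0S he0]] := Y'W y yY.
    case hp: [pick f in S | jn f x y] => [f|]; last first.
      by move: hp; case: pickP => // h; have := h e0; rewrite e0S /jn he0.
    have [fS fj] : f \in S /\ jn f x y.
      by move: hp; case: pickP => // f' /andP[h1 h2] [<-].
    have [fo fx] := jn_other f y yx fj.
    rewrite /mu (big_setD1 f) ?inE ?fS ?fx ?fo ?yY ?hp ?eqxx //=.
    rewrite -/(jn f x y) fj big1 // => f' /setD1P[nf]; rewrite inE => /and4P[f'S _ _ hf'].
    case: (boolP (jn f' x y)) => fj'; last by move: fj'; rewrite /jn => /negPf ->.
    have [fo' _] := jn_other f' y yx fj'; move: hf'; rewrite fo' hp => /eqP[hff].
    by rewrite hff eqxx in nf.
  rewrite /mu big1 // => f; rewrite inE => /and4P[fS _ fY _].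
  case: (boolP (jn f x y)) => fj; last by move: fj; rewrite /jn => /negPf ->.
  by have [fo _] := jn_other f y yx fj; rewrite fo (negPf yY) in fY.
have cutP : cut a b P [set x] = `|uz|%N.
  rewrite cut_mu -cY' -sum1_card (eq_bigr (fun y => (y \in Y') : nat)); last by move=> y; exact: muP.
  rewrite (bigID (mem Y')) /= [X in _ + X]big1 ?addn0; last by move=> y /andP[_ /negPf ->].
  rewrite (eq_bigl (fun y => y \in Y')); last by move=> y; rewrite /= andbC; case: (boolP (y \in Y')) => // /Y'W[].
  by apply: eq_bigr => y ->.
have netP : net a b o1 P x = (- uz)%R.
  have -> : (- uz)%R = (- Posz (cut a b P [set x]))%R by rewrite cutP; move: hu1; clear; lia.
  rewrite /net /cut (big_morph Posz PoszD (erefl _)) -GRing.sumrN; apply: eq_bigr => e.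
  rewrite !inE => /and4P[_ ex /Y'W[_ ox oz _] _]; rewrite /o1.
  move: ex ox oz; rewrite /other; case: (a e =P x) => [->|_] /=.
    by rewrite (negPf xz) /= => /negPf -> _ /negPf ->.
  by move=> bx _ /negPf ->; rewrite (eqP bx) (negPf xz) eqxx.
pose D := Dz :|: P.
have DzS : Dz \subset S by apply/subsetP => e; rewrite inE => /andP[].
have PS : P \subset S by apply/subsetP => e; rewrite inE => /andP[].
have DS : D \subset S by rewrite subUset DzS PS.
have DzD : Dz \subset D by apply: subsetUl.
have DD : D :\: Dz = P.
  apply/setP => e; rewrite in_setD in_setU; case: (boolP (e \in Dz)) => //= eD.
  symmetry; apply/negP; rewrite inE => /and4P[_ _ hY' _].
  move: eD; rewrite inE => /andP[_ ej]; have [eo _] := jn_other e z zx ej.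
  by have [_ _] := Y'W _ hY'; rewrite eo eqxx.
have cutDz : cut a b Dz [set x] = mu a b S x z.
  rewrite /cut /mu [RHS](big_setID Dz) /= (setIidPr DzS) [X in _ = _ + X]big1 ?addn0.
    apply: eq_bigr => e; rewrite !inE => /andP[_ ej]; have [_ ->] := jn_other e z zx ej.
    by move: ej; rewrite /jn => ->.
  by move=> e; rewrite !inE negb_and => /andP[/orP[/negPf->//|]]; rewrite /jn => /negPf ->.
apply: (@eliminate _ _ _ _ k0 a b S W be o1 x D IH g1 xW hA (hcut x xW) DS).
- move=> e; rewrite !inE => /orP[/andP[_ ej]|/and4P[] //].
  by have [] := jn_other e z zx ej.
- move=> e; rewrite !inE => /orP[/andP[_ ej]|/and4P[_ ex _ _]] /andP[az bz].
    by move: ej; rewrite /jn (negPf az) (negPf bz) !andbF.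
  by rewrite /o1 (negPf az) (negPf bz) /=; case: (a e == x).
- move=> y yW yx; rewrite (mu_setD a b x y DzD) DD muP //.
  have -> : mu a b Dz x y = 0.
    rewrite /mu big1 // => e; rewrite !inE => /andP[_ ej].
    have yz := good_zx g yW.
    case: (boolP (jn e x y)) => ej'; last by move: ej'; rewrite /jn => /negPf ->.
    have [e1 _] := jn_other e z zx ej; have [e2 _] := jn_other e y yx ej'.
    by rewrite -e2 e1 eqxx in yz.
  rewrite add0n; have := bepos y yW; rewrite -lt0n; case: (y \in Y') => //.
- rewrite (net_setD a b o1 x DzD) DD netP; apply: dvdz_ex.
  exists (- ((net a b o1 Dz x - (be x)%:Z) %/ (2 * k)%:Z)%Z)%R.
  move: hu3; set q := (_ %/ _)%Z; clear; move: uz (net _ _ _ _ _) => u n; lia.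
- move=> y yx; have cS := cut_setD a b [set x] DS; have cD := cut_setD a b [set x] DzD.
  rewrite DD cutP cutDz in cD.
  case: (y =P z) => [->|/eqP yz].
    rewrite [X in 2 * X](_ : _ = 0) // /mu big1 // => e; rewrite !inE => /andP[h eS].
    by move: h; rewrite eS /= negb_or => /andP[]; rewrite /jn => /negPf ->.
  have m1 : mu a b (S :\: D) x y <= k.
    by apply: leq_trans (muW _ _ xW yx yz); rewrite (mu_setD a b x y DS) leq_addl.
  move: cS; rewrite cD; have := c_le _ xW; move: hu1 hu2 mz m1; rewrite /c; clear -k0.
  move: (cut _ _ _ _) (mu _ _ _ _ _) (mu _ _ _ _ _) (cut _ _ _ _) uz => p q r s u.
  nia.
Qed.

End Elimination.

(** * Induction for the modulo orientation theorem *)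

Section Extension.
Variables (V E : finType) (k : nat) (z : V).
Hypothesis k0 : 0 < k.
Implicit Types (a b : E -> V) (o : E -> bool) (S D : {set E}) (X W A U : {set V}) (x y v r : V).
Implicit Types be : V -> nat.

Let c := 16 * k * k.
Let B0 := 24 * k * k + 3 * k.

(** The cuts at [x] and [y], each at least [c], add up to the cut at [z] plus twice the multiplicity
    of xy. That is at most B0 + 2(k - 1), which is less than 2c. *)
Lemma extends_two a b S W be o : good k z a b S W be o -> #|W| = 2 ->
  (forall x y, x \in W -> y \in W -> x != y -> mu a b S x y < k) -> False.
Proof.
move=> g /eqP/cards2P[x [y [xy WE]]] hmu.
have xW : x \in W by rewrite WE !inE eqxx.
have yW : y \in W by rewrite WE !inE eqxx orbT.
have xz := good_zx g xW; have yz := good_zx g yW.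
have hx : W != [set x] by apply/eqP => h; move: yW; rewrite h inE eq_sym (negPf xy).
have hy : W != [set y] by apply/eqP => h; move: xW; rewrite h inE (negPf xy).
have ux : z |: W = z |: (x |: [set y]) by rewrite WE.
have := g_one g xW hx; have := g_one g yW hy; have := g_cutz g; have := hmu x y xW yW xy.
rewrite !(cut_mu_in _ (g_ends g)) ux.
have -> : (z |: (x |: [set y])) :\ z = [set x; y].
  by rewrite setU1K // !inE negb_or ![z == _]eq_sym xz yz.
have -> : (z |: (x |: [set y])) :\ x = [set z; y].
  by rewrite setUCA setU1K // !inE negb_or xz xy.
have -> : (z |: (x |: [set y])) :\ y = [set z; x].
  by rewrite [x |: _]setUC setUCA setU1K // !inE negb_or yz eq_sym xy.
rewrite !big_setU1 ?inE ?xy ?[z == _]eq_sym ?xz ?yz //= !big_set1.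
rewrite [mu a b S y x]mu_sym [mu a b S x z]mu_sym [mu a b S y z]mu_sym; clear -k0.
by move: (mu _ _ _ _ _) (mu _ _ _ _ _) (mu _ _ _ _ _) (be x) (be y) => p q r s t; nia.
Qed.

(** Splitting off one pair at [x] lowers the cut at [x] and the cuts of larger sets by at most 2 and
    does not affect the cuts at other single vertices. The strict inequalities leave room for this,
    as [be x] is less than 2k. *)
Lemma extends_lift_one a b S W be o x :
  (forall a' b' S' o', #|S'| < #|S| -> good k z a' b' S' W be o' ->
     extends k z a' b' S' W be o') ->
  good k z a b S W be o -> 2 < #|W| ->
  (forall A, A \subset W -> A != W -> 1 < #|A| -> B0 < cut a b S A) ->
  (forall x y, x \in W -> y \in W -> x != y -> mu a b S x y < k) ->
  x \in W -> c + 2 * k < cut a b S [set x] ->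
  extends k z a b S W be o.
Proof.
move=> IH g W3 hA hmu xW hx; have xz := good_zx g xW.
have mz := mu_z g xW W3 hA.
have hlt y : y != x -> mu a b S x y < cut a b S [set x].
  move=> yx; case: (y =P z) => [->|/eqP yz].
    by move: mz; clear; move: (mu _ _ _ _ _) (cut _ _ _ _) => m n; lia.
  case: (boolP (y \in W)) => yW.
    have := hmu x y xW yW; rewrite eq_sym => /(_ yx); move: hx; rewrite /c; clear.
    by move: (mu _ _ _ _ _) (cut _ _ _ _) => m n; lia.
  rewrite (mu_out (W := z |: W)) ?inE ?negb_or ?yz //; last exact: g_ends g.
  by move: hx; clear; lia.
have [y1 y1x m1] : exists2 y, y != x & 0 < mu a b S x y.
  have : \sum_(y | y != x) mu a b S x y != 0.
    by rewrite -cut_mu; move: hx; clear; lia.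
  by rewrite sum_nat_eq0 negb_forall => /existsP[y]; rewrite negb_imply -lt0n => /andP[]; exists y.
have [y2 /andP[y2x y21] m2] : exists2 y, (y != x) && (y != y1) & 0 < mu a b S x y.
  have : \sum_(y | (y != x) && (y != y1)) mu a b S x y != 0.
    have := hlt y1 y1x; rewrite cut_mu (bigD1 y1) //=; clear.
    by move: (mu _ _ _ _ _) (\sum_(_ | _) _) => m n; lia.
  by rewrite sum_nat_eq0 negb_forall => /existsP[y]; rewrite negb_imply -lt0n => /andP[]; exists y.
have [e1 e1S he1] := mu_gt0 m1; have [e2 e2S he2] := mu_gt0 m2.
have [e1x o1] := edge_at y1x he1; have [e2x o2] := edge_at y2x he2.
have e12 : e1 != e2 by apply/eqP => h; move: y21; rewrite -o1 -o2 h eqxx.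
have o12 : other a b x e1 != other a b x e2 by rewrite o1 o2 eq_sym.
have cl X := cut_lift e1S e2S e12 e1x e2x X.
rewrite o1 o2 in cl.
have one y : y != x -> cut a b S [set y] = cut (la a b x e1) (lb a b x e1 e2) (S :\ e2) [set y].
  move=> yx; rewrite (cl [set y]) !inE [x == y]eq_sym (negPf yx) /=.
  case: (y1 =P y) => [<-|_]; last by rewrite addn0.
  by rewrite (negPf y21) addn0.
apply: (extends_lift e1S e2S e12 e1x e2x xz o12); apply: IH.
  by rewrite [X in _ < X](cardsD1 e2) e2S.
split.
- exact: g_z g.
- by apply: lift_ends => //; apply: g_ends g.
- by rewrite -one 1?eq_sym //; apply: g_cutz g.
- by rewrite net_lift_z //; apply: g_sum g.
- move=> y yW; have := g_par g yW; rewrite (dg_lift e1S e2S e12 e1x e2x y) oddD.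
  by case: (x == y); rewrite addbF.
- by move=> y /(g_lt g).
- move=> y yW hy; case: (y =P x) => [->|/eqP yx]; last by rewrite -one //; apply: (g_one g).
  have := cl [set x]; rewrite !inE eqxx (negPf y1x) (negPf y2x) /=.
  have := g_lt g xW; move: hx; rewrite -/c; clear.
  by move: (cut _ _ _ _) (cut _ _ _ _) (be x) => p q r; lia.
- move=> A AW AnW A1; have := hA A AW AnW A1; have := cl A; rewrite /B0; clear -k0.
  move: (cut _ _ _ _) (cut _ _ _ _) (_ && _) => p q r; case: r; nia.
Qed.

(** Induction on the number of vertices, then of edges. Cuts of size at most [B0] are taken apart,
    pairs joined by k - 1 edges are identified, and vertices whose cut exceeds c + 2k lose a pair;
    in any other graph on at least three vertices of [W] a vertex can be eliminated. *)
Lemma good_extends w s a b S W be o : #|W| <= w -> #|S| < s ->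
  good k z a b S W be o -> extends k z a b S W be o.
Proof.
elim: w s a b S W be o => [|w IHw] s.
  move=> a b S W be o; rewrite leqn0 cards_eq0 => /eqP-> _ _.
  by exists o; split=> [|v]; [exact: agree_refl | rewrite inE].
elim: s => [//|s IHs] a b S W be o hW hS g.
have {}IHw a' b' S' W' be' o' : #|W'| < #|W| -> good k z a' b' S' W' be' o' ->
     extends k z a' b' S' W' be' o'.
  move=> h; apply: (IHw #|S'|.+1) => //.
  by rewrite -ltnS; apply: leq_trans hW.
have {}IHs a' b' S' o' : #|S'| < #|S| -> good k z a' b' S' W be o' ->
     extends k z a' b' S' W be o'.
  by move=> h; apply: IHs => //; exact: leq_trans h hS.
case: (set_0Vmem W) => [->|[x xW]].
  by exists o; split=> [|v]; [exact: agree_refl | rewrite inE].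
case: (W =P [set x]) => [WE|/eqP Wx].
  exists o; split; first exact: agree_refl.
  move=> v; rewrite WE inE => /eqP->; have := net_total o (g_ends g).
  have := g_sum g; rewrite big_setU1 ?(g_z g) //= WE !big_set1 => /dvdzP[q hq] ht.
  apply: dvdz_ex; exists (- q)%R; move: hq ht; clear.
  by move: (net _ _ _ _ _) (net _ _ _ _ _) => m n; lia.
case: (boolP [exists A : {set V}, [&& A \subset W, A != W, 1 < #|A| & cut a b S A <= B0]]).
  case/existsP => A /and4P[AW AnW A1 hA].
  have [r rA] : exists r, r \in A by apply/card_gt0P; apply: ltnW.
  have hc : (A == W) || (c + 2 * k <= cut a b S A) by rewrite (g_many g) ?orbT.
  have g1 := contract_good k0 AW rA g hc.
  have cardA : #|cW W A r| < #|W| by apply: card_cW.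
  have [o1 [ag1 h1]] := IHw _ _ _ _ _ _ cardA g1.
  have hr : r \in cW W A r by rewrite !inE eqxx.
  have := h1 r hr; rewrite /cbe eqxx => h1r.
  have g2 := contract_out_good AW rA g hA h1r.
  apply: (extends_glue AW rA g ag1 h1); apply: IHw g2.
  by apply: proper_card; rewrite properEneq AnW AW.
move=> /existsPn hA0.
have hA A : A \subset W -> A != W -> 1 < #|A| -> B0 < cut a b S A.
  by move=> AW AnW A1; have := hA0 A; rewrite AW AnW A1 /= -ltnNge.
case: (boolP [exists u in W, [exists y in W, (u != y) && (k <= (mu a b S u y).+1)]]).
  case/exists_inP => u uW /exists_inP[y yW /andP[uy hm]].
  apply: (extends_parallel k0 g uW yW uy hm).
  have AW : [set u; y] \subset W by rewrite subUset !sub1set uW yW.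
  have rA : u \in [set u; y] by rewrite !inE eqxx.
  have A1 : 1 < #|[set u; y]| by rewrite cards2 uy.
  apply: IHw; first exact: card_cW.
  apply: contract_good => //; case: eqP => //= /eqP AnW; exact: (g_many g).
move=> /exists_inPn hm.
have hmu u y : u \in W -> y \in W -> u != y -> mu a b S u y < k.
  move=> uW yW uy; have /exists_inPn/(_ y yW) := hm u uW.
  by rewrite uy /= -ltnNge => /ltnW.
have W3 : 2 < #|W|.
  rewrite ltnNge leq_eqVlt ltnS; apply/negP => /orP[/eqP W2|].
    exact: extends_two g W2 hmu.
  move=> W1; move: Wx; rewrite eq_sym eqEcard sub1set xW cards1 W1.
  by [].
case: (boolP [exists u in W, c + 2 * k < cut a b S [set u]]) => [/exists_inP[u uW hu]|/exists_inPn hc].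
  exact: extends_lift_one IHs g W3 hA hmu uW hu.
apply: (eliminate_any k0 IHw g W3 hA hmu) => u uW.
by rewrite leqNgt; apply: hc.
Qed.

End Extension.

(** At least 16 k^2 + 2k for positive k, which is c + 2k in [good]. *)
Definition mod_conn (k : nat) := 18 * k * k.

(** Outdegrees modulo k correspond to net outdegrees modulo 2k with the parity of the degree; hence
    the modulus and the parity condition in [good]. Here nothing is preoriented. *)
Theorem mod_orientation (V E : finType) (k : nat) (a b : E -> V) (S : {set E})
    (W : {set V}) (p : V -> nat) : 0 < k ->
  (forall e, e \in S -> a e \in W /\ b e \in W) ->
  (forall X : {set V}, X \subset W -> X != set0 -> X != W -> mod_conn k <= cut a b S X) ->
  \sum_(v in W) p v = #|S| %[mod k] ->
  exists o : E -> bool, forall v, v \in W ->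
    \sum_(e in S) ((if o e then a e else b e) == v) = p v %[mod k].
Proof.
move=> k0 hW hcut hp.
(* An outdegree p v means a net outdegree 2 * p v - deg v; None plays the role of z. *)
pose be (u : option V) := if u is Some v then (2 * p v + (2 * k - 1) * dg a b S v) %% (2 * k) else 0.
pose sa e := Some (a e); pose sb e := Some (b e).
have sinj : injective (@Some V) by move=> x y [].
have pre1 v : @Some V @^-1: [set Some v] = [set v].
  by apply/setP => u; rewrite !inE; apply/eqP/eqP => [[]|->].
have dgs v : dg sa sb S (Some v) = dg a b S v.
  by rewrite dg_map (eq_bigl (pred1 v)) ?big_pred1_eq // => u; rewrite (inj_eq sinj).
have nets o v : net sa sb o S (Some v) = net a b o S v.
  by rewrite net_map (eq_bigl (pred1 v)) ?big_pred1_eq // => u; rewrite (inj_eq sinj).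
have sdg : \sum_(v in W) dg a b S v = 2 * #|S|.
  rewrite /dg exchange_big /= -sum1_card big_distrr /=; apply: eq_bigr => e /hW[ha hb].
  by rewrite big_split /= !sum_eq_in ha hb.
have pre (X : {set option V}) : X \subset [set Some v | v in W] ->
    @Some V @^-1: X \subset W.
  move=> XW; apply/subsetP => v; rewrite inE => /(subsetP XW) /imsetP[w wW [->]] //.
have preW (X : {set option V}) : X \subset [set Some v | v in W] ->
    X = Some @: (@Some V @^-1: X).
  move=> XW; apply/setP => u; apply/idP/imsetP => [uX|[v]].
    by have /imsetP[w wW uw] := subsetP XW _ uX; exists w; rewrite // inE -uw.
  by rewrite inE => h ->.
have g : good k None sa sb S [set Some v | v in W] be xpredT.
  split.
  - by apply/negP => /imsetP[].
  - by move=> e /hW[ha hb]; split; apply/setU1P; right; apply: imset_f.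
  - rewrite (_ : cut _ _ _ _ = 0) // /cut big1 // => e _; rewrite !inE //.
  - have -> : net sa sb xpredT S None = 0%R by rewrite /net big1.
    rewrite big_imset /=; last by move=> ? ? _ _ [].
    have : \sum_(v in W) (2 * p v + (2 * k - 1) * dg a b S v) =
      2 * (\sum_(v in W) p v) + (2 * k - 1) * (2 * #|S|).
      by rewrite -sdg !big_distrr -big_split.
    rewrite (eq_bigr (fun v => (2 * p v + (2 * k - 1) * dg a b S v) %/ (2 * k) * (2 * k)
       + be (Some v))); last by move=> v _; rewrite -divn_eq.
    rewrite big_split /= -big_distrl /=; set q1 := \sum_(v in W) _ %/ _.
    have := divn_eq (\sum_(v in W) p v) k; have := divn_eq #|S| k; rewrite hp.
    set s1 := \sum_(i in W) (_ %% _); set s2 := \sum_(v in W) p v.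
    move: s1 s2 q1 #|S| (s2 %/ k) => s1 s2 q1 s d1.
    move: (s %/ k) (s %% k) => d2 r h1 h2 h3; apply: dvdz_ex.
    exists (Posz d1 - Posz d2 + 2 * Posz s - Posz q1)%R.
    have k1 : 2 * k - 1 = k + k.-1 by move: k0; clear; lia.
    have k2 : Posz k.-1 = (Posz k - 1)%R by move: k0; clear; lia.
    move: h3 h1 h2 k2; rewrite k1; clear; lia.
  - move=> x /imsetP[v vW ->]; rewrite dgs /be.
    have k1 : 2 * k - 1 = (2 * k.-1).+1 by move: k0; clear; lia.
    set n := (X in X %% _); have <- : odd n = odd (n %% (2 * k)).
      by rewrite [in LHS](divn_eq n (2 * k)) oddD mulnCA oddM.
    by rewrite /n k1 oddD !oddM /= oddM.
  - by move=> x /imsetP[v vW ->]; rewrite /be ltn_mod muln_gt0.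
  - move=> x /imsetP[v vW ->] hne; rewrite cut_map pre1.
    have : mod_conn k <= cut a b S [set v].
      apply: hcut; first by rewrite sub1set.
        by apply/set0Pn; exists v; rewrite inE.
      by apply: contra hne => /eqP <-; rewrite imset_set1.
    have : be (Some v) < 2 * k by rewrite /be ltn_mod muln_gt0.
    rewrite /mod_conn; move: (be _) (cut _ _ _ _) => m n; move: k0; clear; nia.
  - move=> A AW AnW A1; rewrite cut_map.
    have : mod_conn k <= cut a b S (@Some V @^-1: A).
      apply: hcut; first exact: pre.
        apply/negP => /eqP h; move: A1; rewrite (preW A AW) h imset0 cards0 //.
      by apply: contra AnW => /eqP h; rewrite (preW A AW) h.
    rewrite /mod_conn; move: (cut _ _ _ _) => n; move: k0; clear; nia.
have [o [_ ho]] := good_extends k0 (leqnn _) (leqnn _) g.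
exists o => v vW; have := ho (Some v) (imset_f _ vW); rewrite nets /be => /dvdzP[q hq].
set out := \sum_(e in S) _.
have hnet : (net a b o S v = 2 * Posz out - Posz (dg a b S v))%R.
  rewrite /net /out /dg !(big_morph Posz PoszD (erefl _)) big_distrr /= -GRing.sumrB.
  by apply: eq_bigr => e _; case: (o e); lia.
have := divn_eq (2 * p v + (2 * k - 1) * dg a b S v) (2 * k).
move: hq; rewrite hnet; clear hnet; move: out (p v) (dg _ _ _ _) => x y d.
move: (_ %% (2 * k)) (_ %/ (2 * k)) => r t hq hd.
have k1 : 2 * k - 1 = k + k.-1 by move: k0; clear; lia.
have k2 : Posz k.-1 = (Posz k - 1)%R by move: k0; clear; lia.
have h : (Posz x - Posz y = (q - Posz t + Posz d) * Posz k)%R.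
  by move: hq hd; rewrite k1; move: k2; clear; lia.
case: (leqP y x) => hxy.
  have [j hj] : exists j : nat, (q - Posz t + Posz d = Posz j)%R.
    exists `|(q - Posz t + Posz d)%R|%N; move: h hxy k0; clear; nia.
  rewrite hj in h; have -> : x = y + j * k by move: h; clear; lia.
  by rewrite addnC modnMDl.
have [j hj] : exists j : nat, (- (q - Posz t + Posz d) = Posz j)%R.
  exists `|(q - Posz t + Posz d)%R|%N; move: h hxy k0; clear; nia.
have -> : y = x + j * k by move: h hj; clear; nia.
by rewrite addnC modnMDl.
Qed.

(** * Lovasz's splitting theorem *)

Section SplitOff.
Variables (V E : finType).
Implicit Types (a b : E -> V) (S : {set E}) (X Y Z W : {set V}).

(** The submodular inequality for three sets. The summand 2 is due to [e1], which is counted three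
    times on the right and once on the left. *)
Lemma cut3_ineq a b S X Y Z e1 : e1 \in S ->
  (a e1 \in X :&: Y :&: Z) && (b e1 \notin X :|: Y :|: Z) ||
  (b e1 \in X :&: Y :&: Z) && (a e1 \notin X :|: Y :|: Z) ->
  cut a b S (X :&: Y :&: Z) + cut a b S (X :\: (Y :|: Z)) + cut a b S (Y :\: (X :|: Z))
    + cut a b S (Z :\: (X :|: Y)) + 2 <= cut a b S X + cut a b S Y + cut a b S Z.
Proof.
move=> e1S he; rewrite /cut ![\sum_(e in S) _](big_setD1 e1 e1S) /=.
set s1 := \sum_(e in _) _; set s2 := \sum_(e in _) _; set s3 := \sum_(e in _) _.
set s4 := \sum_(e in _) _; set s5 := \sum_(e in _) _; set s6 := \sum_(e in _) _.
set s7 := \sum_(e in _) _.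
have hs : s1 + s2 + s3 + s4 <= s5 + s6 + s7.
  rewrite /s1 /s2 /s3 /s4 /s5 /s6 /s7 -!big_split /=; apply: leq_sum => e _; rewrite !inE.
  by do 3 case: (a e \in _); do 3 case: (b e \in _).
move: he hs; clearbody s1 s2 s3 s4 s5 s6 s7; rewrite !inE; clear.
do 3 case: (a e1 \in _); do 3 case: (b e1 \in _); rewrite //=; lia.
Qed.

Variables (a b : E -> V) (S : {set E}) (W : {set V}) (s : V) (K : nat).
Hypotheses (sW : s \notin W) (K2 : 1 < K).
Hypothesis ends : forall e, e \in S -> a e \in s |: W /\ b e \in s |: W.
Hypothesis conn : forall X, X \subset W -> X != set0 -> X != W -> K <= cut a b S X.
Hypothesis even_s : ~~ odd (cut a b S [set s]).

Let N := [set e in S | (a e == s) (+) (b e == s)].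
Let nb := other a b s.

Lemma nb_in e : e \in N -> nb e \in W.
Proof.
rewrite inE => /andP[/ends[]]; rewrite /nb /other !inE.
by case: (a e =P s); case: (b e =P s).
Qed.

Lemma card_N : #|N| = cut a b S [set s].
Proof.
rewrite -sum1_card big_mkcond /cut [RHS]big_mkcond; apply: eq_bigr => e _.
by rewrite !inE; case: (e \in S) => //=; case: (_ (+) _).
Qed.

Let dN X := #|[set e in N | nb e \in X]|.

Lemma cut_compl X : X \subset W -> cut a b S (W :\: X) + 2 * dN X = cut a b S X + #|N|.
Proof.
move=> XW; have -> : dN X = \sum_(e in S) (((a e == s) (+) (b e == s)) && (nb e \in X)).
  rewrite /dN -sum1_card big_mkcond [RHS]big_mkcond; apply: eq_bigr => e _.
  by rewrite !inE; case: (e \in S) => //=; case: (_ (+) _) => //=; case: (_ \in _).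
rewrite card_N /cut big_distrr -!big_split /=; apply: eq_bigr => e /ends[].
have sX : s \notin X by apply: contra sW; apply: (subsetP XW).
rewrite /nb /other !inE.
case: (a e =P s) => [->|_]; case: (b e =P s) => [->|_] /=;
  rewrite ?(negPf sX) ?(negPf sW) ?andbF //=.
- by move=> _ ->; case: (b e \in X).
- by move=> -> _; case: (a e \in X).
- by move=> -> ->; case: (a e \in X); case: (b e \in X).
Qed.

(** Call a set dangerous if it contains [t] and has a cut of at most K + 1. If no partner fits,
    dangerous sets cover all neighbours of [s]. A minimal cover has at least three members, each
    with a private neighbour, and [cut3_ineq] for three of them yields 4K + 2 <= 3(K + 1), against
    [K2]. *)
Lemma split_off e1 : e1 \in N -> exists2 e2, e2 \in N :\ e1 &
  forall X, X \subset W -> X != set0 -> X != W ->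
    K <= cut (la a b s e1) (lb a b s e1 e2) (S :\ e2) X.
Proof.
move=> e1N; have e1S : e1 \in S by move: e1N; rewrite inE => /andP[].
pose t := nb e1; have tW : t \in W := nb_in e1N.
pose dang X := [&& X \subset W, X != W, t \in X & cut a b S X <= K.+1].
case: (boolP [exists e2 in N :\ e1, [forall X : {set V},
   [&& X \subset W, X != set0 & X != W] ==> (K <= cut (la a b s e1) (lb a b s e1 e2) (S :\ e2) X)]]).
  case/exists_inP => e2 e2N /forallP h; exists e2 => // X h1 h2 h3.
  by have := h X; rewrite h1 h2 h3.
move=> /exists_inPn hbad.
have bad e2 : e2 \in N -> e2 != e1 -> exists2 X, dang X & nb e2 \in X.
  move=> e2N ne; have := hbad e2; rewrite !inE ne in e2N * => /(_ e2N).
  rewrite negb_forall => /existsP[X]; rewrite negb_imply -ltnNge => /andP[/and3P[XW X0 XnW]] hX.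
  have [e2S e2x] := andP e2N.
  have h1 : (a e1 == s) || (b e1 == s) by move: e1N; rewrite inE; case: (a e1 == s) => /andP[].
  have h2 : (a e2 == s) || (b e2 == s) by move: e2x; case: (a e2 == s).
  have ne' : e1 != e2 by rewrite eq_sym.
  have := cut_lift e1S e2S ne' h1 h2 X; have := conn XW X0 XnW.
  have -> : s \in X = false by apply/negP => /(subsetP XW); rewrite (negPf sW).
  rewrite -/(nb e1) -/(nb e2) -/t /=; move: hX.
  case: (boolP (t \in X)) => tX; case: (boolP (nb e2 \in X)) => uX /=; rewrite ?muln0 ?addn0;
    try by move=> h3 h4 h5; move: h3; rewrite -h5 ltnNge h4.
  move=> h3 h4 h5; exists X => //; rewrite /dang XW XnW tX /= h5; move: h3; clear.
  by move: (cut _ _ _ _) => c; lia.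
(* Comparing the cuts around [X] and [W :\: X] gives the bound with an excess of 1, which the even
   number of edges at [s] removes. *)
have dangN X : dang X -> 2 * dN X <= #|N|.
  case/and4P => XW XnW tX cX.
  have h1 : K <= cut a b S (W :\: X).
    apply: conn; first exact: subsetDl.
      by rewrite setD_eq0; apply: contra XnW => h; rewrite eqEsubset XW h.
    by apply/eqP => h; move: tW; rewrite -h inE tX.
  have := cut_compl XW; move: even_s; rewrite -card_N; move: h1 cX; clear.
  by move: (cut _ _ _ _) (cut _ _ _ _) (dN X) #|N| => p q r n; lia.
pose cover_N (F : {set {set V}}) := [forall e in N, [exists X in F, nb e \in X]].
have [e0 e0N] : exists e0, e0 \in N :\ e1.
  apply/card_gt0P; move: even_s; rewrite -card_N (cardsD1 e1 N) e1N; clear.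
  by case: #|_|.
have cov0 : cover_N [set X | dang X].
  apply/forall_inP => e eN; apply/exists_inP.
  case: (e =P e1) => [->|/eqP ne].
    have [X dX _] : exists2 X, dang X & nb e0 \in X.
      by move: e0N; rewrite !inE => /andP[ne0 h0]; apply: bad; rewrite ?inE.
    by exists X; rewrite ?inE //; case/and4P: dX.
  by have [X dX hX] := bad e eN ne; exists X; rewrite ?inE.
pose good_cover (F : {set {set V}}) := (F \subset [set X | dang X]) && cover_N F.
have cov0' : good_cover [set X | dang X] by rewrite /good_cover subxx cov0.
case: (@arg_minnP _ _ good_cover (fun F : {set {set V}} => #|F|) cov0') => F /andP[FD Fcov] Fmin.
have FX X : X \in F -> dang X by move/(subsetP FD); rewrite inE.
(* Two dangerous sets, each with at most half of the edges at [s], would have to be disjoint to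
   cover all of them, but [e1] is in both shares. *)
have F3 : 2 < #|F|.
  rewrite ltnNge; apply/negP => F2.
  have [X [Y [XF YF FXY]]] : exists X Y, [/\ X \in F, Y \in F & F \subset [set X; Y]].
    have [X XF] : exists X, X \in F.
      have /exists_inP[X XF _] := forall_inP Fcov e1 e1N; by exists X.
    case: (set_0Vmem (F :\ X)) => [F0|[Y YF]].
      by exists X, X; split=> //; rewrite -(setD1K XF) F0 setU0 setUid.
    exists X, Y; split=> //; first by move: YF; rewrite inE => /andP[].
    have hF : #|(F :\ X) :\ Y| = 0.
      move: F2; rewrite (cardsD1 X) XF (cardsD1 Y (F :\ X)) YF; clear.
      by move: #|_| => n; lia.
    rewrite -(setD1K XF) -(setD1K YF) (cards0_eq hF) setU0.
    exact: subxx.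
  have hNXY : N \subset [set e in N | nb e \in X] :|: [set e in N | nb e \in Y].
    apply/subsetP => e eN; have /exists_inP[Z ZF hZ] := forall_inP Fcov e eN.
    have := subsetP FXY Z ZF; rewrite !inE in eN *; rewrite eN /=.
    by case/orP => /eqP <-; rewrite hZ ?orbT.
  have := subset_leq_card hNXY; have := cardsUI [set e in N | nb e \in X] [set e in N | nb e \in Y].
  have : 0 < #|[set e in N | nb e \in X] :&: [set e in N | nb e \in Y]|.
    apply/card_gt0P; exists e1; have /and4P[_ _ tX _] := FX _ XF; have /and4P[_ _ tY _] := FX _ YF.
    by move: e1N; rewrite !inE => ->; rewrite -/t tX tY.
  have := dangN X (FX _ XF); have := dangN Y (FX _ YF); rewrite /dN; clear.
  by move: #|_| #|_| #|_| #|_| #|_| => p q r n u; lia.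
have priv X : X \in F -> exists2 u, u \in X & forall Y, Y \in F -> Y != X -> u \notin Y.
  move=> XF; have hn : ~~ cover_N (F :\ X).
    apply/negP => hc; have := Fmin (F :\ X); rewrite /good_cover hc (subset_trans (subD1set _ _) FD) => /(_ isT).
    by rewrite /= [X in X <= _](cardsD1 X) XF ltnn.
  move: hn => /forall_inPn[e eN /exists_inPn he].
  have hno Y : Y \in F -> Y != X -> nb e \notin Y.
    by move=> YF YX; apply: he; rewrite !inE YX.
  exists (nb e) => //; have /exists_inP[Z ZF hZ] := forall_inP Fcov e eN.
  by case: (Z =P X) => [<-//|/eqP ZX]; have := hno Z ZF ZX; rewrite hZ.
have /card_gt2P[X [Y [Z [[XF YF ZF] [XY YZ ZX]]]]] := F3.
have [u1 u1X h1] := priv X XF; have [u2 u2Y h2] := priv Y YF; have [u3 u3Z h3] := priv Z ZF.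
have /and4P[XW XnW tX cX] := FX X XF; have /and4P[YW YnW tY cY] := FX Y YF.
have /and4P[ZW ZnW tZ cZ] := FX Z ZF.
have sout (U : {set V}) : U \subset W -> s \notin U.
  by move=> UW; apply: contra sW; apply: (subsetP UW).
have hc : K <= cut a b S (X :&: Y :&: Z).
  apply: conn.
  - by apply: subset_trans XW; rewrite -setIA subsetIl.
  - by apply/set0Pn; exists t; rewrite !inE tX tY tZ.
  - by apply: contra XnW => /eqP h; rewrite eqEsubset XW -h -setIA subsetIl.
have hp (X' Y' Z' : {set V}) u : X' \subset W -> t \in Y' -> u \in X' -> u \notin Y' -> u \notin Z' ->
    K <= cut a b S (X' :\: (Y' :|: Z')).
  move=> X'W tY' uX' uY' uZ'; apply: conn.
  - by apply: subset_trans X'W; apply: subsetDl.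
  - by apply/set0Pn; exists u; rewrite !inE uX' (negPf uY') (negPf uZ').
  - by apply/eqP => h; move: tW; rewrite -h !inE tY'.
have hX := hp X Y Z u1 XW tY u1X (h1 Y YF _) (h1 Z ZF ZX).
have hY := hp Y X Z u2 YW tX u2Y (h2 X XF XY) (h2 Z ZF _).
have hZ := hp Z X Y u3 ZW tX u3Z (h3 X XF _) (h3 Y YF YZ).
rewrite eq_sym in XY; rewrite eq_sym in YZ; rewrite eq_sym in ZX.
have := hX XY; have := hY YZ; have := hZ ZX.
have he : (a e1 \in X :&: Y :&: Z) && (b e1 \notin X :|: Y :|: Z) ||
  (b e1 \in X :&: Y :&: Z) && (a e1 \notin X :|: Y :|: Z).
  move: tX tY tZ e1N; rewrite /t /nb /other !inE.
  case: (a e1 =P s) => [->|_]; case: (b e1 =P s) => [->|_]; rewrite ?andbF //=;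
  by rewrite ?(negPf (sout _ XW)) ?(negPf (sout _ YW)) ?(negPf (sout _ ZW)) ?andbT => -> -> ->; rewrite ?orbT.
have := cut3_ineq e1S he; move: hc cX cY cZ K2; clear.
move: (cut _ _ _ _) (cut _ _ _ _) (cut _ _ _ _) (cut _ _ _ _) (cut _ _ _ _) (cut _ _ _ _) (cut _ _ _ _).
by move=> c1 c2 c3 c4 c5 c6 c7; lia.
Qed.

End SplitOff.

Section FullLift.
Variables (V E : finType) (al bt : E -> V) (S : {set E}) (A : {set V}) (K : nat).
Hypothesis alA : forall e, e \in S -> al e \in A.
Hypothesis btA : forall e, e \in S -> bt e \notin A.
Hypothesis K2 : 1 < K.

Definition lend (L : {set E}) (p : E -> E) e := if e \in L then al (p e) else bt e.

(* Edges of F are intact; an edge e of L has been split off together with p e,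
   and now stands for an edge joining al e to al (p e). *)
Record lifting (R R' : {set V}) (F L : {set E}) (p : E -> E) : Prop := Lifting {
  l_FS : F \subset S;
  l_LS : L \subset S;
  l_FL : [disjoint F & L];
  l_p : forall e, e \in L -> [/\ p e \in S, p e \notin F, p e \notin L & bt (p e) = bt e];
  l_inj : {in L &, injective p};
  l_all : forall e, e \in S -> e \notin F -> e \notin L -> exists2 f, f \in L & p f = e;
  l_F : forall e, e \in F -> bt e \in R';
  l_even : forall v, ~~ odd #|[set e in F | bt e == v]|;
  l_conn : forall X : {set V}, X \subset A :|: R -> X != set0 -> X != A :|: R ->
     K <= cut al (lend L p) (F :|: L) X }.

(** While [s] is being cleared, intact edges may still end at [s], but connectivity is demanded on
    [A :|: R] only, since splitting off at [s] preserves it just for sets avoiding [s]. This is why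
    [lifting] has two sets [R] and [R']. *)
Lemma lift_vertex n s (R : {set V}) (F L : {set E}) p : #|[set e in F | bt e == s]| <= n -> s \notin A -> s \notin R ->
  lifting R (s |: R) F L p -> exists F' L' p', lifting R R F' L' p'.
Proof.
elim/ltn_ind: n F L p => n IH F L p hn sA sR l.
case: (set_0Vmem [set e in F | bt e == s]) => [F0|[e1 he1]].
  exists F, L, p; case: l => *; split=> // e eF.
  have : bt e \in s |: R by auto.
  rewrite !inE => /orP[/eqP hs|//].
  by have := in_set0 e; rewrite -F0 inE eF hs eqxx.
have [e1F /eqP e1s] : e1 \in F /\ bt e1 == s by move: he1; rewrite inE => /andP[].
have FS := subsetP (l_FS l); have LS := subsetP (l_LS l).
have FnL e : e \in F -> e \in L = false.
  by move=> eF; exact: (disjointFr (l_FL l) eF).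
set W := A :|: R; have sW : s \notin W by rewrite inE negb_or sA sR.
have al_s e : e \in S -> (al e == s) = false.
  by move=> eS; apply/eqP => h; move: sA; rewrite -h alA.
have ends e : e \in F :|: L -> al e \in s |: W /\ lend L p e \in s |: W.
  rewrite inE => h; have eS : e \in S by case/orP: h => [/FS|/LS].
  split; first by rewrite !inE alA ?orbT.
  rewrite /lend; case: (boolP (e \in L)) => eL.
    by have [pS _ _ _] := l_p l eL; rewrite !inE alA ?orbT.
  rewrite (negPf eL) orbF in h; have := l_F l h; rewrite !inE.
  by case/orP => ->; rewrite ?orbT.
have NE : [set e in F :|: L | (al e == s) (+) (lend L p e == s)] = [set e in F | bt e == s].
  apply/setP => e; rewrite !inE; case: (boolP (e \in F)) => eF /=.
    by rewrite al_s ?FS // /lend FnL.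
  case: (boolP (e \in L)) => eL //=; rewrite al_s ?LS // /lend eL.
  by have [pS _ _ _] := l_p l eL; rewrite al_s.
have even_s : ~~ odd (cut al (lend L p) (F :|: L) [set s]).
  by rewrite -card_N NE; apply: l_even l s.
have e1N : e1 \in [set e in F :|: L | (al e == s) (+) (lend L p e == s)] by rewrite NE.
have [e2] := split_off sW K2 ends (l_conn l) even_s e1N.
rewrite NE !inE => /and3P[e21 e2F /eqP e2s] hK.
have e12 : e1 != e2 by rewrite eq_sym.
have e1S := FS _ e1F; have e2S := FS _ e2F.
pose F' := F :\ e1 :\ e2; pose L' := e1 |: L; pose p' e := if e == e1 then e2 else p e.
have F'F e : e \in F' -> e \in F by rewrite !inE => /and3P[].
have cardF v : #|[set e in F | bt e == v]| = 2 * (v == s) + #|[set e in F' | bt e == v]|.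
  have h (X : {set E}) : #|[set e in X | bt e == v]| = \sum_(e in X) (bt e == v).
    rewrite -sum1_card big_mkcond [RHS]big_mkcond; apply: eq_bigr => e _.
    by rewrite inE; case: (e \in X) => //=; case: (_ == v).
  rewrite !h (big_setD1 e1) //= (big_setD1 e2) ?inE ?e21 //= e1s e2s eq_sym.
  by rewrite addnA; congr (_ + _); case: (_ == _).
have hlt : #|[set e in F' | bt e == s]| < n.
  by apply: leq_trans hn; rewrite cardF eqxx; clear; lia.
apply: (IH _ hlt F' L' p') => //; split.
- by apply/subsetP => e /F'F /FS.
- by apply/subsetP => e; rewrite !inE => /orP[/eqP->//|/LS].
- rewrite disjoints_subset; apply/subsetP => e eF'; have eF := F'F _ eF'.
  by move: eF'; rewrite !inE negb_or => /and3P[_ -> _]; rewrite FnL.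
- move=> e; rewrite !inE /p' => /orP[/eqP->|eL].
    by rewrite eqxx eqxx /= e2S (negPf e21) FnL // e1s e2s.
  have [pS pF pL pb] := l_p l eL.
  case: eqP => [h|_]; first by move: (FnL _ e1F); rewrite -h eL.
  rewrite (negPf pF) (negPf pL) pS !andbF orbF; split=> //.
  by apply: contra pF => /eqP ->.
- move=> e f; rewrite !inE /p' => he hf.
  case: (e =P e1) he hf => [->|ne] /= he; case: (f =P e1) => [->|nf] //= hf.
  + by move=> h; have [_ pF _ _] := l_p l hf; rewrite -h e2F in pF.
  + by move=> h; have [_ pF _ _] := l_p l he; rewrite h e2F in pF.
  + exact: (l_inj l).
- move=> e eS; rewrite !inE !negb_and !negbK negb_or => he /andP[ne1 eL].
  case: (boolP (e == e2)) he => [/eqP-> _|ne2 /=].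
    by exists e1; rewrite ?inE /p' eqxx.
  rewrite (negPf ne1) /= => eF; have [f fL pf] := l_all l eS eF eL.
  exists f; first by rewrite inE fL orbT.
  by rewrite /p'; case: (f =P e1) => [h|//]; move: (FnL _ e1F); rewrite -h fL.
- by move=> e /F'F /(l_F l).
- move=> v; have := l_even l v; rewrite cardF oddD.
  by case: (v == s).
- move=> X X1 X2 X3; apply: leq_trans (hK X X1 X2 X3) _.
  have o1 : other al (lend L p) s e1 = al e1 by rewrite /other al_s.
  have o2 : other al (lend L p) s e2 = al e2 by rewrite /other al_s.
  have EE : (F :|: L) :\ e2 = F' :|: L'.
    apply/setP => e; rewrite !inE.
    case: (e =P e1) => [->|_] /=; first by rewrite e12 e1F orbT.
    case: (e =P e2) => [->|_] //=; by rewrite (FnL _ e2F).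
  rewrite EE /cut; apply: eq_leq; apply: eq_bigr => e _.
  rewrite /la /lb /lend o1 o2 !inE /p'.
  by case: (e =P e1) => [->|_].
Qed.

Theorem full_lift :
  (forall v, ~~ odd #|[set e in S | bt e == v]|) ->
  (forall X : {set V}, X != set0 -> X != setT -> K <= cut al bt S X) ->
  exists (L : {set E}) (p : E -> E),
   [/\ L \subset S, {in L &, injective p},
       forall e, e \in L -> [/\ p e \in S, p e \notin L & bt (p e) = bt e],
       forall e, e \in S -> e \notin L -> exists2 f, f \in L & p f = e &
       forall X : {set V}, X \subset A -> X != set0 -> X != A ->
         K <= cut al (fun e => al (p e)) L X].
Proof.
move=> hev hconn.
have [F [L [p l]]] : exists F L p, lifting set0 set0 F L p.
  suff H n (R : {set V}) (F L : {set E}) p : #|R| <= n -> R \subset ~: A -> lifting R R F L p ->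
     exists F L p, lifting set0 set0 F L p.
    apply: (H _ (~: A) S set0 id (leqnn _)) => //; split=> //.
    - exact: sub0set.
    - by rewrite disjoints_subset; apply/subsetP => e _; rewrite !inE.
    - by move=> e; rewrite inE.
    - by move=> e h; rewrite h.
    - by move=> e /btA; rewrite inE.
    - move=> X; rewrite setUCr setU0 => _ X0 XT; apply: leq_trans (hconn X X0 XT) _.
      by apply: eq_leq; apply: eq_bigr => e _; rewrite /lend inE.
  elim: n R F L p => [|n IH] R F L p hR RA l.
    by move: hR l; rewrite leqn0 cards_eq0 => /eqP -> l; exists F, L, p.
  case: (set_0Vmem R) => [R0|[s sR]]; first by exists F, L, p; rewrite R0 in l.
  have sA : s \notin A by have := subsetP RA _ sR; rewrite inE.
  have l' : lifting (R :\ s) (s |: (R :\ s)) F L p.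
    rewrite setD1K //; case: l => l1 l2 l3 l4 l5 l6 l7 l8 l9; split=> // X X1 X2 X3; apply: l9 => //.
      by apply: subset_trans X1 _; apply: setUS; apply: subD1set.
    apply: contraNneq sA => h; have := subsetP X1 s; rewrite h !inE sR orbT eqxx /= orbF.
    exact.
  have [|F' [L' [p' l'']]] := lift_vertex (leqnn _) sA _ l'; first by rewrite !inE eqxx.
  apply: IH l''; first by move: hR; rewrite (cardsD1 s) sR.
  exact: subset_trans (subD1set _ _) RA.
have F0 e : e \notin F by apply/negP => /(l_F l); rewrite inE.
exists L, p; split.
- exact: l_LS l.
- exact: l_inj l.
- by move=> e /(l_p l)[].
- by move=> e eS eL; apply: (l_all l).
- move=> X XA X0 XnA; have := l_conn l; rewrite setU0 => h.
  apply: leq_trans (h X XA X0 XnA) _; apply: eq_leq.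
  have -> : F :|: L = L by apply/setP => e; rewrite inE (negPf (F0 e)).
  by apply: eq_bigr => e eL; rewrite /lend eL.
Qed.

End FullLift.

(** * Sparse liftings *)

Section Packing.
Variables (V E : finType) (a b : E -> V).
Implicit Types (S F J : {set E}) (X A U : {set V}).

Lemma cut_bigcup (I : finType) (P : pred I) (F : I -> {set E}) S X :
  (forall i, P i -> F i \subset S) ->
  (forall i j e, P i -> P j -> e \in F i -> e \in F j -> i = j) ->
  \sum_(i | P i) cut a b (F i) X <= cut a b S X.
Proof.
move=> FS Fd; rewrite /cut.
rewrite (eq_bigr (fun i => \sum_(e in S) (e \in F i) * ((a e \in X) (+) (b e \in X)))); last first.
  move=> i Pi; rewrite big_mkcond [RHS]big_mkcond; apply: eq_bigr => e _.
  by case: (boolP (e \in F i)) => [/(subsetP (FS i Pi)) ->|_]; rewrite ?mul1n //; case: ifP.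
rewrite exchange_big; apply: leq_sum => e eS /=; rewrite -big_distrl /=.
rewrite -[X in _ <= X]mul1n leq_mul2r; apply/orP; right.
case: (pickP (fun i => P i && (e \in F i))) => [i /andP[Pi ei]|h].
  rewrite (bigD1 i) //= ei big1 // => j /andP[Pj ji].
  by case: (boolP (e \in F j)) => // ej; rewrite (Fd j i e Pj Pi ej ei) eqxx in ji.
by rewrite big1 // => i Pi; have := h i; rewrite Pi /= => ->.
Qed.

(** Disjoint connected spanning subgraphs are collected, [n2] to a group; each contributes an edge
    to every cut. *)
Lemma pack_groups (n1 n2 : nat) S : 0 < n1 * n2 ->
  (forall X, X != set0 -> X != setT -> 2 * (n1 * n2) <= cut a b S X) ->
  exists G : 'I_n1 -> {set E}, [/\ forall j, G j \subset S,
    forall i j e, e \in G i -> e \in G j -> i = j &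
    forall j X, X != set0 -> X != setT -> n2 <= cut a b (G j) X].
Proof.
move=> n0 hS.
have [|I [IS Iconn Icap]] := @pack_connected V E E ('I_n1 * 'I_n2)%type a b S (n1 * n2) fst (fun=> 1) n0 hS.
  move=> e; rewrite muln1; apply: leq_trans (_ : #|[set (e, i) | i : 'I_n1 * 'I_n2]| <= _).
    apply: subset_leq_card; apply/subsetP => [[f i]]; rewrite inE /= => /andP[_ /eqP ->].
    by apply/imsetP; exists i.
  by apply: leq_trans (leq_imset_card _ _) _; rewrite cardT -cardE card_prod !card_ord.
have uniqI e i j : (e, i) \in I -> (e, j) \in I -> i = j.
  move=> hi hj; apply/eqP/negPn/negP => ij; have := Icap e; rewrite leqNgt => /negP; apply.
  apply/card_gt1P; exists (e, i), (e, j); rewrite !inE hi hj !eqxx; split=> //.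
  by rewrite xpair_eqE eqxx.
exists (fun j => [set e | [exists i : 'I_n2, (e, (j, i)) \in I]]); split.
- by move=> j; apply/subsetP => e; rewrite inE => /existsP[i /IS].
- move=> i j e; rewrite !inE => /existsP[u hu] /existsP[v hv].
  by case: (uniqI _ _ _ hu hv).
- move=> j X X0 XT.
  apply: leq_trans (cut_bigcup (P := xpredT) (F := fun i : 'I_n2 => [set e | (e, (j, i)) \in I]) _ _ _).
  + rewrite -[X in X <= _]card_ord -sum1_card; apply: leq_sum => i _; exact: Iconn.
  + by move=> i _; apply/subsetP => e; rewrite !inE => h; apply/existsP; exists i.
  + by move=> i i' e _ _; rewrite !inE => h h'; case: (uniqI _ _ _ h h').
Qed.

(** The degree bound is a partition matroid in which each fibre of [f] has as capacity its share
    1/K, rounded down, plus one; this one is the summand [K] in the bound. *)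
Lemma sparse_connected (K : nat) S (f : E -> V) : 0 < K ->
  (forall X, X != set0 -> X != setT -> 2 * K <= cut a b S X) ->
  exists F, [/\ F \subset S, forall X, X != set0 -> X != setT -> 0 < cut a b F X
    & forall v, K * #|F :&: [set e | f e == v]| <= #|S :&: [set e | f e == v]| + K].
Proof.
move=> K0 hS; pose cap v := #|S :&: [set e | f e == v]| %/ K + 1.
have [|I [IS Iconn Icap]] := @pack_connected V E V unit a b S K (fun p => f p.1) cap K0 hS.
  move=> v; apply: leq_trans (_ : #|[set (e, tt) | e in S :&: [set e | f e == v]]| <= _).
    apply: subset_leq_card; apply/subsetP => [[e []]]; rewrite inE /= => /andP[eS fe].
    by apply/imsetP; exists e; rewrite // !inE eS.
  apply: leq_trans (leq_imset_card _ _) _; rewrite /cap addn1 mulnC; apply: ltnW.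
  exact: ltn_ceil.
exists [set e | (e, tt) \in I]; split.
- by apply/subsetP => e; rewrite inE => /IS.
- by move=> X X0 XT; apply: Iconn.
- move=> v; have := Icap v; rewrite /cap.
  have <- : #|[set e | (e, tt) \in I] :&: [set e | f e == v]| = #|I :&: [set p | f p.1 == v]|.
    rewrite -(card_imset _ (_ : injective (fun e : E => (e, tt)))); last by move=> ? ? [].
    apply: eq_card => [[e []]]; rewrite !inE /=; apply/imsetP/idP => [[e']|h].
      by rewrite !inE => h [->].
    by exists e; rewrite // !inE.
  rewrite -(leq_pmul2l K0) => h; apply: leq_trans h _.
  by rewrite mulnDr muln1 leq_add2r mulnC leq_divM.
Qed.

Lemma odd_dg_symdiff S1 S2 v :
  odd (dg a b ((S1 :\: S2) :|: (S2 :\: S1)) v) = odd (dg a b S1 v) (+) odd (dg a b S2 v).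
Proof.
rewrite -oddD.
have -> : dg a b S1 v + dg a b S2 v =
   dg a b ((S1 :\: S2) :|: (S2 :\: S1)) v + 2 * dg a b (S1 :&: S2) v.
  rewrite /dg ![\sum_(e in _) _]big_mkcond big_distrr -!big_split /=.
  apply: eq_bigr => e _; rewrite !inE.
  by case: (e \in S1); case: (e \in S2); rewrite //= ?addn0 ?mul2n ?addnn.
by rewrite oddD mul2n odd_double addbF.
Qed.

Section TJoin.
Variable F : {set E}.
Hypothesis Fconn : forall X, X != set0 -> X != setT -> 0 < cut a b F X.

(** No edge of [F] leaves the set of those y that admit such a [J], since taking the symmetric
    difference with the edge would reach its other end. *)
Lemma tjoin_pair x y : exists J, J \subset F /\
  forall v, odd (dg a b J v) = (v == x) (+) (v == y).
Proof.
pose X := [set y | [exists J : {set E}, (J \subset F) &&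
   [forall v, odd (dg a b J v) == (v == x) (+) (v == y)]]].
suff : y \in X.
  rewrite inE => /existsP[J /andP[JF /forallP h]]; exists J; split=> // v.
  exact/eqP.
have xX : x \in X.
  rewrite inE; apply/existsP; exists set0; rewrite sub0set; apply/forallP => v.
  by rewrite /dg big_set0 addbb.
case: (X =P setT) => [->|/eqP XT]; first by rewrite inE.
have X0 : X != set0 by apply/set0Pn; exists x.
have := Fconn X0 XT; rewrite lt0n /cut sum_nat_eq0 negb_forall => /existsP[e].
rewrite negb_imply => /andP[eF].
have step u w : u \in X -> (forall v, odd (dg a b [set e] v) = (v == u) (+) (v == w)) -> w \in X.
  rewrite !inE => /existsP[J /andP[JF /forallP h]] he; apply/existsP.
  exists ((J :\: [set e]) :|: ([set e] :\: J)); apply/andP; split.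
    rewrite subUset !subDset; apply/andP; split.
      by apply: subset_trans JF _; apply: subsetUr.
    by rewrite sub1set inE eF orbT.
  apply/forallP => v; rewrite odd_dg_symdiff he (eqP (h v)).
  by case: (v == x); case: (v == u); case: (v == w).
have dg1 v : odd (dg a b [set e] v) = (v == a e) (+) (v == b e).
  by rewrite /dg big_set1 oddD ![v == _]eq_sym; case: (a e == v); case: (b e == v).
case: (boolP (a e \in X)) => ha; case: (boolP (b e \in X)) => hb //= _.
  by rewrite (step _ (b e) ha) in hb.
by rewrite (step _ (a e) hb) // in ha => v; rewrite dg1 addbC.
Qed.

(** A T-join for [U], where the exceptional vertex [r] takes up the parity of [U]. *)
Lemma tjoin (r : V) U : exists J, J \subset F /\
  forall v, v != r -> odd (dg a b J v) = (v \in U).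
Proof.
move: {2}#|U| (leqnn #|U|) => n; elim: n U => [|n IH] U hU.
  move: hU; rewrite leqn0 cards_eq0 => /eqP ->; exists set0; split; first exact: sub0set.
  by move=> v _; rewrite /dg big_set0 inE.
case: (set_0Vmem U) => [->|[u uU]].
  exists set0; split; first exact: sub0set.
  by move=> v _; rewrite /dg big_set0 inE.
have [|J1 [J1F h1]] := IH (U :\ u); first by move: hU; rewrite (cardsD1 u) uU.
have [J2 [J2F h2]] := tjoin_pair u r.
exists ((J1 :\: J2) :|: (J2 :\: J1)); split.
  rewrite subUset !subDset; apply/andP; split.
    by apply: subset_trans J1F _; apply: subsetUr.
  by apply: subset_trans J2F _; apply: subsetUr.
move=> v vr; rewrite odd_dg_symdiff h1 // h2 (negPf vr) addbF !inE.
by case: (v =P u) => [->|_]; rewrite ?uU ?addbF.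
Qed.

End TJoin.
End Packing.

Lemma sum_ord_sum (n : nat) (V E : finType) (G : 'I_n -> {set E}) (S : {set E}) (f : E -> V) v :
  (forall j, G j \subset S) -> (forall i j e, e \in G i -> e \in G j -> i = j) ->
  \sum_(j < n) #|G j :&: [set e | f e == v]| <= #|S :&: [set e | f e == v]|.
Proof.
move=> GS Gd; set P := [set e | f e == v].
have h (X : {set E}) : #|X :&: P| = \sum_(e in P) (e \in X).
  rewrite -sum1_card big_mkcond [RHS]big_mkcond; apply: eq_bigr => e _.
  by rewrite !inE; case: (e \in X); case: (f e == v).
rewrite h (eq_bigr _ (fun j _ => h (G j))) exchange_big; apply: leq_sum => e _ /=.
case: (pickP (fun i => e \in G i)) => [i ei|hn]; last by rewrite big1 // => j _; rewrite hn.
rewrite (bigD1 i) //= ei (subsetP (GS i) _ ei) big1 // => j ji.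
by case: (boolP (e \in G j)) => // ej; rewrite (Gd j i e ej ei) eqxx in ji.
Qed.

(* An edge e of L stands for the edge from al e to al (p e) that arises by
   splitting off e and p e. *)
Lemma sparse_lifting (V E : finType) (al bt : E -> V) (S : {set E}) (A : {set V}) (N K : nat) :
  (forall e, e \in S -> al e \in A) -> (forall e, e \in S -> bt e \notin A) ->
  1 < N -> 0 < K -> A != set0 ->
  (forall X : {set V}, X != set0 -> X != setT -> 2 * (N.+1 * (2 * K)) <= cut al bt S X) ->
  exists (G L : {set E}) (p : E -> E),
  [/\ [/\ G \subset S, L \subset G, {in L &, injective p} &
       forall e, e \in L -> [/\ p e \in G, p e \notin L & bt (p e) = bt e]],
       forall X : {set V}, X \subset A -> X != set0 -> X != A ->
         N <= cut al (fun e => al (p e)) L X &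
       forall v, v \notin A -> K * #|G :&: [set e | bt e == v]| <= 2 * #|S :&: [set e | bt e == v]|].
Proof.
move=> alA btA N1 K0 A0 hS; have [r rA] := set0Pn _ A0.
(* Each of the [N.+1] groups yields a sparse connected subgraph. The last one is sacrificed: it
   contains the T-join [J] whose removal makes all degrees outside [A] even. The other [N] provide
   the connectivity. *)
have [|Gr [GS Gd Gc]] := @pack_groups V E al bt N.+1 (2 * K) S _ hS; first by rewrite !muln_gt0.
have hF j := sparse_connected bt K0 (Gc j).
have [F hF'] := fin_all_exists hF.
have FG j : F j \subset Gr j by case: (hF' j).
have Fc j X : X != set0 -> X != setT -> 0 < cut al bt (F j) X by case: (hF' j) => _ h _; apply: h.
pose G0 := \bigcup_j F j.
have G0S : G0 \subset S.
  by apply/bigcupsP => j _; apply: subset_trans (FG j) (GS j).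
pose U := [set v | odd (dg al bt G0 v)].
have [J [JF hJ]] := tjoin (Fc ord_max) r U.
pose G := G0 :\: J.
have JG0 : J \subset G0 by apply: subset_trans JF _; apply: bigcup_sup.
have GSub : G \subset S by apply: subset_trans G0S; apply: subsetDl.
have dgE (X : {set E}) v : X \subset S -> v \notin A -> dg al bt X v = #|[set e in X | bt e == v]|.
  move=> XS vA; rewrite /dg -sum1_card big_mkcond [RHS]big_mkcond; apply: eq_bigr => e _.
  rewrite inE; case: (boolP (e \in X)) => //= eX.
  have -> : al e == v = false by apply/eqP => h; rewrite -h alA ?(subsetP XS) in vA.
  by case: (bt e == v).
have [|||||L [p [LG pinj hp _ hc]]] := @full_lift V E al bt G A N.
- by move=> e /(subsetP GSub)/alA.
- by move=> e /(subsetP GSub)/btA.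
- exact: N1.
- move=> v; case: (boolP (v \in A)) => vA.
    rewrite (_ : [set _ in _ | _] = set0) ?cards0 //; apply/setP => e; rewrite !inE.
    apply/negP => /andP[/andP[_ eG] /eqP h]; move: (btA e (subsetP G0S _ eG)).
    by rewrite h vA.
  rewrite -dgE //; have := dg_setD al bt v JG0; rewrite -/G.
  have vr : v != r by apply/eqP => h; rewrite h rA in vA.
  have := hJ v vr; rewrite inE => h1 h2; move: h1; rewrite h2 oddD.
  by case: (odd (dg _ _ J _)); case: (odd (dg _ _ G _)).
- move=> X X0 XT; apply: leq_trans (cut_bigcup al bt (P := fun j => j != ord_max) (F := F) X _ _).
  + apply: leq_trans (_ : \sum_(j < N.+1 | j != ord_max) 1 <= _).
      by rewrite sum1_card cardC1 card_ord.
    by apply: leq_sum => j _; apply: Fc.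
  + move=> j hj; apply/subsetP => e ej; rewrite inE.
    rewrite (subsetP (bigcup_sup j _) _ ej) // andbT.
    apply/negP => /(subsetP JF) => e'.
    by rewrite (Gd _ _ _ (subsetP (FG _) _ ej) (subsetP (FG _) _ e')) eqxx in hj.
  + move=> i j e _ _ ei ej; exact: Gd (subsetP (FG _) _ ei) (subsetP (FG _) _ ej).
exists G, L, p; split=> // v vA; set P := [set e | bt e == v].
have h1 : #|G :&: P| <= \sum_(j < N.+1) #|F j :&: P|.
  rewrite -[X in X <= _]sum1_card (eq_bigr _ (fun j _ => esym (sum1_card _))).
  rewrite (exchange_big_dep predT) //=.
  rewrite big_mkcond; apply: leq_sum => e _; case: ifP => // /setIP[/setDP[/bigcupP[j _ ej] _] eP].
  by rewrite (bigD1 j) //= inE ej eP.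
apply: leq_trans (leq_mul (leqnn K) h1) _.
apply: leq_trans (leq_mul (leqnn 2) (sum_ord_sum _ _ GS Gd)).
rewrite !big_distrr /=; apply: leq_sum => j _; case: (hF' j) => _ _ /(_ v) h2.
(* The summand [K] is absorbed, because the group has at least [2 * K] edges at [v]. *)
apply: leq_trans h2 _; rewrite mul2n -addnn leq_add2l.
have v0 : [set v] != set0 by apply/set0Pn; exists v; rewrite inE.
have vT : [set v] != setT.
  by apply/eqP => h; have := in_setT r; rewrite -h inE => /eqP h'; rewrite -h' rA in vA.
have := Gc j [set v] v0 vT.
have -> : cut al bt (Gr j) [set v] = #|Gr j :&: P|.
  rewrite /cut -sum1_card big_mkcond [RHS]big_mkcond; apply: eq_bigr => e _; rewrite !inE.
  case: (boolP (e \in Gr j)) => //= ej.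
  have -> : al e == v = false by apply/eqP => h; rewrite -h (alA e) ?(subsetP (GS j)) in vA.
  by case: (bt e == v).
by apply: leq_trans; rewrite mul2n -addnn leq_addr.
Qed.

(** * Trees *)

Section Cycles.
Variable G : mgraph.
Implicit Types (e f : edge G) (F : {set edge G}) (u v x y : vert G).

Lemma joins_sym e x y : joins e x y = joins e y x.
Proof. by rewrite /joins orbC. Qed.

Lemma joins_ends e x y x' y' : joins e x y -> joins e x' y' ->
  (x = x' /\ y = y') \/ (x = y' /\ y = x').
Proof.
by case/orP => /andP[/eqP <- /eqP <-] /orP[] /andP[/eqP <- /eqP <-]; [left|right|right|left].
Qed.

Definition adjin F : rel (vert G) := fun u v => [exists f in F, joins f u v].

(** Once the path is made simple, its edges differ because their pairs of ends do, and the closing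
    edge [e] is not among them as it lies outside [F]. *)
Lemma path_cycle F e x p : e \notin F -> path (adjin F) x p -> joins e x (last x p) ->
  exists k vs es, @is_cycle G k vs es /\ k <= (size p).+1.
Proof.
move=> eF; move hy: (last x p) => y hp he.
case/shortenP: hp hy => q hq uq qp hy.
have sq : size q <= size p.
  have := uniq_leq_size uq (s2 := x :: p); rewrite /= ltnS; apply=> z.
  rewrite !inE => /orP[->//|zq]; apply/orP; right.
  exact: qp.
pose w i := nth x (x :: q) i.
pose pe i := odflt e [pick f in F | joins f (w i) (w i.+1)].
have hpe i : i < size q -> pe i \in F /\ joins (pe i) (w i) (w i.+1).
  move=> hi; rewrite /pe; case: pickP => [f /andP[]//|h].
  have := pathP x hq i hi => /exists_inP[f fF fj].
  by have := h f; rewrite fF fj.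
exists (size q).+1, (fun i => w i), (fun i : 'I_(size q).+1 => if i < size q then pe i else e).
split; last by rewrite ltnS.
have winj i j : i <= size q -> j <= size q -> w i = w j -> i = j.
  by move=> hi hj /eqP; rewrite /w nth_uniq //= ?ltnS // => /eqP.
split=> //.
- by move=> i j h; apply: ord_inj; apply: winj h; rewrite -ltnS ltn_ord.
- move=> i j; case: ifP => hi; case: ifP => hj.
  + move=> h; have [_ ji] := hpe i hi; have [_ jj] := hpe j hj; rewrite h in ji.
    apply: ord_inj; case: (joins_ends ji jj) => -[h1 h2].
      by apply: winj h1; apply: ltnW.
    have e1 : nat_of_ord i = j.+1 by apply: winj h1 => //; apply: ltnW.
    have e2 : i.+1 = j :> nat by apply: winj h2 => //; apply: ltnW.
    by move: e2; rewrite e1; clear; lia.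
  + by move=> h; have [iF _] := hpe i hi; move: eF; rewrite -h iF.
  + by move=> h; have [jF _] := hpe j hj; move: eF; rewrite h jF.
  + move=> _; apply: ord_inj.
    have top (l : 'I_(size q).+1) : (l < size q) = false -> l = size q :> nat.
      by move=> hl; apply/eqP; rewrite eqn_leq -ltnS ltn_ord leqNgt hl.
    by rewrite (top i hi) (top j hj).
- move=> i; rewrite /ordS /=; case: ifP => hi.
    by have [_] := hpe i hi; rewrite modn_small.
  have -> : nat_of_ord i = size q.
    by have := ltn_ord i; rewrite ltnS leq_eqVlt hi orbF => /eqP.
  rewrite modnn joins_sym /w /=.
  by rewrite (_ : nth x (x :: q) (size q) = y) // -hy (last_nth x).
Qed.

Lemma connected_cross : connected G -> forall X : {set vert G}, X != set0 -> X != setT ->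
  exists e u v, [/\ joins e u v, u \in X & v \notin X].
Proof.
move=> hc X /set0Pn[x xX]; rewrite -subTset => /subsetPn[y _ yX].
have /connectP[p hp hy] := hc x y.
elim: p x xX hp hy => [|z p IH] x xX /=; first by move=> _ h; rewrite h xX in yX.
case/andP => /existsP[e /andP[_ he]] hp hy.
case: (boolP (z \in X)) => zX; first exact: IH zX hp hy.
by exists e, x, z.
Qed.

Lemma reach_inP n x y : reach_in n x y ->
  exists2 p, path (@adj G) x p & last x p = y /\ size p <= n.
Proof.
elim: n y => [|n IH] y /=; first by move=> /eqP <-; exists [::].
case/orP => [/IH[p hp [h1 h2]]|/existsP[z /andP[/IH[p hp [h1 h2]] hz]]].
  by exists p => //; split=> //; apply: leqW.
exists (rcons p y); first by rewrite rcons_path hp h1.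
by rewrite last_rcons size_rcons.
Qed.

Lemma reach_in_path x p : path (@adj G) x p -> reach_in (size p) x (last x p).
Proof.
elim/last_ind: p => [|p z IH] //=; rewrite rcons_path size_rcons last_rcons /= => /andP[hp hz].
by apply/orP; right; apply/existsP; exists (last x p); rewrite IH.
Qed.

Lemma dist_path x y : connected G ->
  exists2 p, path (@adj G) x p & last x p = y /\ size p <= diameter G.
Proof.
move=> hc; have h : has (fun n => reach_in n x y) (iota 0 #|vert G|).
  have /connectP[p hp hy] := hc x y; apply/hasP.
  case/shortenP: hp hy => q hq uq _ hy; exists (size q).
    by rewrite mem_iota /= add0n; have := max_card (mem (x :: q)); rewrite (card_uniqP uq).
  by rewrite hy; apply: reach_in_path.
have := nth_find 0 h; rewrite nth_iota; last by move: h; rewrite has_find size_iota.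
rewrite add0n => /reach_inP[p hp [h1 h2]]; exists p => //; split=> //.
apply: leq_trans h2 _; rewrite /diameter.
apply: leq_trans (leq_bigmax x); exact: (leq_bigmax y).
Qed.

End Cycles.

(** A path of [T] between two identified vertices is mapped to a closed walk. This walk may repeat
    vertices, but its first edge occurs only once since [fE] is injective, and hence it lies on a
    cycle no longer than the walk. *)
Lemma girth_injective (T G : mgraph) (fV : vert T -> vert G) (fE : edge T -> edge G) :
  connected T -> girth_gt G (diameter T) -> injective fE ->
  (forall e, joins (fE e) (fV (src e)) (fV (tgt e))) -> injective fV.
Proof.
move=> hT hG fEi fj x y fxy; apply/eqP/negPn/negP => xy.
have [p hp [hy sp]] := dist_path x y hT.
have fj' e u v : joins e u v -> joins (fE e) (fV u) (fV v).
  by case/orP => /andP[/eqP <- /eqP <-]; rewrite ?fj // joins_sym.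
case/shortenP: hp hy => q hq uq qp hy.
have sq : size q <= diameter T.
  apply: leq_trans sp; have := uniq_leq_size uq (s2 := x :: p); rewrite /= ltnS; apply=> z.
  rewrite !inE => /orP[->//|zq]; apply/orP; right.
  exact: qp.
case: q hq uq {qp} hy sq => [|z q] /=; first by move=> _ _ h; rewrite h eqxx in xy.
case/andP => /existsP[e /andP[_ he]] hq /andP[xq uq] hy sq.
(* The rest of the path avoids [x], so its image stays within the images of edges other than [e]. *)
pose F := [set fE f | f in ~: [set e]].
have eF : fE e \notin F.
  by apply/imsetP => -[f]; rewrite !inE => fe /fEi h; rewrite h eqxx in fe.
have hpG : path (adjin F) (fV z) (map fV q).
  elim: q z he hq xq {uq hy sq} => [|w q IH] z he //= /andP[/existsP[f /andP[_ hf]] hq] xq.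
  have xzw : (x != z) && (x \notin w :: q) by move: xq; rewrite inE negb_or.
  apply/andP; split.
    apply/exists_inP; exists (fE f); last exact: fj'.
    apply: imset_f; rewrite !inE; apply/eqP => h; rewrite h in hf.
    move: xzw; rewrite inE negb_or => /and3P[xz xw _].
    by case: (joins_ends he hf) => -[h1 h2]; [rewrite h1 eqxx in xz | rewrite h1 eqxx in xw].
  have hp' : forall z, path (@adj T) z q -> x \notin z :: q -> path (adjin F) (fV z) (map fV q).
    move=> z0 hq0 xq0; move: (hq0) (xq0); clear -he fj'.
    elim: q z0 => [|w' q IH'] z0 //= /andP[/existsP[g /andP[_ hg]] hq0].
    rewrite inE negb_or => /andP[xz0 xq0]; apply/andP; split; last exact: IH'.
    apply/exists_inP; exists (fE g); last exact: fj'.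
    apply: imset_f; rewrite !inE; apply/eqP => h; rewrite h in hg.
    move: xq0; rewrite inE negb_or => /andP[xw' _].
    by case: (joins_ends he hg) => -[h1 h2]; [rewrite h1 eqxx in xz0 | rewrite h1 eqxx in xw'].
  by apply: hp' => //; case/andP: xzw.
have hj : joins (fE e) (fV z) (last (fV z) (map fV q)).
  by rewrite last_map hy -fxy joins_sym; apply: fj'.
have [k [vs [es [hcy hk]]]] := path_cycle eF hpG hj.
have := hG k vs es hcy; rewrite size_map in hk.
by rewrite ltnNge (leq_trans hk sq).
Qed.

Section TreeOrder.
Variable T : mgraph.
Hypothesis hT : is_tree T.

(* An ordering of the vertices starting at the root r in which every later
   vertex tv j.+1 is joined to an earlier one, tv (pr j), by the edge te j. *)
Record tree_order (r : vert T) (tv : nat -> vert T) (te : nat -> edge T) (pr : nat -> nat) (m : nat)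
  : Prop := TreeOrder {
  to_root : tv 0 = r;
  to_pr : forall j, j < m -> pr j <= j;
  to_joins : forall j, j < m -> joins (te j) (tv (pr j)) (tv j.+1);
  to_vinj : forall i j, i <= m -> j <= m -> tv i = tv j -> i = j;
  to_einj : forall i j, i < m -> j < m -> te i = te j -> i = j }.

Lemma grow_tree_order r (e0 : edge T) n : n < #|vert T| -> exists tv te pr, tree_order r tv te pr n.
Proof.
case: (hT) => _ hc _; elim: n => [|n IH] hn.
  exists (fun=> r), (fun=> e0), (fun=> 0); split=> //.
  by move=> i j; rewrite !leqn0 => /eqP-> /eqP->.
have [tv [te [pr ho]]] := IH (ltnW hn).
pose X := [set tv i | i : 'I_n.+1].
have X0 : X != set0 by apply/set0Pn; exists (tv 0); apply/imsetP; exists ord0.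
have XT : X != setT.
  apply/eqP => h; have := leq_imset_card (fun i : 'I_n.+1 => tv i) predT.
  by rewrite cardT -cardE card_ord -/X h cardsT leqNgt hn.
have [e [u [v [he uX vX]]]] := connected_cross hc X0 XT.
have [i _ ui] := imsetP uX.
have nX j : j <= n -> v != tv j.
  by move=> hj; apply: contra vX => /eqP ->; apply/imsetP; exists (Ordinal (hj : j < n.+1)).
exists (fun j => if j == n.+1 then v else tv j), (fun j => if j == n then e else te j),
  (fun j => if j == n then i : nat else pr j).
have lt_ne j : j < n -> (j == n = false) * (j == n.+1 = false) * (j.+1 == n.+1 = false).
  by move=> hj; rewrite eqSS !ltn_eqF // ltnW.
have te_ne j : j < n -> te j != e.
  move=> hj; apply/eqP => h; have := to_joins ho hj; rewrite h => hj2.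
  have hp := to_pr ho hj.
  case: (joins_ends he hj2) => -[h1 h2].
    by have := nX j.+1 hj; rewrite h2 eqxx.
  by have := nX (pr j) (leq_trans hp (ltnW hj)); rewrite h2 eqxx.
split.
- by rewrite /= (to_root ho).
- move=> j; rewrite ltnS leq_eqVlt => /orP[/eqP->|hj].
    by rewrite eqxx -ltnS.
  by rewrite !lt_ne // (to_pr ho).
- move=> j; rewrite ltnS leq_eqVlt => /orP[/eqP->|hj].
    by rewrite !eqxx -ui ltn_eqF.
  have hp : pr j < n by apply: leq_ltn_trans (to_pr ho hj) hj.
  by rewrite !(lt_ne _ hj) !(lt_ne _ hp); apply: (to_joins ho).
- move=> j j'; rewrite leq_eqVlt => /orP[/eqP->|hj]; rewrite leq_eqVlt => /orP[/eqP->|hj'] //.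
  + by rewrite eqxx ltn_eqF // => h; have := nX j' hj'; rewrite h eqxx.
  + by rewrite eqxx ltn_eqF // => h; have := nX j hj; rewrite h eqxx.
  + by rewrite !ltn_eqF //; apply: (to_vinj ho).
- move=> j j'; rewrite ltnS leq_eqVlt => /orP[/eqP->|hj]; rewrite ltnS leq_eqVlt => /orP[/eqP->|hj'] //.
  + by rewrite eqxx ltn_eqF // => h; have := te_ne j' hj'; rewrite h eqxx.
  + by rewrite eqxx ltn_eqF // => h; have := te_ne j hj; rewrite h eqxx.
  + by rewrite !ltn_eqF //; apply: (to_einj ho).
Qed.

(** The edges chosen while growing connect all vertices, so any further edge would close a cycle. *)
Lemma tree_orderP r (e0 : edge T) : exists tv te pr,
  [/\ tree_order r tv te pr #|edge T|,
      forall v, exists2 i, i <= #|edge T| & tv i = v &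
      forall e, exists2 j, j < #|edge T| & te j = e].
Proof.
case: (hT) => hV hc hac.
have [n hn] : exists n, #|vert T| = n.+1 by case: #|vert T| hV => // n; exists n.
have [|tv [te [pr ho]]] := @grow_tree_order r e0 n; first by rewrite hn.
have vsurj v : exists2 i, i <= n & tv i = v.
  have ti : injective (fun i : 'I_n.+1 => tv i).
    by move=> i j h; apply: ord_inj; apply: (to_vinj ho) h; rewrite -ltnS ltn_ord.
  have : v \in codom (fun i : 'I_n.+1 => tv i).
    by apply: inj_card_onto => //; rewrite card_ord hn.
  by case/codomP => i ->; exists i; rewrite // -ltnS.
pose F := [set te j | j : 'I_n].
have conn_r i : i <= n -> connect (adjin F) r (tv i).
  elim/ltn_ind: i => i IH; case: i IH => [|i] IH hi; first by rewrite (to_root ho) connect0.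
  have hp := to_pr ho hi; apply: connect_trans (IH (pr i) _ _) _ => //.
    exact: leq_trans hp (ltnW hi).
  apply: connect1; apply/exists_inP; exists (te i); last exact: to_joins ho _ hi.
  by apply/imsetP; exists (Ordinal hi).
have sym : connect_sym (adjin F).
  by apply: sym_connect_sym => u v; apply: eq_existsb => f; rewrite joins_sym.
have esurj e : exists2 j, j < n & te j = e.
  case: (boolP (e \in F)) => [/imsetP[j _ ->]|eF]; first by exists j.
  have he : joins e (src e) (tgt e) by rewrite /joins !eqxx.
  have /connectP[p hp hy] : connect (adjin F) (src e) (tgt e).
    have [i hi <-] := vsurj (src e); have [j hj <-] := vsurj (tgt e).
    by apply: connect_trans (conn_r j hj); rewrite sym; apply: conn_r.
  rewrite hy in he; have [k [vs [es [hcy _]]]] := path_cycle eF hp he.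
  by case: (hac k vs es).
have <- : n = #|edge T|; last by exists tv, te, pr.
have ti : injective (fun i : 'I_n => te i).
  by move=> i j h; apply: ord_inj; apply: (to_einj ho) h; apply: ltn_ord.
have := card_imset predT ti; rewrite cardT -cardE card_ord => <-.
rewrite (_ : [set _ | _ in _] = setT) ?cardsT //; apply/setP => e; rewrite inE.
have [j hj <-] := esurj e; by apply/imsetP; exists (Ordinal hj).
Qed.

(* Rooting T at a leaf, only the first edge meets the root. *)
Lemma leaf_order (e0 : edge T) : exists tv te pr,
  [/\ tree_order (tv 0) tv te pr #|edge T|,
      forall v, exists2 i, i <= #|edge T| & tv i = v,
      forall e, exists2 j, j < #|edge T| & te j = e &
      forall j, 0 < j < #|edge T| -> 0 < pr j].
Proof.
have [tv [te [pr [ho _ es]]]] := tree_orderP (src e0) e0.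
set m := #|edge T| in ho es *.
have m0 : 0 < m by apply/card_gt0P; exists e0.
(* The last vertex of any tree order is a leaf; a second order is then started from it. *)
have leaf e x : joins e (tv m) x -> e = te m.-1.
  have [j hj <-] := es e => h; have := to_joins ho hj => h'.
  have hp := to_pr ho hj.
  case: (joins_ends h h') => -[h1 h2].
    have := to_vinj ho (leqnn m) _ h1; rewrite (leq_trans hp (ltnW hj)) => /(_ isT) hm.
    by move: hp hj; rewrite -hm; clear; lia.
  by have := to_vinj ho (leqnn m) hj h1 => ->.
have [tv' [te' [pr' [ho' vs' es']]]] := tree_orderP (tv m) e0.
have r' := to_root ho'.
exists tv', te', pr'; rewrite r'; split=> // j /andP[j0 jm].
rewrite lt0n; apply/eqP => p0; have := to_joins ho' jm; rewrite p0 r' => /leaf h1.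
have p00 : pr' 0 = 0 by have := to_pr ho' m0; rewrite leqn0 => /eqP.
have := to_joins ho' m0; rewrite p00 r' => /leaf h2.
by have := to_einj ho' jm m0; rewrite h1 h2 => /(_ erefl) h; rewrite h in j0.
Qed.

End TreeOrder.

(** * Walking tokens *)

Notation fibre f v := [set e | f e == v].

(** The n-th token at [v] takes the n-th edge of [M] at [v]. *)
Lemma inj_fibre (I E V : finType) (f : I -> V) (g : E -> V) (M : {set E}) :
  (forall v, #|fibre f v| <= #|M :&: fibre g v|) ->
  exists phi : I -> E, injective phi /\ forall i, phi i \in M /\ g (phi i) = f i.
Proof.
move=> h; case: (pickP (fun _ : I => true)) => [i0 _|hI]; last first.
  by exists (fun i => False_rect _ (Bool.diff_true_false (hI i))); split=> i; have := hI i.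
have [e0 _] : exists e0, e0 \in M :&: fibre g (f i0).
  by apply/card_gt0P; apply: leq_trans (h (f i0)); apply/card_gt0P; exists i0; rewrite inE.
pose fi v := enum (fibre f v); pose ge v := enum (M :&: fibre g v).
pose phi i := nth e0 (ge (f i)) (index i (fi (f i))).
have lt i : index i (fi (f i)) < size (ge (f i)).
  apply: leq_trans (_ : size (fi (f i)) <= _); first by rewrite index_mem mem_enum inE.
  by rewrite -!cardE.
have phiP i : phi i \in M /\ g (phi i) = f i.
  by have := mem_nth e0 (lt i); rewrite mem_enum !inE => /andP[-> /eqP].
exists phi; split=> // i j hij.
have fij : f i = f j by have [_ <-] := phiP i; have [_ <-] := phiP j; rewrite hij.
move: hij; rewrite /phi fij => /eqP; rewrite nth_uniq ?enum_uniq //; last by rewrite -fij.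
move=> /eqP hidx; have hi : i \in fi (f j) by rewrite mem_enum inE fij.
have hj : j \in fi (f j) by rewrite mem_enum inE.
by rewrite -(nth_index i hi) hidx nth_index.
Qed.

(* Every token i walks along the tree: its position at the j.+1-st vertex is the
   head of an edge of M j leaving its position at the parent vertex. *)
Lemma token_walks (V E I : finType) (tl hd : E -> V) (M : nat -> {set E}) (root : I -> V)
    (pr : nat -> nat) (m : nat) :
  (forall j, j < m -> pr j <= j) ->
  (forall j v, j < m -> pr j = 0 -> #|fibre root v| <= #|M j :&: fibre tl v|) ->
  (forall i j v, j < m -> pr j = i.+1 -> #|M i :&: fibre hd v| <= #|M j :&: fibre tl v|) ->
  exists pos : nat -> I -> V, pos 0 = root /\
    forall j, j < m -> exists phi : I -> E, injective phi /\
      forall i, [/\ phi i \in M j, tl (phi i) = pos (pr j) i & hd (phi i) = pos j.+1 i].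
Proof.
elim: m => [|m IH] h1 h2 h3; first by exists (fun=> root).
have [|||pos [p0 hpos]] := IH.
- by move=> j jm; apply: h1; apply: ltnW.
- by move=> j v jm; apply: h2; apply: ltnW.
- by move=> i j v jm; apply: h3; apply: ltnW.
have [|phi [phii phiP]] := @inj_fibre I E V (pos (pr m)) tl (M m).
  move=> v; have hp := h1 m (leqnn _); case hpm: (pr m) hp => [|i] hp.
    by rewrite p0; apply: h2.
  have [psi [psii psiP]] := hpos i hp.
  apply: leq_trans (h3 i m v (leqnn _) hpm).
  rewrite -(card_imset _ psii); apply: subset_leq_card; apply/subsetP => e /imsetP[u].
  by rewrite inE => /eqP hu ->; have [h4 _ h5] := psiP u; rewrite !inE h4 h5 hu eqxx.
exists (fun j => if j == m.+1 then fun i => hd (phi i) else pos j); split=> // j.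
rewrite ltnS leq_eqVlt => /orP[/eqP->|jm].
  exists phi; split=> // i; have [h4 h5] := phiP i.
  by rewrite eqxx (ltn_eqF (h1 m (leqnn _) : pr m < m.+1)) h4 h5.
have [psi [psii psiP]] := hpos j jm; exists psi; split=> // i.
have [h4 h5 h6] := psiP i; rewrite eqSS (ltn_eqF jm).
by rewrite ltn_eqF // ltnS (leq_trans (h1 j (ltnW jm)) (ltnW jm)).
Qed.

Section Decomposition.
Variables T G : mgraph.

Definition dec (S : {set edge G}) :=
  exists P : {set {set edge G}}, partition P S /\ forall X, X \in P -> hom_copy_on T X.

Lemma decU (S1 S2 : {set edge G}) : [disjoint S1 & S2] -> dec S1 -> dec S2 -> dec (S1 :|: S2).
Proof.
move=> d [P1 [/and3P[/eqP c1 t1 n1] h1]] [P2 [/and3P[/eqP c2 t2 n2] h2]].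
exists (P1 :|: P2); split; last by move=> X; rewrite inE => /orP[/h1|/h2].
apply/and3P; split.
- by rewrite /cover bigcup_setU -/(cover P1) -/(cover P2) c1 c2.
- apply/trivIsetP => X Y; rewrite !inE => /orP[] hX /orP[] hY.
  + exact: (trivIsetP t1).
  + move=> _; apply: disjointWl (_ : X \subset S1) _; first by rewrite -c1; apply: bigcup_sup hX.
    by apply: disjointWr d; rewrite -c2; apply: bigcup_sup hY.
  + move=> _; rewrite disjoint_sym.
    apply: disjointWl (_ : Y \subset S1) _; first by rewrite -c1; apply: bigcup_sup hY.
    by apply: disjointWr d; rewrite -c2; apply: bigcup_sup hX.
  + exact: (trivIsetP t2).
- by rewrite inE negb_or n1 n2.
Qed.

Lemma dec_family (J : finType) (c : J -> edge T -> edge G) (fV : J -> vert T -> vert G) :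
  0 < #|edge T| ->
  (forall j e j' e', c j e = c j' e' -> j = j' /\ e = e') ->
  (forall j e, joins (c j e) (fV j (src e)) (fV j (tgt e))) ->
  dec [set c p.1 p.2 | p : J * edge T].
Proof.
move=> /card_gt0P[e0 _] ci cj; exists [set [set c j e | e : edge T] | j : J]; split.
  apply/and3P; split.
  - apply/eqP/setP => f; apply/bigcupP/imsetP => [[X /imsetP[j _ ->] /imsetP[e _ ->]]|[[j e] _ ->]].
      by exists (j, e).
    by exists [set c j e' | e' : edge T]; [apply: imset_f | apply: imset_f].
  - apply/trivIsetP => X Y /imsetP[j _ ->] /imsetP[j' _ ->] ne.
    rewrite -setI_eq0; apply/eqP/setP => f; rewrite !inE; apply/negP.
    move=> /andP[/imsetP[e _ ->] /imsetP[e' _ h]].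
    by have [jj _] := ci _ _ _ _ h; rewrite jj eqxx in ne.
  - by apply/imsetP => -[j _ h]; have := in_set0 (c j e0); rewrite h imset_f.
move=> X /imsetP[j _ ->]; exists (fV j), (c j); split.
- by move=> e e' h; have [] := ci _ _ _ _ h.
- by move=> e; apply: imset_f.
- by move=> f /imsetP[e _ ->]; exists e.
- exact: cj.
Qed.

End Decomposition.

Lemma card_sum_fibre (E V : finType) (X : {set E}) (f : E -> V) :
  \sum_v #|X :&: fibre f v| = #|X|.
Proof. by rewrite [RHS](cards_fibre f). Qed.

Lemma fibre_setD (E V : finType) (X I : {set E}) (f : E -> V) v : I \subset X ->
  #|X :&: fibre f v| = #|I :&: fibre f v| + #|(X :\: I) :&: fibre f v|.
Proof.
by move=> IX; rewrite -(cardsID I (X :&: fibre f v)) setIAC (setIidPr IX) setIDAC.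
Qed.

(* Koenig's edge colouring theorem for the bipartite graph of tails and heads. *)
Lemma equal_classes (V E : finType) (tl hd : E -> V) (n : V -> nat) m (S : {set E}) :
  (forall v, #|S :&: fibre tl v| = m * n v) -> (forall v, #|S :&: fibre hd v| = m * n v) ->
  exists M : nat -> {set E}, [/\ forall j, j < m -> M j \subset S,
    forall j v, j < m -> #|M j :&: fibre tl v| = n v,
    forall j v, j < m -> #|M j :&: fibre hd v| = n v,
    forall i j e, i < m -> j < m -> e \in M i -> e \in M j -> i = j &
    forall e, e \in S -> exists2 j, j < m & e \in M j].
Proof.
elim: m S => [|m IH] S h1 h2.
  exists (fun=> set0); split=> // e eS.
  have : 0 < #|S :&: fibre tl (tl e)| by apply/card_gt0P; exists e; rewrite !inE eS eqxx.
  by rewrite h1.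
have [||I [IS I1 I2]] := @degree_select V E tl hd S m.+1 n n isT.
- by move=> v; rewrite h1.
- by move=> v; rewrite h2.
(* Tails and heads have the same total, so the bounds at the heads are all attained. *)
have I3 v : #|I :&: fibre hd v| = n v.
  apply/eqP; rewrite eqn_leq I2 /= leqNgt; apply/negP => hv.
  have : \sum_u #|I :&: fibre hd u| < \sum_u n u.
    rewrite (bigD1 v) //= [X in _ < X](bigD1 v) //= -addSn; apply: leq_add => //.
    by apply: leq_sum => u _; apply: I2.
  rewrite card_sum_fibre -(card_sum_fibre I tl) (eq_bigr n) ?ltnn // => u _; exact: I1.
have [v|v|M [M1 M2 M3 M4 M5]] := IH (S :\: I).
- by have := h1 v; rewrite (fibre_setD _ _ IS) I1 mulSn => /addnI.
- by have := h2 v; rewrite (fibre_setD _ _ IS) I3 mulSn => /addnI.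
have MI j e : j < m -> e \in M j -> e \notin I.
  by move=> jm ej; have := subsetP (M1 j jm) e ej; rewrite inE => /andP[].
exists (fun j => if j == m then I else M j); split.
- move=> j; rewrite ltnS leq_eqVlt => /orP[/eqP->|jm]; first by rewrite eqxx.
  by rewrite (ltn_eqF jm); apply: subset_trans (M1 j jm) (subsetDl _ _).
- move=> j v; rewrite ltnS leq_eqVlt => /orP[/eqP->|jm]; first by rewrite eqxx.
  by rewrite (ltn_eqF jm); apply: M2.
- move=> j v; rewrite ltnS leq_eqVlt => /orP[/eqP->|jm]; first by rewrite eqxx.
  by rewrite (ltn_eqF jm); apply: M3.
- move=> i j e; rewrite ltnS leq_eqVlt => /orP[/eqP->|im]; rewrite ltnS leq_eqVlt => /orP[/eqP->|jm] //.
  + by rewrite eqxx (ltn_eqF jm) => eI /(MI j e jm); rewrite eI.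
  + by rewrite eqxx (ltn_eqF im) => /(MI i e im) /negPf ->.
  + by rewrite (ltn_eqF jm) (ltn_eqF im); apply: M4.
- move=> e eS; case: (boolP (e \in I)) => eI; first by exists m; rewrite ?eqxx.
  have [|j jm ej] := M5 e; first by rewrite inE eI.
  by exists j; rewrite ?(ltn_eqF jm) // ltnW.
Qed.

Section TreeCopies.
Variables (T G : mgraph) (r : vert T) (tv : nat -> vert T) (te : nat -> edge T) (pr : nat -> nat).
Variable m : nat.
Hypothesis ho : tree_order r tv te pr m.
Hypothesis vs : forall v, exists2 i, i <= m & tv i = v.
Hypothesis es : forall e, exists2 j, j < m & te j = e.
Hypothesis T0 : 0 < #|edge T|.

(** One copy for each token [i]: the vertex [tv l] goes to [pos l i] and the edge [te j] to
    [phi j i]. *)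
Lemma dec_tokens (I : finType) (pos : nat -> I -> vert G) (phi : 'I_m -> I -> edge G) :
  (forall j i, joins (phi j i) (pos (pr j) i) (pos j.+1 i)) ->
  (forall j i j' i', phi j i = phi j' i' -> j = j' /\ i = i') ->
  dec T [set phi p.1 p.2 | p : 'I_m * I].
Proof.
move=> hj hi.
have hes e : exists j : 'I_m, te j = e by have [j jm <-] := es e; exists (Ordinal jm).
have [jof hjof] := fin_all_exists hes.
have hvs v : exists i : 'I_m.+1, tv i = v.
  by have [i im <-] := vs v; exists (Ordinal (im : i < m.+1)).
have [vof hvof] := fin_all_exists hvs.
have vofK l : l <= m -> vof (tv l) = l :> nat.
  by move=> lm; apply: (to_vinj ho) (hvof _); rewrite // -ltnS ltn_ord.
have -> : [set phi p.1 p.2 | p : 'I_m * I] = [set phi (jof p.2) p.1 | p : I * edge T].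
  apply/setP => f; apply/imsetP/imsetP => [[[j i] _ ->]|[[i e] _ ->]].
    exists (i, te j) => //=; congr (phi _ i); apply: ord_inj.
    by apply: (to_einj ho); rewrite ?ltn_ord // hjof.
  by exists (jof e, i).
apply: (@dec_family T G I (fun i e => phi (jof e) i) (fun i v => pos (vof v) i)) => //.
- move=> i e i' e' /hi[h1 h2]; split=> //.
  by rewrite -(hjof e) -(hjof e') h1.
- move=> i e; have jm := ltn_ord (jof e).
  have hp := to_pr ho jm; have := to_joins ho jm; rewrite hjof.
  have hpm : pr (jof e) <= m := leq_trans hp (ltnW jm).
  by case/orP => /andP[/eqP -> /eqP ->]; rewrite !vofK // joins_sym.
Qed.

End TreeCopies.

(** * Graphs with all degrees divisible by 2m *)

Section Eulerian.
Variables T G : mgraph.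
Hypothesis hT : is_tree T.
Let m := #|edge T|.
Hypothesis m0 : 0 < m.

Lemma dec_eulerian (S : {set edge G}) :
  (forall v, 2 * m %| dg (@src G) (@tgt G) S v) -> dec T S.
Proof.
move=> hS; have [e0 _] := card_gt0P m0.
have [tv [te [pr [ho vs es]]]] := tree_orderP hT (src e0) e0.
rewrite -/m in ho vs es.
have [o ho'] := euler_orientation (@src G) (@tgt G) S.
pose tl e := if o e then src e else tgt e; pose hd e := if o e then tgt e else src e.
pose n v := dg (@src G) (@tgt G) S v %/ (2 * m).
have dgn v : dg (@src G) (@tgt G) S v = 2 * (m * n v).
  by rewrite mulnA mulnC divnK.
have hcard (f : edge G -> vert G) v : #|S :&: fibre f v| = \sum_(e in S) (f e == v).
  rewrite -sum1_card big_mkcond [RHS]big_mkcond; apply: eq_bigr => e _.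
  by rewrite !inE; case: (e \in S) => //=; case: (_ == v).
have hsum v : #|S :&: fibre tl v| + #|S :&: fibre hd v| = 2 * (m * n v).
  rewrite -dgn !hcard -big_split; apply: eq_bigr => e _.
  by rewrite /tl /hd; case: (o e) => //=; rewrite addnC.
have hdif v : (net (@src G) (@tgt G) o S v = Posz #|S :&: fibre tl v| - Posz #|S :&: fibre hd v|)%R.
  rewrite !hcard !(big_morph Posz PoszD (erefl _)) -GRing.sumrB; apply: eq_bigr => e _.
  by rewrite /tl /hd; case: (o e).
have hout v : #|S :&: fibre tl v| = m * n v /\ #|S :&: fibre hd v| = m * n v.
  have := ho' v; have := hsum v; rewrite hdif; clear.
  by move: #|_| #|_| (m * n v) => p q s; split; lia.
have [||M [M1 M2 M3 M4 M5]] := @equal_classes _ _ tl hd n m S.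
- by move=> v; case: (hout v).
- by move=> v; case: (hout v).
(* One token for each edge of [M 0], starting at its tail, puts exactly [n v] tokens at [v]. *)
pose I := {e : edge G | e \in M 0}.
have cI v : #|fibre (fun i : I => tl (val i)) v| = n v.
  rewrite -(M2 0 v m0) -(card_imset _ val_inj); apply: eq_card => e; rewrite !inE.
  apply/imsetP/andP => [[i]|[eM he]]; first by rewrite inE => hi ->; split=> //; exact: valP i.
  by exists (exist _ e eM : I); rewrite ?inE.
have prm j : j < m -> pr j < m by move=> jm; apply: leq_ltn_trans (to_pr ho jm) jm.
have [|||pos [p0 hpos]] := @token_walks _ _ I tl hd M (fun i : I => tl (val i)) pr m.
- exact: to_pr ho.
- by move=> j v jm _; rewrite cI M2.
- by move=> i j v jm hp; rewrite M3 ?M2 // ltnW // -hp prm.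
have [phi hphi] := fin_all_exists (fun j : 'I_m => hpos j (ltn_ord j)).
have <- : [set phi p.1 p.2 | p : 'I_m * I] = S.
  apply/setP => e; apply/imsetP/idP => [[[j i] _ ->]|eS].
    by case: (hphi j) => _ /(_ i)[h _ _]; apply: (subsetP (M1 j (ltn_ord j))).
  have [j jm ej] := M5 e eS; pose j' := Ordinal jm.
  have [pinj hp] := hphi j'.
  (* There are as many tokens as edges in each class, so the walks use up the whole class. *)
  have : phi j' @: setT = M j.
    apply/eqP; rewrite eqEcard; apply/andP; split.
      by apply/subsetP => f /imsetP[i _ ->]; case: (hp i).
    rewrite card_imset // -(card_sum_fibre (M j) tl) (eq_bigr n) => [|v _]; last exact: M2.
    rewrite cardsT -(cardsT I) -(card_sum_fibre setT (fun i : I => tl (val i))).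
    by apply: leq_sum => v _; rewrite setTI cI.
  by move=> hM; move: ej; rewrite -hM => /imsetP[i _ ->]; exists (j', i).
apply: (dec_tokens ho vs es m0 (pos := pos)).
- move=> j i; case: (hphi j) => _ /(_ i)[_ <- <-].
  by rewrite /joins /tl /hd; case: (o _); rewrite !eqxx ?orbT.
- move=> j i j' i' h; have [pj hpj] := hphi j; have [_ hpj'] := hphi j'.
  have jj : j = j'.
    apply: ord_inj; apply: (M4 j j' (phi j i)); rewrite ?ltn_ord //; first by case: (hpj i).
    by rewrite h; case: (hpj' i').
  by subst j'; split=> //; apply: pj.
Qed.

End Eulerian.

(** * Removing copies to control the degrees *)

(** Since indegrees are only bounded above, the classes grow: for i < j the indegree
    [4 ^ i.+1 * u v] allowed in class i is at most the outdegree [4 ^ j * u v] of class j, and every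
    token that arrives can leave. *)
Lemma nested_classes (V E : finType) (tl hd : E -> V) (M : {set E}) (u : V -> nat) (m : nat) :
  (forall v, 2 * 4 ^ m * u v <= #|M :&: fibre tl v|) ->
  (forall v, #|M :&: fibre hd v| <= 4 * 4 ^ m * u v) ->
  exists Mj : nat -> {set E}, [/\ forall j, j < m -> Mj j \subset M,
    forall j v, j < m -> #|Mj j :&: fibre tl v| = 4 ^ j * u v,
    forall j v, j < m -> #|Mj j :&: fibre hd v| <= 4 ^ j.+1 * u v &
    forall i j e, i < m -> j < m -> e \in Mj i -> e \in Mj j -> i = j].
Proof.
move=> hout hin.
suff H n : n <= m -> exists (Mj : nat -> {set E}) (R : {set E}),
   [/\ R \subset M, forall v, 2 * 4 ^ m * u v <= #|R :&: fibre tl v| + 4 ^ n * u v,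
    forall j, j < n -> Mj j \subset M :\: R &
    [/\ forall j v, j < n -> #|Mj j :&: fibre tl v| = 4 ^ j * u v,
    forall j v, j < n -> #|Mj j :&: fibre hd v| <= 4 ^ j.+1 * u v &
    forall i j e, i < n -> j < n -> e \in Mj i -> e \in Mj j -> i = j]].
  have [Mj [R [h1 h2 h3 [h4 h5 h6]]]] := H m (leqnn m).
  by exists Mj; split=> // j jm; apply: subset_trans (h3 j jm) (subsetDl _ _).
elim: n => [|n IH] nm.
  exists (fun=> set0), M; split=> // v; apply: leq_trans (hout v) _; exact: leq_addr.
have [Mj [R [h1 h2 h3 [h4 h5 h6]]]] := IH (ltnW nm).
have pw : 4 ^ (m - n) * 4 ^ n = 4 ^ m by rewrite -expnD subnK // ltnW.
have pn : 4 ^ n.+1 = 4 * 4 ^ n by rewrite expnS.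
have p2 : 4 ^ n * 4 <= 4 ^ m by rewrite -expnSr leq_exp2l.
(* The earlier classes have used less than half of the required outdegree, so [4 ^ m * u v] is still
   there; the factor [4 ^ (m - n)] scales the n-th class to this supply and to the bound on
   heads. *)
have [|||I [IR I1 I2]] := @degree_select V E tl hd R (4 ^ (m - n)) (fun v => 4 ^ n * u v) (fun v => 4 ^ n.+1 * u v).
- by rewrite expn_gt0.
- by move=> v; have := h2 v; rewrite mulnA pw; move: p2; clear; nia.
- move=> v; apply: leq_trans (subset_leq_card (setSI _ h1)) _; apply: leq_trans (hin v) _.
  by rewrite pn mulnA [_ * (4 * _)]mulnCA pw.
exists (fun j => if j == n then I else Mj j), (R :\: I); split.
- exact: subset_trans (subsetDl _ _) h1.
- by move=> v; have := h2 v; rewrite (fibre_setD _ _ IR) I1 pn; clear; nia.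
- move=> j; rewrite ltnS leq_eqVlt => /orP[/eqP->|jn].
    rewrite eqxx; apply/subsetP => e eI; rewrite !inE eI /=.
    by apply: (subsetP h1); apply: (subsetP IR).
  rewrite (ltn_eqF jn); apply: subset_trans (h3 j jn) _; apply: setDS; exact: subsetDl.
have MI j e : j < n -> e \in Mj j -> e \notin I.
  move=> jn ej; have := subsetP (h3 j jn) e ej; rewrite inE => /andP[eR _].
  by apply: contra eR; apply: (subsetP IR).
split.
- move=> j v; rewrite ltnS leq_eqVlt => /orP[/eqP->|jn]; first by rewrite eqxx.
  by rewrite (ltn_eqF jn); apply: h4.
- move=> j v; rewrite ltnS leq_eqVlt => /orP[/eqP->|jn]; first by rewrite eqxx.
  by rewrite (ltn_eqF jn); apply: h5.
- move=> i j e; rewrite ltnS leq_eqVlt => /orP[/eqP->|im]; rewrite ltnS leq_eqVlt => /orP[/eqP->|jm] //.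
  + by rewrite eqxx (ltn_eqF jm) => eI /(MI j e jm); rewrite eI.
  + by rewrite eqxx (ltn_eqF im) => /(MI i e im) /negPf ->.
  + by rewrite (ltn_eqF jm) (ltn_eqF im); apply: h6.
Qed.

Lemma modn_int (x y d : nat) : (exists z : int, Posz x = Posz y + z * Posz d)%R -> x = y %[mod d].
Proof.
case=> -[n|n] h.
  have -> : x = n * d + y by move: h; clear; lia.
  by rewrite modnMDl.
have -> : y = n.+1 * d + x by move: h; clear; lia.
by rewrite modnMDl.
Qed.

(** The solvability condition on the side A. With m = [m'.+1], [2 * eA + c] equals m(q + j) + r,
    while the degrees to be removed add up to m i + r. Modulo 2m these agree exactly when q + j and
    i have the same parity. Here i counts the copies, r those starting from an edge inside A, and s
    the one from the crossing edge. *)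
Lemma target_sum1 (m' eA eB c l1 l2 r j q s i : nat) :
  eA = eB + r + m'.+1 * j -> eA + eB + c = m'.+1 * q -> i = l1 + l2 + r + s ->
  odd (q + j) = odd i ->
  2 * eA + c + (2 * m'.+1 - 1) * (m' * i + l2 + (2 * r + s)) = l1 %[mod 2 * m'.+1].
Proof.
move=> h1 h2 h3 h4; apply: modn_int.
have [y hy] : exists y : int, (Posz (q + j) = Posz i + 2 * y)%R.
  exists ((Posz (q + j) - Posz i) %/ 2)%Z; move: h4; clear; lia.
exists (y + Posz (m' * i + l2 + (2 * r + s)))%R.
have -> : 2 * m'.+1 - 1 = m' + m'.+1 by clear; lia.
move: h1 h2 h3 hy; clear => -> h2 -> hy.
have : (Posz eB + Posz eB + Posz c = Posz m'.+1 * (Posz q - Posz j) - Posz r)%R by move: h2; clear; lia.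
move: hy; clear; lia.
Qed.

(** The same balance on the other side, where r and j enter with the opposite sign; the parity
    condition is unchanged. *)
Lemma target_sum2 (m' eA eB c l1 l2 r j q s i : nat) :
  eA = eB + r + m'.+1 * j -> eA + eB + c = m'.+1 * q -> i = l1 + l2 + r + s ->
  odd (q + j) = odd i ->
  2 * eB + c + (2 * m'.+1 - 1) * (m' * i + l1 + s) = l2 %[mod 2 * m'.+1].
Proof.
move=> h1 h2 h3 h4; apply: modn_int.
have [y hy] : exists y : int, (Posz q - Posz j = Posz i + 2 * y)%R.
  exists ((Posz q - Posz j - Posz i) %/ 2)%Z; move: h4; clear; lia.
exists (y + Posz (m' * i + l1 + s))%R.
have -> : 2 * m'.+1 - 1 = m' + m'.+1 by clear; lia.
move: h1 h2 h3 hy; clear => -> h2 -> hy.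
have : (Posz eB + Posz eB + Posz c = Posz m'.+1 * (Posz q - Posz j) - Posz r)%R by move: h2; clear; lia.
rewrite hy; clear; lia.
Qed.

(** If fewer than half of the edges leaving [X] crossed a maximum cut, exchanging the sides of the
    vertices of [X] would enlarge it. *)
Lemma max_cut (V E : finType) (a b : E -> V) : exists A : {set V},
  forall X, cut a b setT X <= 2 * cut a b [set e | (a e \in A) (+) (b e \in A)] X.
Proof.
have [A _ hA] := arg_maxnP (cut a b setT) (isT : xpredT (set0 : {set V})).
exists A => X; pose B := (A :\: X) :|: (X :\: A).
have := hA B isT; rewrite /=.
have -> : cut a b [set e | (a e \in A) (+) (b e \in A)] X =
   \sum_(e in setT) (((a e \in A) (+) (b e \in A)) && ((a e \in X) (+) (b e \in X))).
  rewrite /cut big_mkcond [RHS]big_mkcond; apply: eq_bigr => e _; rewrite !inE.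
  by case: ((a e \in A) (+) (b e \in A)).
have : cut a b setT B + 2 * (\sum_(e in setT) (((a e \in A) (+) (b e \in A)) && ((a e \in X) (+) (b e \in X)))) =
   cut a b setT A + cut a b setT X.
  rewrite /cut big_distrr -!big_split; apply: eq_bigr => e _; rewrite !inE /=.
  by do 2 case: (_ \in A); do 2 case: (_ \in X).
by clear; move: (cut _ _ _ _) (cut _ _ _ _) (cut _ _ _ _) (\sum_(_ in _) _) => p q r s; lia.
Qed.

Lemma edge_connected_cut (G : mgraph) k (X : {set vert G}) : edge_connected k G ->
  X != set0 -> X != setT -> k <= cut (@src G) (@tgt G) setT X.
Proof.
move=> hG /set0Pn[x xX]; rewrite -subTset => /subsetPn[y _ yX].
rewrite leqNgt; apply/negP => hlt.
pose F := [set e | (@src G e \in X) (+) (@tgt G e \in X)].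
have cF : #|F| = cut (@src G) (@tgt G) setT X.
  rewrite /cut -sum1_card big_mkcond [RHS]big_mkcond; apply: eq_bigr => e _.
  by rewrite !inE; case: (_ (+) _).
rewrite -cF in hlt; have /connectP[p hp hy] := hG F hlt x y.
elim: p x xX hp hy => [|z p IH] x xX /=; first by move=> _ h; rewrite h xX in yX.
case/andP => /existsP[e /andP[eF he]] hp hy; apply: (IH z _ hp hy).
move: eF; rewrite inE; case/orP: he => /andP[/eqP -> /eqP ->]; rewrite xX.
  by case: (z \in X).
by case: (z \in X).
Qed.

Lemma sum_sig (E : finType) (X : {set E}) (F : E -> nat) :
  \sum_(i : {e : E | e \in X}) F (val i) = \sum_(e in X) F e.
Proof.
have hX : [set val i | i : {e : E | e \in X}] = X.
  apply/setP => e; apply/imsetP/idP => [[i _ ->]|eX]; first exact: valP i.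
  by exists (exist _ e eX).
rewrite -[in RHS]hX big_imset /=; last by move=> ? ? _ _; apply: val_inj.
by apply: eq_big.
Qed.

Lemma card_fibre (E V : finType) (S : {set E}) (f : E -> V) v :
  #|S :&: fibre f v| = \sum_(e in S) (f e == v).
Proof.
rewrite -sum1_card big_mkcond [RHS]big_mkcond; apply: eq_bigr => e _.
by rewrite !inE; case: (e \in S) => //=; case: (_ == v).
Qed.

Lemma mod_predM (d k x : nat) : 0 < k -> d + (k - 1) * x + x = d %[mod k].
Proof. by move=> k0; rewrite -addnA -mulSnr -addn1 subnK // mulnC addnC modnMDl. Qed.

(** * The decomposition for a given highly connected cut *)

Section Assembly.
Variables T G : mgraph.
Hypothesis hT : is_tree T.
Variable m' : nat.
Hypothesis hm : #|edge T| = m'.+1.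
Let m := m'.+1.
Let N := mod_conn (2 * m).
(** [D] is the outdegree that [nested_classes] consumes per token, [K] the sparsity that secures it
    by [tokens_bound], and [n2] the connectivity that [sparse_lifting] asks of a group. *)
Let D := 2 * 4 ^ m'.
Let K := 8 * D.
Let n2 := 2 * (N.+1 * (2 * K)).

Local Notation V := (vert G).
Local Notation E := (edge G).
Local Notation s := (@src G).
Local Notation t := (@tgt G).
Variable A : {set V}.
Let al e := if s e \in A then s e else t e.
Let bt e := if s e \in A then t e else s e.
Let C := [set e | (s e \in A) (+) (t e \in A)].

Lemma alC e : e \in C -> al e \in A.
Proof. by rewrite inE /al; case: ifP. Qed.

Lemma btC e : e \in C -> bt e \notin A.
Proof. by rewrite inE /bt; case: ifP => //= ->. Qed.

Lemma cut_albt (S : {set E}) X : cut al bt S X = cut s t S X.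
Proof. by apply: eq_bigr => e _; rewrite /al /bt; case: ifP => // _; rewrite addbC. Qed.

Lemma cut_btal (S : {set E}) X : cut bt al S X = cut s t S X.
Proof. by apply: eq_bigr => e _; rewrite /al /bt; case: ifP => // _; rewrite addbC. Qed.

Definition dg1 (e : E) (v : V) := (s e == v) + (t e == v).

Lemma dg1_in e v : e \in C -> v \in A -> dg1 e v = (al e == v).
Proof.
rewrite inE /dg1 /al; case: ifP => hs /= ht vA.
  have -> : t e == v = false by apply/eqP => h; rewrite h vA in ht.
  by rewrite addn0.
have -> : s e == v = false by apply/eqP => h; rewrite h vA in hs.
by [].
Qed.

Lemma dg1_out e v : e \in C -> v \notin A -> dg1 e v = (bt e == v).
Proof.
rewrite inE /dg1 /bt; case: ifP => hs /= ht vA.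
  have -> : s e == v = false by apply/eqP => h; rewrite -h hs in vA.
  by [].
have -> : t e == v = false by apply/eqP => h; rewrite -h ht in vA.
by rewrite addn0.
Qed.

Definition endsin (U : {set V}) (e : E) := (s e \in U) + (t e \in U).

Lemma sum_dg1 (U : {set V}) e : \sum_(v in U) dg1 e v = endsin U e.
Proof. by rewrite /dg1 big_split /= !sum_eq_in. Qed.

Lemma endsin_C e : e \in C -> endsin A e = 1 /\ endsin (~: A) e = 1.
Proof. by rewrite inE /endsin !inE; do 2 case: (_ \in A). Qed.

Let EA := [set e | (s e \in A) && (t e \in A)].
Let EB := [set e | (s e \notin A) && (t e \notin A)].

Lemma sum_endsin_A : \sum_(e in setT) endsin A e = 2 * #|EA| + #|C|.
Proof.
rewrite -!sum1_card big_distrr /= ![\sum_(e in _) _]big_mkcond -big_split /=.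
by apply: eq_bigr => e _; rewrite !inE /endsin; do 2 case: (_ \in A).
Qed.

Lemma sum_endsin_B : \sum_(e in setT) endsin (~: A) e = 2 * #|EB| + #|C|.
Proof.
rewrite -!sum1_card big_distrr /= ![\sum_(e in _) _]big_mkcond -big_split /=.
by apply: eq_bigr => e _; rewrite !inE /endsin !inE; do 2 case: (_ \in A).
Qed.

Lemma card_edges : #|EA| + #|EB| + #|C| = #|E|.
Proof.
rewrite -cardsT -!sum1_card ![\sum_(e in _) _]big_mkcond -!big_split /=.
by apply: eq_bigr => e _; rewrite !inE; do 2 case: (_ \in A).
Qed.

Hypothesis hcut : forall X : {set V}, X != set0 -> X != setT -> 2 * (3 * n2) <= cut s t C X.
Hypotheses (A0 : A != set0) (AT : A != setT).
Hypothesis hAB : #|EB| <= #|EA|.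
Hypothesis hdiv : m %| #|E|.

Lemma n2_pos : 0 < n2.
Proof. by rewrite /n2 /K /D !muln_gt0 /= expn_gt0. Qed.

Lemma N_gt1 : 1 < N.
Proof. by rewrite /N /mod_conn /m; clear; nia. Qed.

(** Here d is the degree of a vertex in a group and g the part of it set aside for split pairs. As K
    = 8D, D g is at most d/4; by the size of [n2], D(m + 1) is at most d/32; and [out] is at least
    (d - g - 1)/2. *)
Lemma tokens_bound d g c out : K * g <= 2 * d -> d <= c + g -> c <= 2 * out + 1 -> n2 <= d ->
  D * (g + m).+1 <= out.
Proof.
have hN : m < N by rewrite /N /mod_conn; rewrite /m; clear; nia.
rewrite /n2 /K; have : 0 < D by rewrite /D muln_gt0 expn_gt0.
move: D N m hN; clear => D N m; nia.
Qed.

Theorem dec_from_cut : dec T [set: E].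
Proof.
have T0 : 0 < #|edge T| by rewrite hm.
have [e0 _] := card_gt0P T0.
have B0 : ~: A != set0 by apply: contra AT => /eqP h; rewrite -(setCK A) h setC0.
have n30 : 0 < 3 * n2 by rewrite muln_gt0 n2_pos.
have [Gr [GS Gd Gc]] := pack_groups n30 hcut.
pose i1 : 'I_3 := @Ordinal 3 0 isT; pose i2 : 'I_3 := @Ordinal 3 1 isT; pose i3 : 'I_3 := @Ordinal 3 2 isT.
have EC j e : e \in Gr j -> e \in C by apply: (subsetP (GS j)).
have K0 : 0 < K by rewrite /K /D !muln_gt0 expn_gt0.
have [G1 [L1 [p1 [[G1E L1G p1i hp1] conn1 sp1]]]] :
  exists (G L : {set E}) (p : E -> E),
  [/\ [/\ G \subset Gr i1, L \subset G, {in L &, injective p} &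
       forall e, e \in L -> [/\ p e \in G, p e \notin L & bt (p e) = bt e]],
       forall X : {set V}, X \subset A -> X != set0 -> X != A ->
         N <= cut al (fun e => al (p e)) L X &
       forall v, v \notin A -> K * #|G :&: fibre bt v| <= 2 * #|Gr i1 :&: fibre bt v|].
  apply: sparse_lifting => //; first by move=> e /EC/alC.
  - by move=> e /EC/btC.
  - exact: N_gt1.
  - by move=> X X0 XT; rewrite cut_albt; apply: Gc.
have [G2 [L2 [p2 [[G2E L2G p2i hp2] conn2 sp2]]]] :
  exists (G L : {set E}) (p : E -> E),
  [/\ [/\ G \subset Gr i2, L \subset G, {in L &, injective p} &
       forall e, e \in L -> [/\ p e \in G, p e \notin L & al (p e) = al e]],
       forall X : {set V}, X \subset ~: A -> X != set0 -> X != ~: A ->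
         N <= cut bt (fun e => bt (p e)) L X &
       forall v, v \notin ~: A -> K * #|G :&: fibre al v| <= 2 * #|Gr i2 :&: fibre al v|].
  apply: sparse_lifting => //; first by move=> e /EC/btC; rewrite inE.
  - by move=> e /EC/alC; rewrite inE negbK.
  - exact: N_gt1.
  - by move=> X X0 XT; rewrite cut_btal; apply: Gc.
(* The third group supplies a crossing edge disjoint from the other two groups. *)
have [w wE] : exists w, w \in Gr i3.
  have [x xA] := set0Pn _ A0.
  have x0 : [set x] != set0 by apply/set0Pn; exists x; rewrite inE.
  have xT : [set x] != setT.
    by apply: contra AT => /eqP h; rewrite eqEsubset subsetT /= -h sub1set.
  case: (set_0Vmem (Gr i3)) => [h|[w wE]]; last by exists w.
  have := leq_trans n2_pos (Gc i3 [set x] x0 xT).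
  by rewrite h /cut big_set0.
have L1E e : e \in L1 -> e \in Gr i1 by move=> /(subsetP L1G)/(subsetP G1E).
have L2E e : e \in L2 -> e \in Gr i2 by move=> /(subsetP L2G)/(subsetP G2E).
pose M := (Gr i1 :\: G1) :|: (Gr i2 :\: G2).
have MC e : e \in M -> e \in C by rewrite !inE => /orP[]/andP[_]/EC; rewrite inE.
have [o ho] := euler_orientation s t M.
pose tl e := if o e then s e else t e; pose hd e := if o e then t e else s e.
pose u v := #|M :&: fibre tl v| %/ D.
pose q := #|E| %/ m; pose r := (#|EA| - #|EB|) %% m; pose j := (#|EA| - #|EB|) %/ m.
have [WA [WAE cWA]] : exists Q : {set E}, Q \subset EA /\ #|Q| = r.
  by apply: subset_of_card; apply: leq_trans (leq_mod _ _) (leq_subr _ _).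
(* The crossing edge is added exactly if the number of copies would otherwise have the wrong parity
   for [target_sum1] and [target_sum2]. *)
pose sb := odd (q + j) (+) odd (#|L1| + #|L2| + r).
pose Wc : {set E} := if sb then [set w] else set0.
have WcP e : e \in Wc -> e = w by rewrite /Wc; case: ifP => _; rewrite inE // => /eqP.
have cWc : #|Wc| = sb by rewrite /Wc; case: ifP => _; rewrite ?cards1 ?cards0.
pose W := WA :|: Wc.
have WAC e : e \in WA -> e \in C = false.
  by move/(subsetP WAE); rewrite !inE => /andP[-> ->].
have WG e jj : e \in W -> e \in Gr jj -> jj = i3.
  rewrite inE => /orP[/WAC h /EC|/WcP -> h]; first by rewrite h.
  exact: Gd h wE.
have sumW (F : E -> nat) : \sum_(e in W) F e = \sum_(e in WA) F e + \sum_(e in Wc) F e.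
  rewrite ![\sum_(e in _) _]big_mkcond -!big_split /=; apply: eq_bigr => e _; rewrite in_setU.
  case: (boolP (e \in WA)) => //= h1; case: (boolP (e \in Wc)) => h2; rewrite ?addn0 //.
  by have := WAC _ h1; rewrite (WcP _ h2) (EC _ _ wE).
have cW : #|W| = r + sb by rewrite -sum1_card sumW !sum1_card cWA cWc.
pose IS := L1 :|: L2 :|: W.
pose I := {e : E | e \in IS}.
have L12 e : e \in L1 -> e \in L2 = false.
  move=> /L1E h1; apply/negbTE/negP => /L2E h2; by have := Gd _ _ _ h1 h2.
have LW1 e : e \in L1 -> e \in W = false.
  by move=> /L1E h1; apply/negbTE/negP => h; have := WG _ _ h h1.
have LW2 e : e \in L2 -> e \in W = false.
  by move=> /L2E h1; apply/negbTE/negP => h; have := WG _ _ h h1.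
have sumIS (F : E -> nat) : \sum_(e in IS) F e =
    \sum_(e in L1) F e + \sum_(e in L2) F e + \sum_(e in W) F e.
  rewrite ![\sum_(e in _) _]big_mkcond -!big_split /=; apply: eq_bigr => e _; rewrite !inE.
  case: (boolP (e \in L1)) => h1; first by rewrite L12 // -in_setU -/W LW1 // !addn0.
  case: (boolP (e \in L2)) => h2; first by rewrite -in_setU -/W LW2 // addn0.
  by rewrite /= -in_setU -/W.
have cIS : #|IS| = #|L1| + #|L2| + r + sb.
  by rewrite -addnA -cW -!sum1_card sumIS.
(* The image of [tv 1], the neighbour of the leaf at which T is rooted. For a split pair it is the
   common end of the two edges, so it does not depend on which of them becomes the leaf edge. *)
pose center e := if e \in L1 then bt e else if e \in L2 then al e else s e.
have outM v : \sum_(e in M) dg1 e v <= 2 * #|M :&: fibre tl v| + 1.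
  have h1 : \sum_(e in M) dg1 e v = #|M :&: fibre tl v| + #|M :&: fibre hd v|.
    rewrite !card_fibre -big_split; apply: eq_bigr => e _; rewrite /dg1 /tl /hd.
    by case: (o e) => //=; rewrite addnC.
  have h2 : (net s t o M v = Posz #|M :&: fibre tl v| - Posz #|M :&: fibre hd v|)%R.
    rewrite !card_fibre !(big_morph Posz PoszD (erefl _)) -GRing.sumrB; apply: eq_bigr => e _.
    by rewrite /tl /hd; case: (o e).
  have := ho v; rewrite h1 h2; clear; move: #|_| #|_| => x y; lia.
have inM v : #|M :&: fibre hd v| <= #|M :&: fibre tl v| + 1.
  have h2 : (net s t o M v = Posz #|M :&: fibre tl v| - Posz #|M :&: fibre hd v|)%R.
    rewrite !card_fibre !(big_morph Posz PoszD (erefl _)) -GRing.sumrB; apply: eq_bigr => e _.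
    by rewrite /tl /hd; case: (o e).
  have := ho v; rewrite h2; clear; move: #|_| #|_| => x y; lia.
have rm : r < m by rewrite ltn_mod.
have cWm : #|W| <= m by rewrite cW; move: rm; rewrite -addn1 => rm'; apply: leq_trans rm'; rewrite leq_add2l leq_b1.
(* The successor makes [u v] positive even where no token starts; [hin] needs this to absorb an
   excess of indegree by 1. *)
have tok v : D * #|fibre (fun i : I => center (val i)) v|.+1 <= #|M :&: fibre tl v|.
  have hfib : #|fibre (fun i : I => center (val i)) v| = \sum_(e in IS) (center e == v).
    rewrite -(sum_sig IS (fun e => center e == v : nat)) -sum1_card big_mkcond; apply: eq_bigr => i _.
    by rewrite inE; case: (_ == v).
  have v0 : [set v] != set0 by apply/set0Pn; exists v; rewrite inE.
  have vT : [set v] != setT.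
    apply/eqP => h; have [x xA] := set0Pn _ A0; have [y yA] := set0Pn _ B0.
    have := in_setT x; have := in_setT y; rewrite -h !inE => /eqP hy /eqP hx.
    by move: yA; rewrite inE hy -hx xA.
  have cutE jj (f : E -> V) : (forall e, e \in Gr jj -> dg1 e v = (f e == v)) ->
      n2 <= #|Gr jj :&: fibre f v|.
    move=> hf; apply: leq_trans (Gc jj _ v0 vT) _.
    rewrite card_fibre /cut; apply: leq_sum => e ej; rewrite !inE.
    have := hf e ej; rewrite /dg1.
    by case: (s e == v); case: (t e == v); case: (f e == v).
  (* At a vertex of [A] only tokens of [L2] and [W] can start, elsewhere only those of [L1] and [W];
     so one group bounds the tokens and supplies the outdegree. *)
  have main (jj : 'I_3) (f : E -> V) (GG LL : {set E}) : GG \subset Gr jj -> LL \subset GG ->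
      Gr jj :\: GG \subset M ->
      (forall e, e \in Gr jj -> dg1 e v = (f e == v)) ->
      K * #|GG :&: fibre f v| <= 2 * #|Gr jj :&: fibre f v| ->
      \sum_(e in IS) (center e == v) <= #|LL :&: fibre f v| + #|W| ->
      D * (\sum_(e in IS) (center e == v)).+1 <= #|M :&: fibre tl v|.
    move=> GGr LG GM hf hsp hs.
    have := tokens_bound (g := #|GG :&: fibre f v|) (d := #|Gr jj :&: fibre f v|)
      (c := \sum_(e in M) dg1 e v) hsp _ (outM v) (cutE jj f hf).
    have hle : #|Gr jj :&: fibre f v| <= \sum_(e in M) dg1 e v + #|GG :&: fibre f v|.
      rewrite (fibre_setD f v GGr) addnC leq_add2r card_fibre.
      rewrite (eq_bigr (fun e => dg1 e v)) => [|e]; last by rewrite inE => /andP[_ /hf ->].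
      by rewrite [X in _ <= X](big_setID (Gr jj :\: GG)) /= (setIidPr GM) leq_addr.
    move=> /(_ hle); apply: leq_trans; rewrite leq_mul2l; apply/orP; right.
    rewrite ltnS; apply: leq_trans hs _; apply: leq_add cWm.
    exact: subset_leq_card (setSI (fibre f v) LG).
  rewrite hfib; case: (boolP (v \in A)) => vA.
    apply: (main i2 al G2 L2) => //; first exact: subsetUr.
    - by move=> e /EC eC; apply: dg1_in.
    - by apply: sp2; rewrite inE vA.
    - rewrite sumIS big1 ?add0n => [|e eL].
        apply: leq_add.
          rewrite card_fibre; apply: leq_sum => e e2; rewrite /center e2.
          by have -> : e \in L1 = false by apply/negbTE/negP => /L12; rewrite e2.
        by rewrite -sum1_card; apply: leq_sum => e _; case: (_ == v).
      rewrite /center eL; case: eqP => // h.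
      by have := btC (EC _ _ (L1E _ eL)); rewrite h vA.
  apply: (main i1 bt G1 L1) => //; first exact: subsetUl.
  - by move=> e /EC eC; apply: dg1_out.
  - exact: sp1.
  - rewrite sumIS; apply: leq_add.
      rewrite [X in _ + X]big1 ?addn0 => [|e eL].
        by rewrite card_fibre; apply: leq_sum => e e1; rewrite /center e1.
      rewrite /center eL; have -> : e \in L1 = false by apply/negbTE/negP => /L12; rewrite eL.
      by case: eqP => // h; have := alC (EC _ _ (L2E _ eL)); rewrite h (negPf vA).
    by rewrite -sum1_card; apply: leq_sum => e _; case: (_ == v).
have D0 : 0 < D by rewrite /D muln_gt0 expn_gt0.
have hu v : #|fibre (fun i : I => center (val i)) v| <= u v.
  by rewrite /u leq_divRL // mulnC; apply: leq_trans (tok v); rewrite leq_mul2l leqnSn orbT.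
have hout v : 2 * 4 ^ m' * u v <= #|M :&: fibre tl v| by rewrite -/D mulnC /u leq_divM.
have hin v : #|M :&: fibre hd v| <= 4 * 4 ^ m' * u v.
  apply: leq_trans (inM v) _; have -> : 4 * 4 ^ m' = 2 * D by rewrite /D mulnA.
  have u1 : 0 < u v.
    by rewrite /u divn_gt0 //; apply: leq_trans (tok v); rewrite leq_pmulr.
  rewrite addn1; apply: leq_trans (ltn_ceil #|M :&: fibre tl v| D0) _.
  by rewrite -/(u v) mulnC -mulnA mulnCA leq_mul2l; move: u1; clear; case: (u v) => // n _; lia.
have [Mj [Mj1 Mj2 Mj3 Mj4]] := nested_classes hout hin.
have [tv [te [pr [hto vs es hpr]]]] := leaf_order hT e0.
rewrite hm in hto vs es hpr.
(* The walks traverse T without its leaf, so indices are shifted by one: [pos n] is the image of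
   [tv n.+1]. By [hpr] the predecessor in [pr jj.+1 - 1] does not truncate. *)
have [|||pos [p0 hpos]] := @token_walks V E I tl hd Mj (fun i : I => center (val i))
    (fun j => pr j.+1 - 1) m'.
- by move=> jj jm; rewrite leq_subLR add1n; apply: (to_pr hto).
- move=> jj v jm _; rewrite Mj2 //; apply: leq_trans (hu v) _.
  by rewrite leq_pmull // expn_gt0.
- move=> i jj v jm hi; have hp : pr jj.+1 <= jj.+1 by apply: (to_pr hto).
  have ij : i < jj by move: hp hi; clear; lia.
  rewrite Mj2 //; apply: leq_trans (Mj3 i v (ltn_trans ij jm)) _.
  by rewrite leq_mul2r leq_exp2l // ij orbT.
have [phi hphi] := fin_all_exists (fun jj : 'I_m' => hpos jj (ltn_ord jj)).
have phiM jj i : phi jj i \in M.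
  by case: (hphi jj) => _ /(_ i)[h _ _]; apply: (subsetP (Mj1 jj (ltn_ord jj))).
(* The degrees used by the walks; they are known before any leaf edge is chosen. *)
pose base v := \sum_(jj < m') \sum_(i : I) dg1 (phi jj i) v.
have cI : #|{: I}| = #|IS| by rewrite card_sig; apply: eq_card.
have baseU (U : {set V}) : (forall e, e \in C -> endsin U e = 1) ->
    \sum_(v in U) base v = m' * #|IS|.
  move=> hU; rewrite /base exchange_big /=.
  rewrite (eq_bigr (fun=> #|IS|)) ?sum_nat_const ?card_ord // => jj _.
  rewrite exchange_big -cI -sum1_card; apply: eq_bigr => i _ /=.
  by rewrite sum_dg1 hU // MC.
have dTU (U : {set V}) : \sum_(v in U) dg s t setT v = \sum_(e in setT) endsin U e.
  by rewrite /dg exchange_big; apply: eq_bigr => e _ /=; rewrite -sum_dg1.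
pose Z v := \sum_(e in W) dg1 e v.
have ZU (U : {set V}) x : (forall e, e \in WA -> endsin U e = x) -> endsin U w = 1 ->
    \sum_(v in U) Z v = x * r + sb.
  move=> hU hw; rewrite /Z exchange_big /= sumW; congr (_ + _).
    rewrite -cWA mulnC -sum_nat_const; apply: eq_bigr => e eW; rewrite sum_dg1; exact: hU.
  by rewrite -cWc -sum1_card; apply: eq_bigr => e /WcP ->; rewrite sum_dg1.
have wC := EC _ _ wE.
have hq : #|EA| + #|EB| + #|C| = m'.+1 * q by rewrite card_edges mulnC divnK.
have hr : #|EA| = #|EB| + r + m'.+1 * j.
  by rewrite -addnA [r + _]addnC [m'.+1 * _]mulnC -divn_eq subnKC.
have hodd : odd (q + j) = odd #|IS|.
  by rewrite cIS [RHS]oddD oddb /sb addbCA addbb addbF.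
(* The factor [2 * m - 1] stands for -1 modulo 2m: the target is the full degree minus all that the
   copies take at [v] apart from the leaf edges of [L1]. *)
pose target1 v := dg s t setT v + (2 * m - 1) * (base v + \sum_(e in L2) (al e == v) + Z v).
pose target2 v := dg s t setT v + (2 * m - 1) * (base v + \sum_(e in L1) (bt e == v) + Z v).
have [|||o1 ho1] := @mod_orientation V E (2 * m) al (fun e => al (p1 e)) L1 A target1 _ _ conn1.
- by rewrite muln_gt0.
- move=> e eL; split; first by apply/alC/EC/L1E.
  by apply/alC/(EC i1)/(subsetP G1E); case: (hp1 e eL).
- rewrite /target1 big_split -big_distrr !big_split /= dTU sum_endsin_A.
  rewrite baseU => [|e /endsin_C[]//]; rewrite (ZU A 2) ?(proj1 (endsin_C wC)) //; last first.
    by move=> e /(subsetP WAE); rewrite inE /endsin => /andP[-> ->].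
  rewrite exchange_big (eq_bigr (fun=> 1)) => [|e eL]; last first.
    by rewrite sum_eq_in (alC (EC _ _ (L2E _ eL))).
  rewrite sum1_card; exact: target_sum1 hr hq cIS hodd.
have [|||o2 ho2] := @mod_orientation V E (2 * m) bt (fun e => bt (p2 e)) L2 (~: A) target2 _ _ conn2.
- by rewrite muln_gt0.
- move=> e eL; rewrite !inE; split; first by apply/btC/EC/L2E.
  by apply/btC/(EC i2)/(subsetP G2E); case: (hp2 e eL).
- rewrite /target2 big_split -big_distrr !big_split /= dTU sum_endsin_B.
  rewrite baseU => [|e /endsin_C[]//]; rewrite (ZU (~: A) 0) ?(proj2 (endsin_C wC)) //; last first.
    by move=> e /(subsetP WAE); rewrite inE /endsin !inE => /andP[-> ->].
  rewrite exchange_big (eq_bigr (fun=> 1)) => [|e eL]; last first.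
    by rewrite sum_eq_in inE (btC (EC _ _ (L1E _ eL))).
  rewrite sum1_card mul0n add0n; exact: target_sum2 hr hq cIS hodd.
(* The tail of a split edge in the modulo orientation is the far end of the leaf edge, so outdegrees
   count leaf edges. *)
pose leaf e := if e \in L1 then (if o1 e then e else p1 e)
  else if e \in L2 then (if o2 e then e else p2 e) else e.
have leaf1 e : e \in L1 -> leaf e \in G1 /\ bt (leaf e) = bt e.
  move=> eL; have [h1 h2 h3] := hp1 e eL; rewrite /leaf eL; case: ifP => // _.
  by rewrite (subsetP L1G).
have leaf2 e : e \in L2 -> leaf e \in G2 /\ al (leaf e) = al e.
  move=> eL; have [h1 h2 h3] := hp2 e eL; rewrite /leaf.
  have -> : e \in L1 = false by apply/negbTE/negP => /L12; rewrite eL.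
  by rewrite eL; case: ifP => // _; rewrite (subsetP L2G).
have leaf3 e : e \in W -> leaf e = e.
  move=> eW; rewrite /leaf; have -> : e \in L1 = false by apply/negbTE/negP => /LW1; rewrite eW.
  by have -> : e \in L2 = false by apply/negbTE/negP => /LW2; rewrite eW.
have i12 : i1 != i2 by [].
have i13 : i1 != i3 by [].
have i23 : i2 != i3 by [].
have ISP e : e \in IS -> [\/ e \in L1, e \in L2 | e \in W].
  by rewrite in_setU in_setU => /orP[/orP[]|] h; [apply: Or31|apply: Or32|apply: Or33].
have leafG1 e : e \in L1 -> leaf e \in Gr i1 by move=> /leaf1[h _]; apply: (subsetP G1E).
have leafG2 e : e \in L2 -> leaf e \in Gr i2 by move=> /leaf2[h _]; apply: (subsetP G2E).
have leafM e : e \in IS -> leaf e \notin M.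
  move=> eI; rewrite in_setU !in_setD; apply/negP => h; case: (ISP e eI) => eL.
  - case/orP: h => /andP[h1 h2]; first by case: (leaf1 e eL) => h3 _; rewrite h3 in h1.
    by have := i12; rewrite (Gd _ _ _ (leafG1 e eL) h2) eqxx.
  - case/orP: h => /andP[h1 h2]; last by case: (leaf2 e eL) => h3 _; rewrite h3 in h1.
    by have := i12; rewrite (Gd _ _ _ (leafG2 e eL) h2) eqxx.
  - rewrite (leaf3 e eL) in h; case/orP: h => /andP[_ h2].
      by have := i13; rewrite (WG _ _ eL h2) eqxx.
    by have := i23; rewrite (WG _ _ eL h2) eqxx.
have leafI e f : e \in IS -> f \in IS -> leaf e = leaf f -> e = f.
  move=> eI fI h; case: (ISP e eI) => eL; case: (ISP f fI) => fL.
  - move: h; rewrite /leaf eL fL; have [_ he _] := hp1 e eL; have [_ hf _] := hp1 f fL.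
    case: ifP => _; case: ifP => _ // h; last exact: p1i h.
      by rewrite -h eL in hf.
    by rewrite h fL in he.
  - by have := i12; have := leafG2 f fL; rewrite -h => h2; rewrite (Gd _ _ _ (leafG1 e eL) h2) eqxx.
  - have := leafG1 e eL; rewrite h (leaf3 f fL) => h2.
    by have := i13; rewrite (WG _ _ fL h2) eqxx.
  - by have := i12; have := leafG2 e eL; rewrite h => h2; rewrite (Gd _ _ _ (leafG1 f fL) h2) eqxx.
  - move: h; rewrite /leaf eL fL; have [_ he _] := hp2 e eL; have [_ hf _] := hp2 f fL.
    have -> : e \in L1 = false by apply/negbTE/negP => /L12; rewrite eL.
    have -> : f \in L1 = false by apply/negbTE/negP => /L12; rewrite fL.
    case: ifP => _; case: ifP => _ // h; last exact: p2i h.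
      by rewrite -h eL in hf.
    by rewrite h fL in he.
  - have := leafG2 e eL; rewrite h (leaf3 f fL) => h2.
    by have := i23; rewrite (WG _ _ fL h2) eqxx.
  - have := leafG1 f fL; rewrite -h (leaf3 e eL) => h2.
    by have := i13; rewrite (WG _ _ eL h2) eqxx.
  - have := leafG2 f fL; rewrite -h (leaf3 e eL) => h2.
    by have := i23; rewrite (WG _ _ eL h2) eqxx.
  - by rewrite -(leaf3 e eL) -(leaf3 f fL).
have btE e : bt e = s e \/ bt e = t e by rewrite /bt; case: ifP; [right|left].
have alE e : al e = s e \/ al e = t e by rewrite /al; case: ifP; [left|right].
have leafC e : e \in IS -> center e = s (leaf e) \/ center e = t (leaf e).
  move=> eI; rewrite /center; case: (ISP e eI) => eL.
  - by rewrite eL; case: (leaf1 e eL) => _ <-.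
  - have -> : e \in L1 = false by apply/negbTE/negP => /L12; rewrite eL.
    by rewrite eL; case: (leaf2 e eL) => _ <-.
  - have -> : e \in L1 = false by apply/negbTE/negP => /LW1; rewrite eL.
    have -> : e \in L2 = false by apply/negbTE/negP => /LW2; rewrite eL.
    by rewrite (leaf3 e eL); left.
pose far (i : I) := if s (leaf (val i)) == center (val i) then t (leaf (val i)) else s (leaf (val i)).
(* Tree edge 0 is the leaf edge; edge [j'.+1] comes from step [j'] of the walk. *)
pose phiF (jj : 'I_m'.+1) (i : I) := if unlift ord0 jj is Some j' then phi j' i else leaf (val i).
pose posF n (i : I) := if n is n'.+1 then pos n' i else far i.
have phiFj jj i : joins (phiF jj i) (posF (pr jj) i) (posF jj.+1 i).
  rewrite /phiF; case: unliftP => [j' ->|->].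
    case: (hphi j') => _ /(_ i)[_]; rewrite lift0.
    have /hpr : 0 < j'.+1 < m'.+1 by exact: (ltn_ord j').
    case: (pr j'.+1) => // n _; rewrite /posF subn1 /= => <- <-.
    by rewrite /joins /tl /hd; case: (o _); rewrite !eqxx ?orbT.
  have -> : pr (ord0 : 'I_m'.+1) = 0 by have := to_pr hto (ltn0Sn m'); rewrite leqn0 => /eqP.
  rewrite /posF p0 /far /joins /=; case: (leafC _ (valP i)) => ->; first by rewrite !eqxx orbT.
  by case: ifP => [/eqP ->|_]; rewrite !eqxx ?orbT.
have phiFi jj i jj' i' : phiF jj i = phiF jj' i' -> jj = jj' /\ i = i'.
  rewrite /phiF; case: unliftP => [j1 ->|->]; case: unliftP => [j2 ->|->] h.
  - have [pj hpj] := hphi j1; have [_ hpj'] := hphi j2.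
    have jj0 : j1 = j2.
      apply: ord_inj; apply: (Mj4 j1 j2 (phi j1 i)); rewrite ?ltn_ord //; first by case: (hpj i).
      by rewrite h; case: (hpj' i').
    by subst j2; split=> //; apply: pj.
  - by have := leafM _ (valP i'); rewrite -h phiM.
  - by have := leafM _ (valP i); rewrite h phiM.
  - by split=> //; apply: val_inj; apply: leafI h; apply: valP.
have decH := dec_tokens hto vs es T0 phiFj phiFi.
set H : {set E} := [set _ | _ in _] in decH.
have HS v : \sum_(e in H) dg1 e v = \sum_(e in IS) dg1 (leaf e) v + base v.
  rewrite /H big_imset /=; last by move=> [a b] [c d] _ _ /= /phiFi[-> ->].
  rewrite -(pair_bigA _ (fun jj i => dg1 (phiF jj i) v)) /= big_ord_recl; congr (_ + _).
    rewrite -(sum_sig IS (fun e => dg1 (leaf e) v)); apply: eq_bigr => i _.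
    by rewrite /phiF unlift_none.
  by apply: eq_bigr => jj _; apply: eq_bigr => i _; rewrite /phiF liftK.
have HA v : \sum_(e in H) dg1 e v = dg s t setT v %[mod 2 * m].
  rewrite HS sumIS.
  have WZ : \sum_(e in W) dg1 (leaf e) v = Z v.
    by apply: eq_bigr => e eW; rewrite leaf3.
  rewrite WZ; case: (boolP (v \in A)) => vA.
    have -> : \sum_(e in L1) dg1 (leaf e) v = \sum_(e in L1) ((if o1 e then al e else al (p1 e)) == v).
      apply: eq_bigr => e eL; rewrite dg1_in ?(EC _ _ (leafG1 e eL)) //.
      by rewrite /leaf eL; case: (o1 e).
    have -> : \sum_(e in L2) dg1 (leaf e) v = \sum_(e in L2) (al e == v).
      apply: eq_bigr => e eL; rewrite dg1_in ?(EC _ _ (leafG2 e eL)) //.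
      by case: (leaf2 e eL) => _ ->.
    rewrite -!addnA -modnDml ho1 // modnDml /target1.
    set B := \sum_(e in L2) _; clear; move: (dg _ _ _ _) (base v) (Z v) => d b z.
    have -> : B + (z + b) = b + B + z by lia.
    exact: mod_predM.
  have vB : v \in ~: A by rewrite inE.
  have -> : \sum_(e in L2) dg1 (leaf e) v = \sum_(e in L2) ((if o2 e then bt e else bt (p2 e)) == v).
    apply: eq_bigr => e eL; rewrite dg1_out ?(EC _ _ (leafG2 e eL)) //.
    have -> : leaf e = if o2 e then e else p2 e; last by case: (o2 e).
    by rewrite /leaf eL; have -> : e \in L1 = false by apply/negbTE/negP => /L12; rewrite eL.
  have -> : \sum_(e in L1) dg1 (leaf e) v = \sum_(e in L1) (bt e == v).
    apply: eq_bigr => e eL; rewrite dg1_out ?(EC _ _ (leafG1 e eL)) //.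
    by case: (leaf1 e eL) => _ ->.
  rewrite [X in X + Z v]addnC -!addnA -modnDml ho2 // modnDml /target2.
  set B := \sum_(e in L1) _; clear; move: (dg _ _ _ _) (base v) (Z v) => d b z.
  have -> : B + (z + b) = b + B + z by lia.
  exact: mod_predM.
have -> : [set: E] = H :|: ~: H by rewrite setUCr.
apply: decU decH _; first by rewrite -setI_eq0 setICr.
apply: dec_eulerian => // v; rewrite hm -/m.
have hdeg : dg s t setT v = \sum_(e in H) dg1 e v + dg s t (~: H) v.
  by rewrite /dg (big_setID H) /= setTI setTD.
by rewrite -(addKn (\sum_(e in H) dg1 e v) (dg s t (~: H) v)) -hdeg -eqn_mod_dvd ?HA // hdeg leq_addr.
Qed.
End Assembly.

(** * From edge-connectivity to a maximum cut *)

Section MainTheorem.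
Variable T : mgraph.
Hypothesis hT : is_tree T.

Lemma no_edges (G : mgraph) : #|edge G| = 0 -> dec T [set: edge G].
Proof.
move=> h; exists set0; split; last by move=> X; rewrite inE.
have -> : [set: edge G] = set0 by apply/eqP; rewrite -cards_eq0 cardsT h.
by apply/and3P; split; rewrite ?inE // /cover ?big_set0 //; apply/trivIsetP => X; rewrite inE.
Qed.

(** The outer 2 is lost to the maximum cut and the next one to packing connected subgraphs, 3 is the
    number of groups, and the rest is [n2]. *)
Definition conn_bound :=
  2 * (2 * (3 * (2 * ((mod_conn (2 * #|edge T|)).+1 * (2 * (8 * (2 * 4 ^ #|edge T|.-1))))))).

Lemma highly_connected_dec (G : mgraph) :
  edge_connected conn_bound G -> #|edge T| %| #|edge G| -> dec T [set: edge G].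
Proof.
rewrite /conn_bound => hG hdiv; case hm: #|edge T| hdiv hG => [|m'].
  (* If T is a single vertex, divisibility by 0 forces G to have no edges. *)
  by rewrite dvd0n => /eqP h _; apply: no_edges.
move=> hdiv hG; case: (posnP #|edge G|) => [|/card_gt0P[e0 _]]; first exact: no_edges.
have [A hA] := max_cut (@src G) (@tgt G).
pose C (B : {set vert G}) := [set e : edge G | (src e \in B) (+) (tgt e \in B)].
pose n := 3 * (2 * ((mod_conn (2 * m'.+1)).+1 * (2 * (8 * (2 * 4 ^ m'))))).
have hcut X : X != set0 -> X != setT -> 2 * n <= cut (@src G) (@tgt G) (C A) X.
  move=> X0 XT; have := leq_trans (edge_connected_cut hG X0 XT) (hA X).
  by rewrite leq_mul2l.
have n0 : 0 < n by rewrite /n !muln_gt0 /= expn_gt0.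
have C0 : C A != set0.
  have x0 : [set src e0] != set0 by apply/set0Pn; exists (src e0); rewrite inE.
  have xT : [set src e0] != setT.
    apply/eqP => h; have := in_setT (tgt e0); rewrite -h inE eq_sym.
    by rewrite (negPf (loopless e0)).
  by apply/eqP => h; have := hcut _ x0 xT; rewrite h /cut big_set0 leqNgt muln_gt0 n0.
have [e1] := set0Pn _ C0; rewrite inE => he1.
have A0 : A != set0 by apply: contraTneq he1 => ->; rewrite !inE.
have AT : A != setT by apply: contraTneq he1 => ->; rewrite !inE.
case: (leqP #|[set e : edge G | (src e \notin A) && (tgt e \notin A)]|
            #|[set e : edge G | (src e \in A) && (tgt e \in A)]|) => hAB.
  exact: (dec_from_cut hT hm hcut A0 AT hAB hdiv).
(* The balancing edges are taken inside the side with more inner edges, so here the two sides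
   exchange names. *)
have CE : C (~: A) = C A.
  by apply/setP => e; rewrite !inE; case: (src e \in A); case: (tgt e \in A).
apply: (@dec_from_cut T G hT m' hm (~: A)) => //.
- by move=> X; rewrite -/(C (~: A)) CE; apply: hcut.
- by apply: contra AT => /eqP h; rewrite -(setCK A) h setC0.
- by apply: contra A0 => /eqP h; rewrite -(setCK A) h setCT.
- apply: leq_trans (leq_trans (ltnW hAB) _).
    by apply: subset_leq_card; apply/subsetP => e; rewrite !inE !negbK.
  by apply: subset_leq_card; apply/subsetP => e; rewrite !inE.
Qed.

End MainTheorem.

Theorem theorem3 (T : mgraph) (hT : is_tree T) :
  exists kh : nat,
    (forall G : mgraph, edge_connected kh G -> #|edge T| %| #|edge G| ->
       T_star_decomposition T G) /\
    (forall G : mgraph, edge_connected kh G -> #|edge T| %| #|edge G| ->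
       girth_gt G (diameter T) -> T_decomposition T G).
Proof.
exists (conn_bound T); split=> [G|G hG hdiv hgirth]; first exact: highly_connected_dec.
have [P [hP hS]] := highly_connected_dec hT hG hdiv; exists P; split=> // S /hS[fV [fE [h1 h2 h3 h4]]].
exists fV, fE; split=> //; case: hT => _ hc _; exact: girth_injective hc hgirth h1 h4.
Qed.
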